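(* The category of minimal (resp. maximal) finite flat commutative group schemes over $\mathcal O_K$ killed by a power of $p$ is abelian.
   Context: $p$ is an odd prime, $k$ a perfect field of characteristic $p$, $K_0=\mathrm{Frac}\,W(k)$, $K$ a finite totally ramified extension of $K_0$ with ring of integers $\mathcal O_K$. Minimal and maximal are in the sense of Raynaud. Let $\mathcal G$ be a finite flat commutative group scheme over $\mathcal O_K$ killed by a power of $p$. The models (prolongations) of the generic fibre $\mathcal G_K$ over $\mathcal O_K$ are ordered by declaring $\mathcal H\ge\mathcal H'$ if there is a morphism of group schemes $\mathcal H\to\mathcal H'$ inducing the identity of $\mathcal G_K$ on generic fibres; this ordered set has a greatest and a smallest element. $\mathcal G$ is maximal (resp. minimal) if it is the greatest (resp. smallest) model of its generic fibre; equivalently, if every morphism $\mathcal H\to\mathcal G$ (resp. $\mathcal G\to\mathcal H$) of finite flat commutative group schemes over $\mathcal O_K$ killed by a power of $p$ that is an isomorphism on generic fibres is an isomorphism. The categories in question are the corresponding full subcategories of the category of finite flat commutative group schemes over $\mathcal O_K$ killed by a power of $p$. *)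

(* Defs.v *)
From HB Require Import structures.
From mathcomp Require Import all_boot all_order all_algebra all_field.
From mathcomp Require Import boolp.

Set Implicit Arguments.
Unset Strict Implicit.
Unset Printing Implicit Defensive.
Import GRing.Theory.
Local Open Scope ring_scope.

(** * Abelian categories *)

Record category := Category {
  obj :> Type;
  hom : obj -> obj -> Type;
  idc : forall X, hom X X;
  comp : forall X Y Z, hom Y Z -> hom X Y -> hom X Z;
  comp_idl : forall X Y (f : hom X Y), comp (idc Y) f = f;
  comp_idr : forall X Y (f : hom X Y), comp f (idc X) = f;
  comp_assoc : forall X Y Z T (h : hom Z T) (g : hom Y Z) (f : hom X Y),
    comp h (comp g f) = comp (comp h g) f }.

Arguments idc {c} X.
Notation "g \oc f" := (comp g f) (at level 50, left associativity).

Definition full_subcategory (C : category) (P : C -> Prop) : category :=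
  @Category {X : C | P X} (fun X Y => hom (sval X) (sval Y))
    (fun X => idc (sval X)) (fun _ _ _ g f => g \oc f)
    (fun _ _ f => comp_idl f) (fun _ _ f => comp_idr f)
    (fun _ _ _ _ h g f => comp_assoc h g f).

Record preadditive (C : category) := Preadditive {
  hadd : forall X Y : C, hom X Y -> hom X Y -> hom X Y;
  hzero : forall X Y : C, hom X Y;
  hopp : forall X Y : C, hom X Y -> hom X Y;
  haddA : forall X Y, associative (@hadd X Y);
  haddC : forall X Y, commutative (@hadd X Y);
  hadd0 : forall X Y, left_id (hzero X Y) (@hadd X Y);
  haddN : forall X Y, left_inverse (hzero X Y) (@hopp X Y) (@hadd X Y);
  comp_addl : forall X Y Z (g h : hom Y Z) (f : hom X Y),
    hadd g h \oc f = hadd (g \oc f) (h \oc f);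
  comp_addr : forall X Y Z (g : hom Y Z) (f h : hom X Y),
    g \oc hadd f h = hadd (g \oc f) (g \oc h) }.

Definition mono (C : category) (X Y : C) (f : hom X Y) : Prop :=
  forall Z (g h : hom Z X), f \oc g = f \oc h -> g = h.

Definition epi (C : category) (X Y : C) (f : hom X Y) : Prop :=
  forall Z (g h : hom Y Z), g \oc f = h \oc f -> g = h.

Definition zero_object (C : category) (Z : C) : Prop :=
  forall X, (exists! f : hom X Z, True) /\ (exists! f : hom Z X, True).

Section Preadditive.
Variables (C : category) (A : preadditive C).

Definition biproduct (X Y P : C) (i1 : hom X P) (i2 : hom Y P)
    (p1 : hom P X) (p2 : hom P Y) : Prop :=
  [/\ p1 \oc i1 = idc X, p2 \oc i2 = idc Y &
      hadd A (i1 \oc p1) (i2 \oc p2) = idc P].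

Definition is_kernel (X Y N : C) (f : hom X Y) (i : hom N X) : Prop :=
  f \oc i = hzero A N Y /\
  forall Z (g : hom Z X), f \oc g = hzero A Z Y -> exists! h, i \oc h = g.

Definition is_cokernel (X Y Q : C) (f : hom X Y) (q : hom Y Q) : Prop :=
  q \oc f = hzero A X Q /\
  forall Z (g : hom Y Z), g \oc f = hzero A X Z -> exists! h, h \oc q = g.

End Preadditive.

Definition abelian_category (C : category) : Prop :=
  exists A : preadditive C,
    (exists Z : C, zero_object Z) /\
    (forall X Y : C, exists (P : C) (i1 : hom X P) (i2 : hom Y P)
       (p1 : hom P X) (p2 : hom P Y), biproduct A i1 i2 p1 p2) /\
    (forall (X Y : C) (f : hom X Y),
       exists (N : C) (i : hom N X), is_kernel A f i) /\
    (forall (X Y : C) (f : hom X Y),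
       exists (Q : C) (q : hom Y Q), is_cokernel A f q) /\
    (forall (X Y : C) (f : hom X Y), mono f ->
       exists (Z : C) (g : hom Y Z), is_kernel A g f) /\
    (forall (X Y : C) (f : hom X Y), epi f ->
       exists (Z : C) (g : hom Z X), is_cokernel A g f).

(** * Affine commutative group schemes *)

Lemma lrmorphism_ext (R : pzRingType) (A B : lalgType R)
  (f g : {lrmorphism A -> B}) : f =1 g -> f = g.
Proof.
move=> /funext; case: f g => [f [[fa] [fm] [fs]]] [g [[ga] [gm] [gs]]] /= fg.
case: _ / fg in ga gm gs *.
by rewrite (Prop_irrelevance fa ga) (Prop_irrelevance fm gm)
  (Prop_irrelevance fs gs).
Qed.

Definition lrid (R : pzRingType) (A : lalgType R) : {lrmorphism A -> A} :=
  [the {lrmorphism A -> A} of idfun].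

Definition lrcomp (R : pzRingType) (A B C : lalgType R)
    (g : {lrmorphism B -> C}) (f : {lrmorphism A -> B}) : {lrmorphism A -> C} :=
  [the {lrmorphism A -> C} of g \o f].

(* G = Spec (coord G), its group law being given on the functor of points
   B |-> Hom (coord G, B), naturally in the R-algebra B.  MathComp algebras
   are nonzero: coord G has a counit to R, and the omitted test algebra
   B = 0 has a single point.  Naturality of the neutral element and of the
   opposite follows from that of the sum. *)
Record group_scheme (R : comNzRingType) := GroupScheme {
  coord : comAlgType R;
  point := fun B : comAlgType R => {lrmorphism coord -> B};
  gadd : forall B, point B -> point B -> point B;
  gzero : forall B, point B;
  gopp : forall B, point B -> point B;
  gaddA : forall B, associative (@gadd B);
  gaddC : forall B, commutative (@gadd B);
  gadd0 : forall B, left_id (gzero B) (@gadd B);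
  gaddN : forall B, left_inverse (gzero B) (@gopp B) (@gadd B);
  gadd_nat : forall (B C : comAlgType R) (f : {lrmorphism B -> C}) x y,
    lrcomp f (@gadd B x y) = @gadd C (lrcomp f x) (lrcomp f y) }.

Arguments point {R} g B.
Arguments gadd {R g B}.
Arguments gzero {R} g B.

Section Morphisms.
Variable R : comNzRingType.

Record gs_hom (G H : group_scheme R) := GsHom {
  comorph : {lrmorphism coord H -> coord G};
  gs_hom_add : forall (B : comAlgType R) (x y : point G B),
    lrcomp (gadd x y) comorph = gadd (lrcomp x comorph) (lrcomp y comorph) }.

Definition on_points (G H : group_scheme R) (f : gs_hom G H)
  (B : comAlgType R) (x : point G B) : point H B := lrcomp x (comorph f).

Lemma gs_hom_ext (G H : group_scheme R) (f g : gs_hom G H) :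
  comorph f =1 comorph g -> f = g.
Proof.
move=> /lrmorphism_ext; case: f g => [f fD] [g gD] /= fg.
by case: _ / fg in gD *; rewrite (Prop_irrelevance fD gD).
Qed.

Lemma gs_id_subproof (G : group_scheme R) (B : comAlgType R) (x y : point G B) :
  lrcomp (gadd x y) (lrid (coord G))
    = gadd (lrcomp x (lrid (coord G))) (lrcomp y (lrid (coord G))).
Proof.
have lrcomp1 (z : point G B) : lrcomp z (lrid (coord G)) = z.
  exact: lrmorphism_ext.
by rewrite !lrcomp1.
Qed.

Definition gs_id (G : group_scheme R) : gs_hom G G :=
  GsHom (@gs_id_subproof G).

Lemma gs_comp_subproof (G H L : group_scheme R) (g : gs_hom H L)
  (f : gs_hom G H) (B : comAlgType R) (x y : point G B) :
  lrcomp (gadd x y) (lrcomp (comorph f) (comorph g))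
    = gadd (lrcomp x (lrcomp (comorph f) (comorph g)))
           (lrcomp y (lrcomp (comorph f) (comorph g))).
Proof.
have lrcompA (z : point G B) : lrcomp z (lrcomp (comorph f) (comorph g))
    = lrcomp (lrcomp z (comorph f)) (comorph g) by exact: lrmorphism_ext.
by rewrite !lrcompA !gs_hom_add.
Qed.

Definition gs_comp (G H L : group_scheme R) (g : gs_hom H L) (f : gs_hom G H) :
  gs_hom G L := GsHom (gs_comp_subproof g f).

Definition group_schemes : category.
Proof.
by exists (group_scheme R) gs_hom gs_id gs_comp => *; exact: gs_hom_ext.
Defined.

(** * Finite flat group schemes *)

Definition finite_module (M : lmodType R) : Prop :=
  exists (n : nat) (e : 'I_n -> M),
    forall m, exists c : 'I_n -> R, m = \sum_i c i *: e i.

Definition bilinear_map (M N P : lmodType R) (b : M -> N -> P) : Prop :=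
  (forall n, linear (b^~ n)) /\ (forall m, linear (b m)).

(* The sum of the m_i (x) n_i vanishes in the tensor product of M and N: by
   the universal property, it is killed by every bilinear map. *)
Definition tensor_vanishes (M N : lmodType R) (s : seq (M * N)) : Prop :=
  forall (P : lmodType R) (b : M -> N -> P), bilinear_map b ->
    \sum_(t <- s) b t.1 t.2 = 0.

(* For every injective f, the induced map f (x) A is injective. *)
Definition flat_module (A : lmodType R) : Prop :=
  forall (M N : lmodType R) (f : {linear M -> N}), injective f ->
  forall s : seq (M * A),
    tensor_vanishes [seq (f t.1, t.2) | t <- s] -> tensor_vanishes s.

Definition finite_flat (G : group_scheme R) : Prop :=
  finite_module (coord G) /\ flat_module (coord G).

Definition gmuln (G : group_scheme R) (B : comAlgType R) (n : nat)
  (x : point G B) : point G B := iter n (gadd x) (gzero G B).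

Definition killed_by_power (p : nat) (G : group_scheme R) : Prop :=
  exists m, forall (B : comAlgType R) (x : point G B),
    gmuln (p ^ m) x = gzero G B.

End Morphisms.

(** * Generic fibres and prolongations *)

Definition restr_scalars (R S : comNzRingType) (j : {rmorphism R -> S})
  (B : comAlgType S) : Type := B.

Section RestrictionOfScalars.
Variables (R S : comNzRingType) (j : {rmorphism R -> S}) (B : comAlgType S).
Local Notation B_R := (restr_scalars j B).

HB.instance Definition _ := GRing.ComNzRing.on B_R.

Let scale (a : R) (b : B_R) : B_R := (j a *: (b : B) : B).

Let scaleA a b v : scale a (scale b v) = scale (a * b) v.
Proof. by rewrite /scale scalerA rmorphM. Qed.
Let scale1 : left_id 1 scale.
Proof. by move=> v; rewrite /scale rmorph1 scale1r. Qed.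
Let scaleDr : right_distributive scale +%R.
Proof. by move=> a u v; exact: (scalerDr (j a) (u : B)). Qed.
Let scaleDl v : {morph scale^~ v : a b / a + b}.
Proof. by move=> a b; rewrite /scale rmorphD scalerDl. Qed.

HB.instance Definition _ :=
  GRing.Zmodule_isLmodule.Build R B_R scaleA scale1 scaleDr scaleDl.

Let scaleAl a (u v : B_R) : a *: (u * v) = (a *: u) * v.
Proof. exact: (scalerAl (j a) (u : B) (v : B)). Qed.

HB.instance Definition _ := GRing.Lmodule_isLalgebra.Build R B_R scaleAl.
HB.instance Definition _ := GRing.Lalgebra_isComAlgebra.Build R B_R.

End RestrictionOfScalars.

Section RestrictionOfMorphisms.
Variables (R S : comNzRingType) (j : {rmorphism R -> S}) (B C : comAlgType S).
Variable f : {lrmorphism B -> C}.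

Definition restr_fun (b : restr_scalars j B) : restr_scalars j C := f b.

Let restr_zmod : zmod_morphism restr_fun.
Proof. by move=> x y; exact: (rmorphB f). Qed.
Let restr_monoid : monoid_morphism restr_fun.
Proof. by split; [exact: (rmorph1 f) | exact: (rmorphM f)]. Qed.
Let restr_scale : scalable restr_fun.
Proof. by move=> a x; exact: (linearZ_LR f (j a)). Qed.

HB.instance Definition _ := GRing.isZmodMorphism.Build
  (restr_scalars j B) (restr_scalars j C) restr_fun restr_zmod.
HB.instance Definition _ := GRing.isMonoidMorphism.Build
  (restr_scalars j B) (restr_scalars j C) restr_fun restr_monoid.
HB.instance Definition _ := GRing.isScalable.Build
  R (restr_scalars j B) (restr_scalars j C) *:%R restr_fun restr_scale.

Definition restr_morphism :
    {lrmorphism restr_scalars j B -> restr_scalars j C} :=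
  [the {lrmorphism restr_scalars j B -> restr_scalars j C} of restr_fun].

End RestrictionOfMorphisms.

Section Prolongations.
Variables (R S : comNzRingType) (j : {rmorphism R -> S}).

(* The base change G_S of G along j : R -> S, as a functor of points: G_S(B)
   is G(B) with B viewed as an R-algebra. *)
Definition fibre_point (G : group_scheme R) (B : comAlgType S) : Type :=
  point G (restr_scalars j B).

(* By Yoneda, isomorphisms of group schemes H_S -> G_S are the natural
   isomorphisms of group-valued functors on S-algebras. *)
Record fibre_iso (H G : group_scheme R) := FibreIso {
  fibre_map : forall B : comAlgType S, fibre_point H B -> fibre_point G B;
  fibre_map_bij : forall B, bijective (@fibre_map B);
  fibre_map_add : forall (B : comAlgType S) (x y : fibre_point H B),
    fibre_map (gadd x y) = gadd (fibre_map x) (fibre_map y);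
  fibre_map_nat : forall (B C : comAlgType S) (f : {lrmorphism B -> C})
      (x : fibre_point H B),
    fibre_map (B := C) (lrcomp (restr_morphism j f) x)
      = lrcomp (restr_morphism j f) (fibre_map x) }.

Lemma fibre_iso_id (G : group_scheme R) : fibre_iso G G.
Proof. by exists (fun _ x => x) => // B; exists id. Defined.

(* A prolongation (over R) of the fibre G_S. *)
Record prolongation (G : group_scheme R) := Prolongation {
  model : group_scheme R;
  model_finite_flat : finite_flat model;
  model_iso : fibre_iso model G }.

Definition self_prolongation (G : group_scheme R) (hG : finite_flat G) :
  prolongation G := Prolongation hG (fibre_iso_id G).

Definition prolongation_ge (G : group_scheme R) (M N : prolongation G) : Prop :=
  exists f : gs_hom (model M) (model N),
    forall (B : comAlgType S) (x : fibre_point (model M) B),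
      fibre_map (model_iso N) (on_points f x : fibre_point (model N) B)
        = fibre_map (model_iso M) x.

Definition maximal (G : group_scheme R) : Prop :=
  exists hG : finite_flat G,
    forall M : prolongation G, prolongation_ge (self_prolongation hG) M.

Definition minimal (G : group_scheme R) : Prop :=
  exists hG : finite_flat G,
    forall M : prolongation G, prolongation_ge M (self_prolongation hG).

Definition maximal_category (p : nat) : category :=
  full_subcategory (C := group_schemes R)
    (fun G => [/\ finite_flat G, killed_by_power p G & maximal G]).

Definition minimal_category (p : nat) : category :=
  full_subcategory (C := group_schemes R)
    (fun G => [/\ finite_flat G, killed_by_power p G & minimal G]).

End Prolongations.

(** * Witt vectors and rings of integers *)

Definition ghost (p : nat) (A : comNzRingType) (a : nat -> A) (n : nat) : A :=
  \sum_(i < n.+1) (p ^ i)%:R * a i ^+ (p ^ (n - i)).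

(* W is the ring W(k) of p-typical Witt vectors: its elements are the
   sequences in k (via wv), with the functorial addition and multiplication
   that make the ghost components additive and multiplicative.  Sums and
   products in k are computed by lifting the sequences to a ring A without
   p-torsion, where a sequence is determined by its ghost components; taking
   for A a polynomial ring over the integers and for a and b sequences of
   distinct variables, c is the sequence of Witt's universal polynomials. *)
Definition is_Witt_ring (p : nat) (k W : comNzRingType) : Prop :=
  exists wv : (nat -> k) -> W, bijective wv /\
  forall (A : comNzRingType) (f : {rmorphism A -> k}),
    (forall x : A, p%:R * x = 0 -> x = 0) ->
  forall a b c : nat -> A,
    ((forall n, ghost p c n = ghost p a n + ghost p b n) ->
       wv (f \o c) = wv (f \o a) + wv (f \o b)) /\
    ((forall n, ghost p c n = ghost p a n * ghost p b n) ->
       wv (f \o c) = wv (f \o a) * wv (f \o b)).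

Definition perfect_field (p : nat) (k : fieldType) : Prop :=
  p \in [pchar k] /\ forall x : k, exists y : k, y ^+ p = x.

Section RingOfIntegers.
Variables (W : idomainType) (K : fieldExtType {fraction W}).

Definition integers : {pred K} :=
  fun x => `[< integralOver (in_alg K \o @tofrac W) x >].

Lemma integers_subring : subring_closed integers.
Proof.
split.
- exact/asboolP/integral1.
- by move=> x y /asboolP hx /asboolP hy; apply/asboolP/integral_sub.
- by move=> x y /asboolP hx /asboolP hy; apply/asboolP/integral_mul.
Qed.

HB.instance Definition _ := GRing.isSubringClosed.Build K integers
  integers_subring.

(* The integral closure of W in the finite extension K of Frac W. *)
Definition ring_of_integers : Type := {x : K | x \in integers}.
HB.instance Definition _ := SubType.on ring_of_integers.
HB.instance Definition _ := Choice.on ring_of_integers.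
HB.instance Definition _ :=
  [SubChoice_isSubComNzRing of ring_of_integers by <:].

Definition integers_incl : {rmorphism ring_of_integers -> K} :=
  [the {rmorphism ring_of_integers -> K} of val].

(* e = [K : Frac W], where W has uniformizer p: some pi generates the
   maximal ideal (the nonunits) and p is a unit times pi ^+ [K : Frac W]. *)
Definition totally_ramified (p : nat) : Prop :=
  let O := ring_of_integers in
  let unit (x : O) := exists y, x * y = 1 in
  exists pi : O, (forall x, ~ unit x <-> exists y, x = y * pi) /\
  exists u : O, unit u /\ p%:R = u * pi ^+ \dim {:K}.

End RingOfIntegers.

(* Main.v *)
From HB Require Import structures.
From mathcomp Require Import all_boot all_order all_algebra all_field.
From mathcomp Require Import boolp ring monalg.
Require Import Defs.

Set Implicit Arguments.
Unset Strict Implicit.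
Unset Printing Implicit Defensive.
Import GRing.Theory Num.Theory.
Local Open Scope ring_scope.

(** Write O for the ring of integers of K.  It is a discrete valuation ring with
    fraction field K, and a finite flat group scheme over O is one whose
    coordinate ring is a free module of finite rank.

    The category C of finite flat group schemes killed by a power of p is
    additive.  It has kernels, the schematic closures of the kernels on generic
    fibres ([kernel_exists]), and cokernels, given by the functions that are
    invariant under translation ([cokernel_exists]).  It is not abelian: a
    bimorphism, that is, a monic and epic morphism, is a morphism that becomes
    invertible on generic fibres, and it need not be invertible over O.  This is
    the only defect.  The exactness properties of the abelian category of
    generic fibres survive in C as two statements: epimorphisms have epic
    pullbacks, and monomorphisms have monic pushouts.

    In every additive category with kernels, cokernels and these two
    properties, the canonical map from the coimage of a morphism to its image is
    a bimorphism.  Call an object M maximal if every bimorphism into M is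
    invertible.  Maps from a maximal object lift through bimorphisms, because a
    pulled back bimorphism is again one; so if every object receives a
    bimorphism from a maximal one, kernels and cokernels in the full subcategory
    of maximal objects are the maximal objects above those of C.  A monomorphism
    between maximal objects is its own coimage, and it has the mapping property
    of the kernel of its cokernel because maps into the image lift through the
    bimorphism from the coimage.  For an epimorphism, that bimorphism ends in
    the target, which is maximal, and so it is invertible.  This is
    [maximal_abelian]; [minimal_abelian] is its dual, the hypotheses being
    self-dual.

    Two points need the condition that G is killed by N = p^m.  Multiplication
    by N is N on the cotangent module of G at the origin, so that N kills this
    module, and the determinant trick produces an integral t on G whose value at
    the origin is N^n, with n the rank of G ([integral_exists]).  The function
    (x, y) |-> t(x - y) is then a Casimir element: up to the scalar N^n, which
    is nonzero in O, it makes the coordinate ring separable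
    ([casimir_of_integral]).  First, separability gives the exactness
    properties: it splits the surjection onto the functions on an image, so an
    image is cut out by invariant functions ([image_indicator],
    [kernel_of_cokernel]), and it averages linear retractions
    ([fibre_product_injective]).  Secondly, the trace formula attached to the
    Casimir element ([casimir_trace]) bounds the failure of a bimorphism X -> Y
    to be invertible: N^n annihilates the cokernel of the map on coordinate
    rings ([generic_mono_bound]).  The valuation of the determinant of that map
    is therefore bounded in terms of X alone or of Y alone
    ([degree_bounded_source], [degree_bounded_target]).  It is additive under
    composition and vanishes only on isomorphisms, so a bimorphism of largest
    degree into a given object comes from a maximal object, and likewise for
    minimal ones.

    It remains to recognize the hypotheses.  Two models of the same generic
    fibre are dominated by a third, the closure of the graph of the
    identification ([graph_closure]); hence the greatest and the smallest models
    are the maximal and the minimal objects above ([maximalP], [minimalP]).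
    That O is a discrete valuation ring follows from total ramification, once it
    is known that no nonzero element of O is infinitely divisible by p.  This
    reduces to W, where multiplication by p is the shift of the p-th powers of
    the components ([witt_mulp]); the universal polynomials behind this formula
    exist by Dwork's criterion in any ring with a lift of Frobenius
    ([ghost_surjective]). *)

(** * Integral categories and their maximal objects *)

Section PreadditiveTheory.
Variables (C : category) (A : preadditive C).
Implicit Types X Y Z : C.
Local Notation "0h" := (hzero A _ _).
Local Notation "f +h g" := (hadd A f g) (at level 50).

Lemma hadd_r0 X Y (f : hom X Y) : f +h 0h = f.
Proof. by rewrite haddC hadd0. Qed.

Lemma hadd_cancel X Y (f g h : hom X Y) : f +h g = f +h h -> g = h.
Proof.
by move=> /(congr1 (hadd A (hopp A f))); rewrite !haddA !haddN !hadd0.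
Qed.

Lemma hopp0 X Y : hopp A (hzero A X Y) = 0h.
Proof. by rewrite -[LHS](hadd_r0) haddN. Qed.

Lemma comp_0r X Y Z (g : hom Y Z) : g \oc hzero A X Y = 0h.
Proof.
apply: (@hadd_cancel _ _ (g \oc hzero A X Y)).
by rewrite -comp_addr hadd0 hadd_r0.
Qed.

Lemma comp_0l X Y Z (f : hom X Y) : hzero A Y Z \oc f = 0h.
Proof.
apply: (@hadd_cancel _ _ (hzero A Y Z \oc f)).
by rewrite -comp_addl hadd0 hadd_r0.
Qed.

Lemma comp_oppr X Y Z (g : hom Y Z) (f : hom X Y) :
  g \oc hopp A f = hopp A (g \oc f).
Proof.
apply: (@hadd_cancel _ _ (g \oc f)).
by rewrite -comp_addr ![f +h _]haddC ![(g \oc f) +h _]haddC !haddN comp_0r.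
Qed.

Lemma comp_oppl X Y Z (g : hom Y Z) (f : hom X Y) :
  hopp A g \oc f = hopp A (g \oc f).
Proof.
apply: (@hadd_cancel _ _ (g \oc f)).
by rewrite -comp_addl ![g +h _]haddC ![(g \oc f) +h _]haddC !haddN comp_0l.
Qed.

Lemma hsub_eq0 X Y (f g : hom X Y) : f +h hopp A g = 0h -> f = g.
Proof.
move=> /(congr1 (fun u => hadd A u g)).
by rewrite -haddA haddN hadd_r0 hadd0.
Qed.

Lemma hsub_self X Y (f : hom X Y) : f +h hopp A f = 0h.
Proof. by rewrite haddC haddN. Qed.

Lemma mono0P X Y (f : hom X Y) :
  (forall Z (g : hom Z X), f \oc g = 0h -> g = 0h) -> mono f.
Proof.
move=> f0 Z g h fgh; apply: hsub_eq0; apply: f0.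
by rewrite comp_addr comp_oppr fgh hsub_self.
Qed.

Lemma epi0P X Y (f : hom X Y) :
  (forall Z (g : hom Y Z), g \oc f = 0h -> g = 0h) -> epi f.
Proof.
move=> f0 Z g h gfh; apply: hsub_eq0; apply: f0.
by rewrite comp_addl comp_oppl gfh hsub_self.
Qed.

Lemma mono_comp0 X Y Z (f : hom X Y) (g : hom Z X) :
  mono f -> f \oc g = 0h -> g = 0h.
Proof. by move=> fm fg; apply: fm; rewrite fg comp_0r. Qed.

Lemma epi_comp0 X Y Z (f : hom X Y) (g : hom Y Z) :
  epi f -> g \oc f = 0h -> g = 0h.
Proof. by move=> fe gf; apply: fe; rewrite gf comp_0l. Qed.

Lemma kernel_mono X Y N (f : hom X Y) (i : hom N X) : is_kernel A f i -> mono i.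
Proof.
move=> [fi ker_i] Z g h igh.
have [|u [_ uniq_u]] := ker_i Z (i \oc g);
  first by rewrite comp_assoc fi comp_0l.
by rewrite -(uniq_u g) // -(uniq_u h).
Qed.

Lemma cokernel_epi X Y Q (f : hom X Y) (q : hom Y Q) :
  is_cokernel A f q -> epi q.
Proof.
move=> [qf coker_q] Z g h gqh.
have [|u [_ uniq_u]] := coker_q Z (g \oc q).
  by rewrite -comp_assoc qf comp_0r.
by rewrite -(uniq_u g) // -(uniq_u h).
Qed.

Lemma kernel_lift X Y N Z (f : hom X Y) (i : hom N X) (g : hom Z X) :
  is_kernel A f i -> f \oc g = 0h -> exists h, i \oc h = g.
Proof. by move=> [_ ker_i] /ker_i[h [ih _]]; exists h. Qed.

Lemma cokernel_lift X Y Q Z (f : hom X Y) (q : hom Y Q) (g : hom Y Z) :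
  is_cokernel A f q -> g \oc f = 0h -> exists h, h \oc q = g.
Proof. by move=> [_ coker_q] /coker_q[h [hq _]]; exists h. Qed.

End PreadditiveTheory.

Definition bimorphism (C : category) (X Y : C) (f : hom X Y) := mono f /\ epi f.

Definition iso (C : category) (X Y : C) (f : hom X Y) :=
  exists g, g \oc f = idc X /\ f \oc g = idc Y.

(** A bimorphism X -> M places X above M; nothing lies properly above M.  Among
    the models of a generic fibre this singles out the greatest ([maximalP]). *)
Definition bi_maximal (C : category) (M : C) :=
  forall X (f : hom X M), bimorphism f -> iso f.

Definition bi_minimal (C : category) (M : C) :=
  forall X (f : hom M X), bimorphism f -> iso f.

Section Composition.
Variable C : category.
Implicit Types X Y Z : C.

Lemma mono_comp X Y Z (g : hom Y Z) (f : hom X Y) :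
  mono g -> mono f -> mono (g \oc f).
Proof. by move=> gm fm T u v; rewrite -!comp_assoc => /gm/fm. Qed.

Lemma epi_comp X Y Z (g : hom Y Z) (f : hom X Y) :
  epi g -> epi f -> epi (g \oc f).
Proof. by move=> ge fe T u v; rewrite !comp_assoc => /fe/ge. Qed.

Lemma bimorphism_comp X Y Z (g : hom Y Z) (f : hom X Y) :
  bimorphism g -> bimorphism f -> bimorphism (g \oc f).
Proof.
by move=> [gm ge] [fm fe]; split; [apply: mono_comp | apply: epi_comp].
Qed.

Lemma comp_epi X Y Z (g : hom Y Z) (f : hom X Y) : epi (g \oc f) -> epi g.
Proof. by move=> e T u v uv; apply: e; rewrite !comp_assoc uv. Qed.

End Composition.

Section Abelian.
Variables (C : category) (A : preadditive C).
Implicit Types X Y Z : C.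

Definition has_kernels := forall X Y (f : hom X Y),
  exists (N : C) (i : hom N X), is_kernel A f i.
Definition has_cokernels := forall X Y (f : hom X Y),
  exists (Q : C) (q : hom Y Q), is_cokernel A f q.
Definition has_biproducts := forall X Y, exists (P : C)
  (i1 : hom X P) (i2 : hom Y P) (p1 : hom P X) (p2 : hom P Y),
  biproduct A i1 i2 p1 p2.

(** Instead of the full universal property, only the joint injectivity of the
    two projections is kept: it makes p2 monic as soon as f is. *)
Definition epi_pullback := forall X Y Z (f : hom X Y) (z : hom Z Y), epi f ->
  exists P (p1 : hom P X) (p2 : hom P Z), [/\ f \oc p1 = z \oc p2, epi p2 &
    forall T (u v : hom T P), p1 \oc u = p1 \oc v -> p2 \oc u = p2 \oc v ->
      u = v].

Definition mono_pushout := forall X Y Z (f : hom Y X) (z : hom Y Z), mono f ->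
  exists P (q1 : hom X P) (q2 : hom Z P), [/\ q1 \oc f = q2 \oc z, mono q2 &
    forall T (u v : hom P T), u \oc q1 = v \oc q1 -> u \oc q2 = v \oc q2 ->
      u = v].

Definition enough_maximals :=
  forall X, exists M (s : hom M X), bi_maximal M /\ bimorphism s.

Definition epi_onto_image := forall X Y Q I (f : hom X Y) (q : hom Y Q)
  (i : hom I Y) (e : hom X I), is_cokernel A f q -> is_kernel A q i ->
  i \oc e = f -> epi e.

Lemma biproduct_proj X Y P (i1 : hom X P) (i2 : hom Y P) (p1 : hom P X)
    (p2 : hom P Y) : biproduct A i1 i2 p1 p2 ->
  p1 \oc i2 = hzero A _ _ /\ p2 \oc i1 = hzero A _ _.
Proof.
move=> [pi1 pi2 sumP]; split.
- suff p1i2p2 : p1 \oc i2 \oc p2 = hzero A _ _.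
    by rewrite -[_ \oc i2]comp_idr -pi2 comp_assoc p1i2p2 comp_0l.
  have := congr1 (fun u => p1 \oc u) sumP.
  rewrite comp_idr comp_addr !comp_assoc pi1 comp_idl -[RHS](hadd_r0 A).
  exact: hadd_cancel.
- suff p2i1p1 : p2 \oc i1 \oc p1 = hzero A _ _.
    by rewrite -[_ \oc i1]comp_idr -pi1 comp_assoc p2i1p1 comp_0l.
  have := congr1 (fun u => p2 \oc u) sumP.
  rewrite comp_idr comp_addr !comp_assoc pi2 comp_idl haddC.
  rewrite -[RHS](hadd_r0 A).
  exact: hadd_cancel.
Qed.

(** Pull back the epimorphism onto the image along a map k killed by the
    pushout: k then lifts, up to an epimorphism, to X, where f detects it. *)
Lemma mono_pushout_of_pullback : has_biproducts -> has_kernels ->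
  has_cokernels -> epi_pullback -> epi_onto_image -> mono_pushout.
Proof.
move=> biprod ker coker pull img X Y Z f z f_mono.
have [B [i1 [i2 [p1 [p2 biB]]]]] := biprod X Z.
have [p1i1 p2i2 sumB] := biB.
have [p1i2 p2i1] := biproduct_proj biB.
pose d := hadd A (i1 \oc f) (hopp A (i2 \oc z)).
have p1d : p1 \oc d = f.
  rewrite comp_addr comp_oppr !comp_assoc p1i1 p1i2 comp_0l comp_idl.
  by rewrite hopp0 hadd_r0.
have p2d : p2 \oc d = hopp A z.
  by rewrite comp_addr comp_oppr !comp_assoc p2i1 p2i2 comp_0l comp_idl hadd0.
have [P [q qd]] := coker _ _ d.
have [I [i iq]] := ker _ _ q.
have [e ie] : exists e, i \oc e = d by apply: kernel_lift iq _; case: qd.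
exists P, (q \oc i1), (q \oc i2); split.
- apply: (@hsub_eq0 _ A); rewrite -!comp_assoc -comp_oppr -comp_addr.
  by case: qd.
- apply: mono0P => N k; rewrite -comp_assoc => /(kernel_lift iq)[h ih].
  have [P' [x [n [xn n_epi _]]]] := pull _ _ _ e h
    (img _ _ _ _ _ _ _ _ qd iq ie).
  have dx : d \oc x = i2 \oc k \oc n.
    by rewrite -ie -ih -!comp_assoc xn.
  have x0 : x = hzero A _ _.
    apply: (mono_comp0 f_mono); rewrite -p1d -comp_assoc dx.
    by rewrite !comp_assoc p1i2 !comp_0l.
  apply: (epi_comp0 n_epi).
  have -> : k \oc n = p2 \oc (d \oc x).
    by rewrite dx !comp_assoc p2i2 comp_idl.
  by rewrite x0 !comp_0r.
- move=> T u v uv1 uv2; apply: (cokernel_epi qd).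
  rewrite -[u \oc q]comp_idr -[v \oc q]comp_idr -sumB !comp_addr !comp_assoc.
  by rewrite -![_ \oc q \oc _]comp_assoc uv1 uv2.
Qed.

End Abelian.

Definition preadditive_full (C : category) (A : preadditive C) (P : C -> Prop) :
  preadditive (full_subcategory P) :=
  @Preadditive (full_subcategory P)
    (fun X Y => @hadd C A (sval X) (sval Y))
    (fun X Y => hzero A (sval X) (sval Y))
    (fun X Y => @hopp C A (sval X) (sval Y))
    (fun X Y => @haddA C A (sval X) (sval Y))
    (fun X Y => @haddC C A (sval X) (sval Y))
    (fun X Y => @hadd0 C A (sval X) (sval Y))
    (fun X Y => @haddN C A (sval X) (sval Y))
    (fun X Y Z => @comp_addl C A (sval X) (sval Y) (sval Z))
    (fun X Y Z => @comp_addr C A (sval X) (sval Y) (sval Z)).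

Section MaximalObjects.
Variables (C : category) (A : preadditive C).
Implicit Types X Y Z : C.
Hypotheses (zero : exists Z : C, zero_object Z) (biprod : has_biproducts A).
Hypotheses (ker : has_kernels A) (coker : has_cokernels A).
Hypotheses (pull : epi_pullback C) (push : mono_pushout C).
Hypothesis enough : enough_maximals C.

(** A map z into the coimage that is killed by g lifts, after pullback along an
    epimorphism, to X; there it lies in the kernel of f, which c kills. *)
Lemma coimage_mono X Y N Q (f : hom X Y) (i : hom N X) (c : hom X Q)
    (g : hom Q Y) :
  is_kernel A f i -> is_cokernel A i c -> g \oc c = f -> mono g.
Proof.
move=> f_i i_c gc; apply: (mono0P (A := A)) => Z z gz.
have [P [w [q [cw q_epi _]]]] := pull z (cokernel_epi i_c).
have [|v iv] := kernel_lift (g := w) f_i.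
  by rewrite -gc -comp_assoc cw comp_assoc gz comp_0l.
by apply: (epi_comp0 q_epi); rewrite -cw -iv comp_assoc i_c.1 comp_0l.
Qed.

Lemma image_epi : epi_onto_image A.
Proof.
move=> X Y Q I f q i e f_q q_i ie; apply: (epi0P (A := A)) => Z z ze.
have [P [w [m [wi m_mono _]]]] := push z (kernel_mono q_i).
have [|v vq] := cokernel_lift (g := w) f_q.
  by rewrite -ie comp_assoc wi -comp_assoc ze comp_0r.
by apply: (mono_comp0 (A := A) m_mono); rewrite -wi -vq -comp_assoc q_i.1
  comp_0r.
Qed.

(** The pullback of a bimorphism is a bimorphism, hence invertible when its
    target is maximal. *)
Lemma maximal_lift M N Y (s : hom N Y) (z : hom M Y) :
  bi_maximal M -> bimorphism s -> exists t, s \oc t = z.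
Proof.
move=> M_max [s_mono s_epi].
have [P [p1 [p2 [sp1 p2_epi p_mono]]]] := pull z s_epi.
have p2_mono : mono p2.
  move=> T u v uv; apply: p_mono => //; apply: s_mono.
  by rewrite !comp_assoc sp1 -!comp_assoc uv.
have [g [_ p2g]] := M_max _ _ (conj p2_mono p2_epi).
by exists (p1 \oc g); rewrite comp_assoc sp1 -comp_assoc p2g comp_idr.
Qed.

Let D := full_subcategory (@bi_maximal C).
Let AD : preadditive D := preadditive_full A (@bi_maximal C).

Let maximal_kernel (X Y : D) (f : hom X Y) (N : C) (i : hom N (sval X))
    (M : D) (s : hom (sval M) N) :
  is_kernel A (f : hom (sval X) (sval Y)) i -> bimorphism s ->
  is_kernel AD f (i \oc s : hom M X).
Proof.
move=> f_i s_bi; split=> [|Z g fg].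
  by rewrite /= comp_assoc f_i.1 comp_0l.
have [h ih] := kernel_lift f_i fg.
have [t st] := maximal_lift h (svalP Z) s_bi.
exists t; split; first by rewrite /= -comp_assoc st.
move=> t' ist'; apply: s_bi.1; rewrite st; apply: (kernel_mono f_i).
by rewrite ih -ist' /= comp_assoc.
Qed.

Let maximal_cokernel (X Y : D) (f : hom X Y) (Q : C) (c : hom (sval Y) Q)
    (M : D) (s : hom (sval M) Q) (q : hom Y M) :
  is_cokernel A (f : hom (sval X) (sval Y)) c -> bimorphism s ->
  s \oc q = c -> is_cokernel AD f q.
Proof.
move=> f_c s_bi sq; split=> [|Z g gf].
  apply: (mono_comp0 (A := A) s_bi.1).
  by have := f_c.1; rewrite -sq -comp_assoc.
have [h hc] := cokernel_lift f_c gf.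
exists (h \oc s); split; first by rewrite /= -comp_assoc sq.
have q_epi : epi (q : hom (sval Y) (sval M)).
  apply: (epi0P (A := A)) => T t tq.
  have [P [w [m [ws m_mono _]]]] := push t s_bi.1.
  apply: (mono_comp0 (A := A) m_mono); rewrite -ws.
  suff -> : w = hzero A _ _ by rewrite comp_0l.
  apply: (epi_comp0 (A := A) (cokernel_epi f_c)).
  by rewrite -sq comp_assoc ws -comp_assoc tq comp_0r.
by move=> h' h'q; apply: q_epi; rewrite -comp_assoc sq hc.
Qed.

Let maximal_mono (X Y : D) (f : hom X Y) :
  mono f -> mono (f : hom (sval X) (sval Y)).
Proof.
move=> f_mono; apply: (mono0P (A := A)) => Z g fg.
have [M [s [M_max s_bi]]] := enough Z.
apply: (epi_comp0 (A := A) s_bi.2).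
apply: (mono_comp0 (A := AD) f_mono (Z := exist _ M M_max) (g := g \oc s)).
by rewrite /= comp_assoc fg comp_0l.
Qed.

Let maximal_epi (X Y : D) (f : hom X Y) :
  epi f -> epi (f : hom (sval X) (sval Y)).
Proof.
move=> f_epi; apply: (epi0P (A := A)) => Z g gf.
have [M [s [M_max s_bi]]] := enough Z.
have [q sq] := maximal_lift g (svalP Y) s_bi.
suff q0 : q = hzero A _ _ by rewrite -sq q0 comp_0r.
apply: (epi_comp0 (A := AD) f_epi (Z := exist _ M M_max)).
apply: (mono_comp0 (A := A) s_bi.1).
by rewrite /= comp_assoc sq gf.
Qed.

(** Kernels and cokernels are maximal objects above those of the ambient
    category.  A morphism factors through a bimorphism e from its coimage to its
    image.  If f is monic its coimage is its source, and maps from maximal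
    objects to the image lift through e to this source; if f is epic its image
    is its target, and maximality of the target makes e invertible. *)
Theorem maximal_abelian : abelian_category D.
Proof.
exists AD; split.
  have [Z Z0] := zero; have [M [s [M_max s_bi]]] := enough Z.
  exists (exist _ M M_max) => X; split; exists (hzero A _ _); split=> // h _.
    apply: s_bi.1; have [[u [_ uniq_u]] _] := Z0 (sval X).
    by rewrite -(uniq_u (s \oc h)) // -(uniq_u (s \oc _)).
  have id0 : idc M = hzero A M M.
    apply: s_bi.1; have [[u [_ uniq_u]] _] := Z0 M.
    by rewrite -(uniq_u (s \oc idc M)) // -(uniq_u (s \oc _)).
  by rewrite -[h]comp_idr /= id0 comp_0r.
split.
  move=> X Y; have [P [i1 [i2 [p1 [p2 [pi1 pi2 sumP]]]]]] :=
    biprod (sval X) (sval Y).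
  have [M [s [M_max s_bi]]] := enough P.
  have [j1 sj1] := maximal_lift i1 (svalP X) s_bi.
  have [j2 sj2] := maximal_lift i2 (svalP Y) s_bi.
  exists (exist _ M M_max), j1, j2, (p1 \oc s), (p2 \oc s); split=> /=.
  - by rewrite -comp_assoc sj1.
  - by rewrite -comp_assoc sj2.
  - apply: s_bi.1; rewrite comp_addr !comp_assoc sj1 sj2 -comp_addl sumP.
    by rewrite comp_idl comp_idr.
split.
  move=> X Y f; have [N [i f_i]] := ker (f : hom (sval X) (sval Y)).
  have [M [s [M_max s_bi]]] := enough N.
  by exists (exist _ M M_max), (i \oc s);
    exact: (maximal_kernel (M := exist _ M M_max) f_i s_bi).
split.
  move=> X Y f; have [Q [c f_c]] := coker (f : hom (sval X) (sval Y)).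
  have [M [s [M_max s_bi]]] := enough Q.
  have [q sq] := maximal_lift c (svalP Y) s_bi.
  by exists (exist _ M M_max), q;
    exact: (maximal_cokernel (M := exist _ M M_max) f_c s_bi sq).
split=> X Y f.
  move=> /maximal_mono f_mono.
  have [Q [c f_c]] := coker (f : hom (sval X) (sval Y)).
  have [M [s [M_max s_bi]]] := enough Q.
  have [q sq] := maximal_lift c (svalP Y) s_bi.
  have f_q := maximal_cokernel (M := exist _ M M_max) f_c s_bi sq.
  exists (exist _ M M_max), q; split; first exact: f_q.1.
  move=> Z g qg.
  have [I [i c_i]] := ker c.
  have [e ie] := kernel_lift c_i f_c.1.
  have e_bi : bimorphism e.
    split; last exact: image_epi f_c c_i ie.
    by move=> T u v uv; apply: f_mono; rewrite -ie -!comp_assoc uv.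
  have [|h ih] := kernel_lift (g := g : hom (sval Z) (sval Y)) c_i.
    by rewrite -sq -comp_assoc [q \oc _]qg comp_0r.
  have [t et] := maximal_lift h (svalP Z) e_bi.
  exists t; split; first by rewrite /= -ie -comp_assoc et.
  by move=> t' ft'; apply: f_mono; rewrite [RHS]ft' -ie -comp_assoc et.
move=> /maximal_epi f_epi.
have [N [i f_i]] := ker (f : hom (sval X) (sval Y)).
have [M [s [M_max s_bi]]] := enough N.
have f_is := maximal_kernel (M := exist _ M M_max) f_i s_bi.
exists (exist _ M M_max), (i \oc s); split; first exact: f_is.1.
move=> Z g gis.
have gi : (g : hom (sval X) (sval Z)) \oc i = hzero A _ _.
  by apply: (epi_comp0 (A := A) s_bi.2); rewrite -comp_assoc.
have [Q [c i_c]] := coker i.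
have [d dc] := cokernel_lift i_c f_i.1.
have d_bi : bimorphism d.
  split; first exact: coimage_mono f_i i_c dc.
  by apply: (@comp_epi _ _ _ _ d c); rewrite dc.
have [h hc] := cokernel_lift i_c gi.
have [b [bd db]] := svalP Y _ _ d_bi.
exists (h \oc b); split.
  by rewrite /= -dc comp_assoc -[h \oc b \oc d]comp_assoc bd comp_idr.
move=> t tf; apply: f_epi; rewrite [RHS]tf.
by rewrite -dc comp_assoc -[h \oc b \oc d]comp_assoc bd comp_idr.
Qed.

End MaximalObjects.

Section Opposite.

Definition opposite (C : category) : category :=
  @Category C (fun X Y => hom Y X) (fun X => idc X) (fun _ _ _ g f => f \oc g)
    (fun _ _ f => comp_idr f) (fun _ _ f => comp_idl f)
    (fun _ _ _ _ h g f => esym (comp_assoc f g h)).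

Definition preadditive_opposite (C : category) (A : preadditive C) :
  preadditive (opposite C) :=
  @Preadditive (opposite C)
    (fun X Y => @hadd C A Y X) (fun X Y => hzero A Y X)
    (fun X Y => @hopp C A Y X) (fun X Y => @haddA C A Y X)
    (fun X Y => @haddC C A Y X) (fun X Y => @hadd0 C A Y X)
    (fun X Y => @haddN C A Y X)
    (fun X Y Z g h f => comp_addr A f g h)
    (fun X Y Z g f h => comp_addl A f h g).

(** The conditions on an abelian category are self-dual, and a full subcategory
    of the opposite category is the opposite of a full subcategory. *)
Lemma abelian_opposite_full (C : category) (P : C -> Prop) :
  abelian_category (full_subcategory (C := opposite C) P) ->
  abelian_category (full_subcategory P).
Proof.
move=> [A [[Z Z0] [biprod [ker [coker [mono_ker epi_coker]]]]]].
pose B : preadditive (full_subcategory P) :=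
  @Preadditive (full_subcategory P)
    (fun X Y => @hadd _ A Y X) (fun X Y => hzero A Y X)
    (fun X Y => @hopp _ A Y X) (fun X Y => @haddA _ A Y X)
    (fun X Y => @haddC _ A Y X) (fun X Y => @hadd0 _ A Y X)
    (fun X Y => @haddN _ A Y X)
    (fun X Y Z g h f => comp_addr A f g h)
    (fun X Y Z g f h => comp_addl A f h g).
exists B; split; first by exists Z => X; have [? ?] := Z0 X.
split.
  move=> X Y; have [S [i1 [i2 [p1 [p2 [pi1 pi2 sumS]]]]]] := biprod X Y.
  by exists S, p1, p2, i1, i2.
split; first by move=> X Y f; have [Q [q f_q]] := coker Y X f; exists Q, q.
split; first by move=> X Y f; have [N [i f_i]] := ker Y X f; exists N, i.
by split=> X Y f; [move=> /(epi_coker Y X f) | move=> /(mono_ker Y X f)].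
Qed.

End Opposite.

Theorem minimal_abelian (C : category) (A : preadditive C) :
  (exists Z : C, zero_object Z) -> has_biproducts A -> has_kernels A ->
  has_cokernels A -> epi_pullback C -> mono_pushout C ->
  (forall X : C, exists M (s : hom X M), bi_minimal M /\ bimorphism s) ->
  abelian_category (full_subcategory (@bi_minimal C)).
Proof.
move=> [Z Z0] biprod ker coker pull push enough.
have bi_op (X Y : C) (f : hom X Y) :
    bimorphism (f : hom (c := opposite C) Y X) <-> bimorphism f.
  by split=> -[fm fe].
have min_op (M : C) : bi_maximal (M : opposite C) <-> bi_minimal M.
  by split=> M_min X f /bi_op/M_min[g [gf fg]]; exists g.
have -> : @bi_minimal C = @bi_maximal (opposite C).
  by apply/funext => M; apply/propext; split=> /min_op.
apply: (@abelian_opposite_full C).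
apply: (@maximal_abelian (opposite C) (preadditive_opposite A)).
- by exists Z => X; have [? ?] := Z0 X.
- move=> X Y; have [S [i1 [i2 [p1 [p2 [pi1 pi2 sumS]]]]]] := biprod X Y.
  by exists S, p1, p2, i1, i2.
- by move=> X Y f; have [Q [q f_q]] := coker Y X f; exists Q, q.
- by move=> X Y f; have [N [i f_i]] := ker Y X f; exists N, i.
- move=> X Y T f z /(push X Y T f z)[S [q1 [q2 [sq q2m qe]]]].
  by exists S, q1, q2.
- move=> X Y T f z /(pull X Y T f z)[S [q1 [q2 [sq q2m qe]]]].
  by exists S, q1, q2.
- move=> X; have [M [s [/min_op M_min /bi_op s_bi]]] := enough X.
  by exists M, s.
Qed.

(** A full subcategory of a full subcategory is again one of the ambient
    category; its objects carry their proofs packed differently, so the abelian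
    structure is transported along a bijection F on objects that is the identity
    on morphisms. *)
Lemma abelian_nested (C : category) (P Q : C -> Prop)
    (M : full_subcategory P -> Prop) :
  (forall X, Q X <-> exists h : P X, M (exist _ X h)) ->
  abelian_category (full_subcategory M) ->
  abelian_category (full_subcategory Q).
Proof.
move=> QPM [A [[Z Z0] [biprod [ker [coker [mono_ker epi_coker]]]]]].
have QP X : Q X -> P X by move=> /QPM[].
have QM X (q : Q X) : M (exist _ X (QP X q)).
  by have [h] := (QPM X).1 q; rewrite (Prop_irrelevance h (QP X q)).
pose F (X : full_subcategory Q) : full_subcategory M :=
  exist _ (exist _ (sval X) (QP _ (svalP X))) (QM _ (svalP X)).
have F_onto Y : exists X, F X = Y.
  case: Y => [[X h] m]; have q : Q X by apply/QPM; exists h.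
  exists (exist _ X q); rewrite /F /=.
  move: (QP _ _) (QM _ _) => h' m'.
  by case: _ / (Prop_irrelevance h h') m' => m';
    rewrite (Prop_irrelevance m m').
pose B : preadditive (full_subcategory Q) :=
  @Preadditive (full_subcategory Q)
    (fun X Y => @hadd _ A (F X) (F Y)) (fun X Y => hzero A (F X) (F Y))
    (fun X Y => @hopp _ A (F X) (F Y)) (fun X Y => @haddA _ A (F X) (F Y))
    (fun X Y => @haddC _ A (F X) (F Y)) (fun X Y => @hadd0 _ A (F X) (F Y))
    (fun X Y => @haddN _ A (F X) (F Y))
    (fun X Y Z => @comp_addl _ A (F X) (F Y) (F Z))
    (fun X Y Z => @comp_addr _ A (F X) (F Y) (F Z)).
have kerF X Y N (f : hom (F X) (F Y)) (i : hom (F N) (F X)) :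
    is_kernel A f i ->
    is_kernel B (f : hom (c := full_subcategory Q) X Y)
      (i : hom (c := full_subcategory Q) N X).
  by move=> [fi ker_i]; split=> // T g /(ker_i (F T)).
have cokerF X Y N (f : hom (F X) (F Y)) (q : hom (F Y) (F N)) :
    is_cokernel A f q ->
    is_cokernel B (f : hom (c := full_subcategory Q) X Y)
      (q : hom (c := full_subcategory Q) Y N).
  by move=> [fi ker_i]; split=> // T g /(ker_i (F T)).
exists B; split.
  have [Z' Z'E] := F_onto Z; rewrite -{}Z'E in Z0.
  by exists Z' => X; apply: (Z0 (F X)).
split.
  move=> X Y; have [S [i1 [i2 [p1 [p2 S_biprod]]]]] := biprod (F X) (F Y).
  have [S' S'E] := F_onto S; case: S / S'E i1 i2 p1 p2 S_biprod => i1 i2 p1 p2.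
  by exists S', i1, i2, p1, p2.
split.
  move=> X Y f; have [N [i f_i]] := ker (F X) (F Y) f.
  have [N' N'E] := F_onto N; case: N / N'E i f_i => i f_i.
  by exists N', i; apply: kerF.
split.
  move=> X Y f; have [N [q f_q]] := coker (F X) (F Y) f.
  have [N' N'E] := F_onto N; case: N / N'E q f_q => q f_q.
  by exists N', q; apply: cokerF.
split=> X Y f f_mono.
  have [|N [g g_f]] := mono_ker (F X) (F Y) f.
    by move=> T; have [T' <-] := F_onto T; apply: f_mono.
  have [N' N'E] := F_onto N; case: N / N'E g g_f => g g_f.
  by exists N', g; apply: kerF.
have [|N [g g_f]] := epi_coker (F X) (F Y) f.
  by move=> T; have [T' <-] := F_onto T; apply: f_mono.
have [N' N'E] := F_onto N; case: N / N'E g g_f => g g_f.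
by exists N', g; apply: cokerF.
Qed.

(** Refining a bimorphism adds to its degree.  If s has the largest degree among
    the bimorphisms into Y, then a bimorphism into its source has degree 0. *)
Lemma enough_maximals_of_degree (C : category)
    (deg : forall X Y : C, hom X Y -> nat -> Prop) :
  (forall X Y (f : hom X Y), bimorphism f -> exists v, deg X Y f v) ->
  (forall X Y Z (g : hom Y Z) (f : hom X Y) v w, bimorphism g ->
     bimorphism f -> deg _ _ g v -> deg _ _ f w ->
       deg _ _ (g \oc f) (v + w)%N) ->
  (forall X Y (f : hom X Y), bimorphism f -> deg _ _ f 0 -> iso f) ->
  (forall Y, exists N, forall X (f : hom X Y) v,
     bimorphism f -> deg _ _ f v -> v <= N)%N ->
  enough_maximals C.
Proof.
move=> deg_ex deg_comp deg0 deg_bound Y; have [N leN] := deg_bound Y.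
pose reached v := `[< exists X (f : hom X Y), bimorphism f /\ deg _ _ f v >].
have id_bi : bimorphism (idc Y).
  by split=> T u v; rewrite ?comp_idl ?comp_idr.
have [v0 v0P] := deg_ex _ _ _ id_bi.
have ex_v : exists v, reached v by exists v0; apply/asboolP; exists Y, (idc Y).
have max_v v : reached v -> (v <= N)%N.
  by move=> /asboolP[X [f [f_bi]]]; apply: leN.
case: (ex_maxnP ex_v max_v) => v /asboolP[M [s [s_bi s_v]]] v_max.
exists M, s; split=> // X f f_bi.
have [w f_w] := deg_ex _ _ _ f_bi.
have : reached (v + w)%N.
  apply/asboolP; exists X, (s \oc f); split; first exact: bimorphism_comp.
  exact: deg_comp.
move=> /v_max; rewrite -{2}[v]addn0 leq_add2l leqn0 => /eqP w0.
by apply: deg0 => //; rewrite w0 in f_w.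
Qed.

Lemma enough_minimals_of_degree (C : category)
    (deg : forall X Y : C, hom X Y -> nat -> Prop) :
  (forall X Y (f : hom X Y), bimorphism f -> exists v, deg X Y f v) ->
  (forall X Y Z (g : hom Y Z) (f : hom X Y) v w, bimorphism g ->
     bimorphism f -> deg _ _ g v -> deg _ _ f w ->
       deg _ _ (g \oc f) (v + w)%N) ->
  (forall X Y (f : hom X Y), bimorphism f -> deg _ _ f 0 -> iso f) ->
  (forall X, exists N, forall Y (f : hom X Y) v,
     bimorphism f -> deg _ _ f v -> v <= N)%N ->
  forall X : C, exists M (s : hom X M), bi_minimal M /\ bimorphism s.
Proof.
move=> deg_ex deg_comp deg0 deg_bound X.
have bi_op (Z Y : C) (f : hom Z Y) :
    bimorphism (f : hom (c := opposite C) Y Z) <-> bimorphism f.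
  by split=> -[fm fe].
have [||||M [s [M_max /bi_op s_bi]]] :=
    @enough_maximals_of_degree (opposite C) (fun Y Z => deg Z Y) _ _ _ _ X.
- by move=> Y Z f /bi_op/deg_ex.
- move=> T Y Z g f v w /bi_op g_bi /bi_op f_bi g_v f_w.
  by rewrite addnC; apply: deg_comp.
- by move=> Y Z f /bi_op f_bi /(deg0 _ _ _ f_bi)[g [gf fg]]; exists g.
- move=> Y; have [N leN] := deg_bound Y; exists N => Z f v /bi_op.
  exact: leN.
- exists M, s; split=> // Y f f_bi.
  by have [|g [gf fg]] := M_max Y f; [apply/bi_op | exists g].
Qed.

(** * Free algebras and their base changes *)

Section Morphisms.
Variables (R : comNzRingType).

Lemma lrmorphism_of (A B : comAlgType R) (f : A -> B) :
  {morph f : x y / x + y} -> {morph f : x y / x * y} -> f 1 = 1 ->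
  scalable f -> exists g : {lrmorphism A -> B}, g =1 f.
Proof.
move=> fD fM f1 fZ.
have f0 : f 0 = 0 by rewrite -(scale0r 0) fZ scale0r.
have fB : zmod_morphism f.
  by move=> x y; rewrite fD -scaleN1r fZ scaleN1r.
have fm : monoid_morphism f by [].
pose m1 := GRing.isZmodMorphism.Build A B f fB.
pose m2 := GRing.isMonoidMorphism.Build A B f fm.
pose m3 := GRing.isScalable.Build R A B *:%R f fZ.
pose g : {lrmorphism A -> B} := HB.pack_for {lrmorphism A -> B} f m1 m2 m3.
by exists g.
Qed.

Lemma factor_surj (A B C : comAlgType R) (q : {lrmorphism A -> C})
    (g : {lrmorphism A -> B}) :
  (forall c, exists a, q a = c) -> (forall a, q a = 0 -> g a = 0) ->
  exists h : {lrmorphism C -> B}, lrcomp h q = g.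
Proof.
move=> q_onto kerq; pose s c := sval (cid (q_onto c)).
have sK c : q (s c) = c by rewrite /s; case: cid.
have gE a a' : q a = q a' -> g a = g a'.
  move=> qa; apply/subr0_eq; rewrite -rmorphB; apply: kerq.
  by rewrite rmorphB /= qa subrr.
have [||||h hE] := @lrmorphism_of C B (g \o s).
- by move=> x y; rewrite /= -rmorphD; apply: gE; rewrite rmorphD /= !sK.
- by move=> x y; rewrite /= -rmorphM; apply: gE; rewrite rmorphM /= !sK.
- by rewrite /= -(rmorph1 g); apply: gE; rewrite rmorph1 sK.
- by move=> a x; rewrite /= -linearZ; apply: gE; rewrite linearZ /= !sK.
exists h; apply: lrmorphism_ext => a; rewrite /= hE; apply: gE.
by rewrite sK.
Qed.

Lemma factor_inj (A B C : comAlgType R) (i : {lrmorphism C -> A})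
    (g : {lrmorphism B -> A}) :
  injective i -> (forall b, exists c, i c = g b) ->
  exists h : {lrmorphism B -> C}, lrcomp i h = g.
Proof.
move=> i_inj img; pose s b := sval (cid (img b)).
have sK b : i (s b) = g b by rewrite /s; case: cid.
have [||||h hE] := @lrmorphism_of B C s.
- by move=> x y; apply: i_inj; rewrite rmorphD /= !sK rmorphD.
- by move=> x y; apply: i_inj; rewrite rmorphM /= !sK rmorphM.
- by apply: i_inj; rewrite rmorph1 sK rmorph1.
- by move=> a x; apply: i_inj; rewrite linearZ /= !sK linearZ.
by exists h; apply: lrmorphism_ext => b; rewrite /= hE sK.
Qed.

Lemma lrcompA (A B C D : comAlgType R) (h : {lrmorphism C -> D})
    (g : {lrmorphism B -> C}) (f : {lrmorphism A -> B}) :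
  lrcomp h (lrcomp g f) = lrcomp (lrcomp h g) f.
Proof. exact: lrmorphism_ext. Qed.

Lemma lrcomp_id (A B : comAlgType R) (f : {lrmorphism A -> B}) :
  lrcomp (lrid B) f = f.
Proof. exact: lrmorphism_ext. Qed.

Lemma lrid_comp (A B : comAlgType R) (f : {lrmorphism A -> B}) :
  lrcomp f (lrid A) = f.
Proof. exact: lrmorphism_ext. Qed.

Lemma lrcomp_inj (A B C : comAlgType R) (g : {lrmorphism B -> C})
    (x y : {lrmorphism A -> B}) :
  injective g -> lrcomp g x = lrcomp g y -> x = y.
Proof.
move=> g_inj gxy; apply: lrmorphism_ext => a; apply: g_inj.
exact: (congr1 (fun z : {lrmorphism A -> C} => z a) gxy).
Qed.

Lemma lrcomp_surj (A B C : comAlgType R) (g : {lrmorphism A -> B})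
    (x y : {lrmorphism B -> C}) :
  (forall b, exists a, g a = b) -> lrcomp x g = lrcomp y g -> x = y.
Proof.
move=> g_onto xyg; apply: lrmorphism_ext => b; have [a <-] := g_onto b.
exact: (congr1 (fun z : {lrmorphism A -> C} => z a) xyg).
Qed.

End Morphisms.

Definition free_on (R : comNzRingType) (M : lmodType R) n (e : 'I_n -> M)
    (c : {linear M -> 'rV[R]_n}) :=
  (forall m, m = \sum_i c m 0 i *: e i) /\
  (forall i, c (e i) = delta_mx 0 i).

Definition free_mod (R : comNzRingType) (M : lmodType R) :=
  exists n (e : 'I_n -> M) (c : {linear M -> 'rV[R]_n}), free_on e c.

Definition torsion_free (R : comNzRingType) (M : lmodType R) :=
  forall (d : R) (m : M), d != 0 -> d *: m = 0 -> m = 0.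

Notation alg_of h := (restr_scalars h _^o).

Section BaseChange.
Variables (R S : comNzRingType) (j : {rmorphism R -> S}) (A : comAlgType R).
Variables (n : nat) (e : 'I_n -> A) (c : {linear A -> 'rV[R]_n}).
Hypothesis ec : free_on e c.

(** The tensor product of A with S over R, built from the structure constants of
    A in the basis e. *)
Definition base_change of {rmorphism R -> S} & free_on e c := 'rV[S]_n.
Local Notation T := (base_change j ec).
HB.instance Definition _ := GRing.Lmodule.on T.

Definition bc_in (a : A) : T := map_mx j (c a).

Lemma bc_inD a b : bc_in (a + b) = bc_in a + bc_in b.
Proof. by rewrite /bc_in linearD map_mxD. Qed.

Lemma bc_inZ r a : bc_in (r *: a) = j r *: bc_in a.
Proof. by apply/rowP => i; rewrite /bc_in linearZ !mxE rmorphM. Qed.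

Lemma bc_in0 : bc_in 0 = 0.
Proof. by rewrite /bc_in linear0 map_mx0. Qed.

Lemma bc_in_sum I (r : seq I) (P : pred I) F :
  bc_in (\sum_(i <- r | P i) F i) = \sum_(i <- r | P i) bc_in (F i).
Proof. exact: (big_morph bc_in bc_inD bc_in0). Qed.

Lemma bc_in_basis i : bc_in (e i) = delta_mx 0 i.
Proof. by rewrite /bc_in ec.2 map_delta_mx. Qed.

Lemma bc_sum (u : T) : u = \sum_i u 0 i *: bc_in (e i).
Proof.
rewrite [LHS]row_sum_delta; apply: eq_bigr => i _.
by rewrite bc_in_basis.
Qed.

Definition bc_mul (u v : T) : T :=
  \sum_i \sum_k (u 0 i * v 0 k) *: bc_in (e i * e k).

Lemma bc_mulC : commutative bc_mul.
Proof.
move=> u v; rewrite /bc_mul exchange_big; apply: eq_bigr => i _.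
by apply: eq_bigr => k _; rewrite mulrC [e k * _]mulrC.
Qed.

Lemma bc_mulDl : left_distributive bc_mul +%R.
Proof.
move=> u v w; rewrite /bc_mul -big_split; apply: eq_bigr => i _ /=.
by rewrite -big_split; apply: eq_bigr => k _ /=; rewrite mxE mulrDl scalerDl.
Qed.

Lemma bc_mulDr : right_distributive bc_mul +%R.
Proof. by move=> u v w; rewrite !(bc_mulC u) bc_mulDl. Qed.

Lemma bc_mulZl s u v : bc_mul (s *: u) v = s *: bc_mul u v.
Proof.
rewrite /bc_mul scaler_sumr; apply: eq_bigr => i _.
by rewrite scaler_sumr; apply: eq_bigr => k _; rewrite mxE scalerA mulrA.
Qed.

Lemma bc_mulZr s u v : bc_mul u (s *: v) = s *: bc_mul u v.
Proof. by rewrite !(bc_mulC u) bc_mulZl. Qed.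

Lemma bc_inM a b : bc_in (a * b) = bc_mul (bc_in a) (bc_in b).
Proof.
rewrite {1}[a]ec.1 {1}[b]ec.1 mulr_suml bc_in_sum; apply: eq_bigr => i _.
rewrite mulr_sumr bc_in_sum; apply: eq_bigr => k _.
by rewrite -scalerAl -scalerAr scalerA bc_inZ rmorphM !mxE.
Qed.

Lemma bc_ind (P : T -> Prop) :
  (forall u v, P u -> P v -> P (u + v)) -> (forall s u, P u -> P (s *: u)) ->
  (forall a, P (bc_in a)) -> forall u, P u.
Proof.
move=> PD PZ Pin u; rewrite [u]bc_sum; apply: (big_ind P) => //.
  by rewrite -bc_in0.
by move=> i _; apply: PZ.
Qed.

Lemma bc_mulA : associative bc_mul.
Proof.
move=> u v w; elim/bc_ind: u => [u u' IH IH'|s u IH|a].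
- by rewrite !bc_mulDl IH IH'.
- by rewrite !bc_mulZl IH.
elim/bc_ind: v => [u u' IH IH'|s u IH|b].
- by rewrite !bc_mulDl !bc_mulDr IH IH' bc_mulDl.
- by rewrite bc_mulZl !bc_mulZr IH bc_mulZl.
elim/bc_ind: w => [u u' IH IH'|s u IH|d].
- by rewrite !bc_mulDr IH IH'.
- by rewrite !bc_mulZr IH.
by rewrite -!bc_inM mulrA.
Qed.

Lemma bc_mul1 : left_id (bc_in 1) bc_mul.
Proof.
move=> u; elim/bc_ind: u => [u u' IH IH'|s u IH|a].
- by rewrite bc_mulDr IH IH'.
- by rewrite bc_mulZr IH.
by rewrite -bc_inM mul1r.
Qed.

(** The base change is nonzero because A is: a basis vector of A stays nonzero
    there, and it is a multiple of 1. *)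
Lemma bc_1_neq0 : bc_in 1 != 0.
Proof.
have i0 : 'I_n.
  case: n e c ec => [|m] e' c' [ec' _]; last exact: ord0.
  have := ec' 1; rewrite big_ord0 => /eqP; rewrite oner_eq0 //.
apply/eqP => in1; have := bc_mul1 (bc_in (e i0)).
rewrite in1 /bc_mul => /rowP/(_ i0).
rewrite bc_in_basis mxE !eqxx big1 ?mxE => [/eqP|i _].
  by rewrite eq_sym oner_eq0.
by rewrite big1 // => k _; rewrite mxE mul0r scale0r.
Qed.

HB.instance Definition _ := GRing.Zmodule_isComNzRing.Build T bc_mulA bc_mulC
  bc_mul1 bc_mulDl bc_1_neq0.

Definition bc_const (s : S) : T := s *: (1 : T).

Lemma bc_const_zmod : zmod_morphism bc_const.
Proof. by move=> s t; rewrite /bc_const scalerBl. Qed.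

Lemma bc_const_monoid : monoid_morphism bc_const.
Proof.
split=> [|s t]; first by rewrite /bc_const scale1r.
rewrite /bc_const [RHS](bc_mulZl s 1) -scalerA; congr (_ *: _).
by rewrite [RHS](bc_mul1 _).
Qed.

HB.instance Definition _ :=
  GRing.isZmodMorphism.Build S T bc_const bc_const_zmod.
HB.instance Definition _ :=
  GRing.isMonoidMorphism.Build S T bc_const bc_const_monoid.

Lemma bc_constM s u : bc_const s * u = s *: u.
Proof.
by rewrite /bc_const [LHS](bc_mulZl s 1); congr (_ *: _); apply: bc_mul1.
Qed.

(** A pair of compatible ring homomorphisms from S and from A extends to the
    base change, as the products of basis vectors are the same there. *)
Lemma bc_lift (C : comNzRingType) (y : {rmorphism S -> C}) (x : A -> C) :
  {morph x : a b / a + b} -> {morph x : a b / a * b} -> x 1 = 1 ->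
  (forall r a, x (r *: a) = y (j r) * x a) ->
  exists h : T -> C, [/\ {morph h : u v / u + v}, {morph h : u v / u * v},
    forall a, h (bc_in a) = x a & forall s u, h (s *: u) = y s * h u].
Proof.
move=> xD xM x1 xZ; pose h (u : T) := \sum_i y (u 0 i) * x (e i).
have x0 : x 0 = 0 by rewrite -(scale0r 0) xZ !rmorph0 mul0r.
have hD : {morph h : u v / u + v}.
  move=> u v; rewrite /h -big_split; apply: eq_bigr => i _ /=.
  by rewrite mxE rmorphD mulrDl.
have hZ s u : h (s *: u) = y s * h u.
  rewrite /h mulr_sumr; apply: eq_bigr => i _.
  by rewrite mxE rmorphM mulrA.
have hin a : h (bc_in a) = x a.
  rewrite {2}[a]ec.1 (big_morph x xD x0); apply: eq_bigr => i _.
  by rewrite mxE xZ.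
exists h; split=> // u v; elim/bc_ind: u => [u u' IH IH'|s u IH|a].
- by rewrite mulrDl !hD IH IH' mulrDl.
- by rewrite [s *: u * v](bc_mulZl s u v) !hZ -mulrA -IH.
elim/bc_ind: v => [u u' IH IH'|s u IH|b].
- by rewrite mulrDr !hD IH IH' mulrDr.
- by rewrite [_ * (s *: u)](bc_mulZr s _ u) !hZ mulrCA -IH.
by rewrite [_ * _](esym (bc_inM a b)) !hin xM.
Qed.

End BaseChange.

Section Quotients.
Local Open Scope quotient_scope.
Variables (R : comNzRingType) (A : comAlgType R).

Section Quotient.
Variable J : A -> Prop.
Hypotheses (J1 : ~ J 1) (J0 : J 0).
Hypothesis JM : forall a x y, J x -> J y -> J (a * x + y).

Let Jb : {pred A} := fun a => `[< J a >].
Let Jb_ideal : idealr_closed Jb.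
Proof.
split; [exact/asboolP | exact/asboolP |].
by move=> a x y /asboolP Jx /asboolP Jy; apply/asboolP/JM.
Qed.
HB.instance Definition _ := isIdealr.Build A Jb Jb_ideal.
Let Q := {ideal_quot (Jb : idealr A)}.
Let proj (a : A) : Q := \pi_Q a.
Let proj_zmod : zmod_morphism proj. Proof. exact: rmorphB. Qed.
Let proj_monoid : monoid_morphism proj.
Proof. by split; [exact: rmorph1 | exact: rmorphM]. Qed.
HB.instance Definition _ := GRing.isZmodMorphism.Build A Q proj proj_zmod.
HB.instance Definition _ := GRing.isMonoidMorphism.Build A Q proj proj_monoid.

Let scalar (r : R) : Q := proj r%:A.
Let scalar_zmod : zmod_morphism scalar.
Proof. by move=> r s; rewrite /scalar scalerBl rmorphB. Qed.
Let scalar_monoid : monoid_morphism scalar.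
Proof.
split=> [|r s]; first by rewrite /scalar scale1r rmorph1.
by rewrite /scalar -rmorphM /= -scalerAl mul1r scalerA.
Qed.
HB.instance Definition _ := GRing.isZmodMorphism.Build R Q scalar scalar_zmod.
HB.instance Definition _ :=
  GRing.isMonoidMorphism.Build R Q scalar scalar_monoid.

Lemma quotient_algebra : exists (C : comAlgType R) (q : {lrmorphism A -> C}),
  (forall c, exists a, q a = c) /\ (forall a, q a = 0 <-> J a).
Proof.
exists (alg_of scalar : comAlgType R).
have [||||q qE] := @lrmorphism_of R A (alg_of scalar) proj.
- exact: rmorphD.
- exact: rmorphM.
- exact: rmorph1.
- by move=> r x; rewrite -{1}[x]mul1r scalerAl rmorphM.
exists q; split=> [c|a].
  by exists (repr (c : Q)); rewrite qE; apply: reprK.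
rewrite qE -(rmorph0 proj); split=> [qa|Ja]; last first.
  apply/eqP; rewrite -[_ == _]Quotient.idealrBE subr0; exact/asboolP.
by apply/asboolP; rewrite -[`[<_>]]/(a \in Jb) -[a]subr0 Quotient.idealrBE;
  apply/eqP.
Qed.

End Quotient.

Section Subalgebra.
Variable D : A -> Prop.
Hypotheses (D1 : D 1) (DB : forall x y, D x -> D y -> D (x - y)).
Hypotheses (DM : forall x y, D x -> D y -> D (x * y)).
Hypothesis DZ : forall r x, D x -> D (r *: x).

Let Db : {pred A} := fun a => `[< D a >].
Let Db_subring : subring_closed Db.
Proof.
split; first exact/asboolP.
- by move=> x y /asboolP Dx /asboolP Dy; apply/asboolP/DB.
- by move=> x y /asboolP Dx /asboolP Dy; apply/asboolP/DM.
Qed.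
HB.instance Definition _ := GRing.isSubringClosed.Build A Db Db_subring.
Let U := {x : A | x \in Db}.
HB.instance Definition _ := SubType.on U.
HB.instance Definition _ := Choice.on U.
HB.instance Definition _ := [SubChoice_isSubComNzRing of U by <:].

Let scalar_in (r : R) : r%:A \in Db.
Proof. by apply/asboolP/DZ. Qed.
Let scalar (r : R) : U := exist _ r%:A (scalar_in r).
Let scalar_zmod : zmod_morphism scalar.
Proof. by move=> r s; apply: val_inj; rewrite /= scalerBl. Qed.
Let scalar_monoid : monoid_morphism scalar.
Proof.
split=> [|r s]; apply: val_inj; first by rewrite /= scale1r.
by rewrite /= -scalerAl mul1r scalerA.
Qed.
HB.instance Definition _ := GRing.isZmodMorphism.Build R U scalar scalar_zmod.
HB.instance Definition _ :=
  GRing.isMonoidMorphism.Build R U scalar scalar_monoid.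

Lemma subalgebra : exists (C : comAlgType R) (i : {lrmorphism C -> A}),
  injective i /\ (forall a, D a <-> exists c, i c = a).
Proof.
exists (alg_of scalar : comAlgType R).
have [||||i iE] := @lrmorphism_of R (alg_of scalar) A (fun u : U => val u).
- by [].
- by [].
- by [].
- move=> r x; change (val (scalar r * (x : U)) = r *: val (x : U)).
  by rewrite /= -scalerAl mul1r.
exists i; split=> [x y|a]; first by rewrite !iE => /val_inj.
split=> [Da|[c <-]]; last by rewrite iE; apply/asboolP/(valP (c : U)).
have Dba : a \in Db by apply/asboolP.
by exists (exist _ a Dba : U); rewrite iE.
Qed.

End Subalgebra.

End Quotients.

Section Tensor.
Variable R : comNzRingType.

Lemma linear_of (M N : lmodType R) (f : M -> N) :
  linear f -> exists g : {linear M -> N}, g =1 f.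
Proof.
move=> f_lin; pose m := GRing.isLinear.Build R M N *:%R f f_lin.
by exists (HB.pack_for {linear M -> N} f m).
Qed.

Lemma bilinearD1 (M N P : lmodType R) (b : M -> N -> P) x y n :
  bilinear_map b -> b (x + y) n = b x n + b y n.
Proof. by move=> [b_lin _]; have := b_lin n 1 x y; rewrite !scale1r. Qed.

Lemma bilinearD2 (M N P : lmodType R) (b : M -> N -> P) x y m :
  bilinear_map b -> b m (x + y) = b m x + b m y.
Proof. by move=> [_ b_lin]; have := b_lin m 1 x y; rewrite !scale1r. Qed.

Lemma bilinear01 (M N P : lmodType R) (b : M -> N -> P) n :
  bilinear_map b -> b 0 n = 0.
Proof.
by move=> bb; apply: (addIr (b 0 n)); rewrite -bilinearD1 // !add0r.
Qed.

Lemma bilinear02 (M N P : lmodType R) (b : M -> N -> P) m :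
  bilinear_map b -> b m 0 = 0.
Proof.
by move=> bb; apply: (addIr (b m 0)); rewrite -bilinearD2 // !add0r.
Qed.

Lemma bilinearZ1 (M N P : lmodType R) (b : M -> N -> P) r x n :
  bilinear_map b -> b (r *: x) n = r *: b x n.
Proof.
move=> bb; have [b_lin _] := bb.
by have := b_lin n r x 0; rewrite addr0 bilinear01 // addr0.
Qed.

Lemma bilinearZ2 (M N P : lmodType R) (b : M -> N -> P) r x m :
  bilinear_map b -> b m (r *: x) = r *: b m x.
Proof.
move=> bb; have [_ b_lin] := bb.
by have := b_lin m r x 0; rewrite addr0 bilinear02 // addr0.
Qed.

Lemma bilinear_sum1 (M N P : lmodType R) (b : M -> N -> P) n I (r : seq I)
    (Q : pred I) F : bilinear_map b ->
  b (\sum_(i <- r | Q i) F i) n = \sum_(i <- r | Q i) b (F i) n.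
Proof.
move=> bb; apply: (big_morph (b^~ n)) => [x y|]; last exact: bilinear01.
exact: bilinearD1.
Qed.

Lemma bilinear_sum2 (M N P : lmodType R) (b : M -> N -> P) m I (r : seq I)
    (Q : pred I) F : bilinear_map b ->
  b m (\sum_(i <- r | Q i) F i) = \sum_(i <- r | Q i) b m (F i).
Proof.
move=> bb; apply: (big_morph (b m)) => [x y|]; last exact: bilinear02.
exact: bilinearD2.
Qed.

(** The universal property is needed twice, for algebra maps and for bilinear
    maps: the first gives points with values in T, the second tests whether a
    sum of products vanishes.  Uniqueness follows from generation. *)
Definition is_tensor (A B T : comAlgType R) (i1 : {lrmorphism A -> T})
    (i2 : {lrmorphism B -> T}) :=
  [/\ forall (C : comAlgType R) (x : {lrmorphism A -> C})
        (y : {lrmorphism B -> C}),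
        exists h : {lrmorphism T -> C}, lrcomp h i1 = x /\ lrcomp h i2 = y,
      forall t, exists n (u : 'I_n -> A) (v : 'I_n -> B),
        t = \sum_k i1 (u k) * i2 (v k) &
      forall (P : lmodType R) (b : A -> B -> P), bilinear_map b ->
        exists L : {linear T -> P}, forall u v, L (i1 u * i2 v) = b u v].

(** The base change of A to B, restricted to scalars in R. *)
Lemma tensor_exists (A B : comAlgType R) : free_mod A ->
  exists (T : comAlgType R) (i1 : {lrmorphism A -> T})
    (i2 : {lrmorphism B -> T}), is_tensor i1 i2.
Proof.
move=> [n [e [c ec]]].
pose j : {rmorphism R -> B} := in_alg B.
pose T := base_change j ec.
pose h : {rmorphism R -> T} := [the {rmorphism R -> T} of bc_const j ec \o j].
pose TA : comAlgType R := alg_of h.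
have scaleT r (t : TA) : r *: t = (j r *: (t : T) : T).
  exact: (@bc_constM R B j A n e c ec (j r) t).
have [||||i1 i1E] := @lrmorphism_of R A TA (bc_in j ec).
- exact: bc_inD.
- exact: bc_inM.
- by [].
- by move=> r a; rewrite scaleT bc_inZ.
have [||||i2 i2E] := @lrmorphism_of R B TA (bc_const j ec).
- exact: rmorphD.
- exact: rmorphM.
- exact: rmorph1.
- by move=> r b; rewrite scaleT /bc_const scalerA /j /= -scalerAl mul1r.
have i12 a b : i1 a * i2 b = (b *: (bc_in j ec a : T) : T).
  by rewrite i1E i2E mulrC; apply: (@bc_constM R B j A n e c ec).
have T_sum (t : TA) : t = \sum_k i1 (e k) * i2 ((t : T) 0 k).
  by rewrite [LHS](bc_sum (t : T)); apply: eq_bigr => k _; rewrite i12.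
exists TA, i1, i2; split.
- move=> C x y.
  have [||||g [gD gM gin gZ]] := @bc_lift R B j A n e c ec C y x.
  + exact: rmorphD.
  + exact: rmorphM.
  + exact: rmorph1.
  + by move=> r a; rewrite linearZ /j /= linearZ /= rmorph1 -scalerAl mul1r.
  have [||||f fE] := @lrmorphism_of R TA C g.
  + exact: gD.
  + exact: gM.
  + by have := gin 1; rewrite rmorph1.
  + by move=> r t; rewrite scaleT gZ /j /= linearZ /= rmorph1 -scalerAl mul1r.
  exists f; split; apply: lrmorphism_ext => a; rewrite /= fE.
    by rewrite i1E gin.
  by rewrite i2E [LHS]gZ; have := gin 1; rewrite rmorph1 => ->; rewrite mulr1.
- by move=> t; exists n, e, (fun k => (t : T) 0 k).
- move=> P b bb.
  have [|L LE] := @linear_of TA P (fun t => \sum_k b (e k) ((t : T) 0 k)).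
    move=> r u v; rewrite scaler_sumr -big_split; apply: eq_bigr => k _ /=.
    rewrite scaleT !mxE bilinearD2 //; congr (_ + _).
    by rewrite -bilinearZ2 // /j /= -scalerAl mul1r.
  exists L => u v; rewrite LE i12 [in RHS](ec.1 u) bilinear_sum1 //.
  apply: eq_bigr => k _; rewrite !mxE bilinearZ1 // -bilinearZ2 //.
  by rewrite /j /= -scalerAr mulr1.
Qed.

Section TensorTheory.
Variables (A B T : comAlgType R) (i1 : {lrmorphism A -> T}).
Variables (i2 : {lrmorphism B -> T}) (AB : is_tensor i1 i2).

Lemma tensor_eq (P : lmodType R) (b : A -> B -> P) n m (u : 'I_n -> A)
    (v : 'I_n -> B) (u' : 'I_m -> A) (v' : 'I_m -> B) : bilinear_map b ->
  \sum_k i1 (u k) * i2 (v k) = \sum_k i1 (u' k) * i2 (v' k) ->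
  \sum_k b (u k) (v k) = \sum_k b (u' k) (v' k).
Proof.
have [_ _ ext] := AB; move=> /ext[L LE] /(congr1 L); rewrite !linear_sum.
rewrite (eq_bigr (fun k => b (u k) (v k))) => [->|k _]; last exact: LE.
by apply: eq_bigr => k _; apply: LE.
Qed.

Lemma tensor_hom_eq (C : comAlgType R) (f g : {lrmorphism T -> C}) :
  lrcomp f i1 = lrcomp g i1 -> lrcomp f i2 = lrcomp g i2 -> f = g.
Proof.
have [_ gen _] := AB; move=> fg1 fg2; apply: lrmorphism_ext => t.
have [n [u [v ->]]] := gen t; rewrite !rmorph_sum; apply: eq_bigr => k _.
rewrite /= !rmorphM; congr (_ * _).
  exact: (congr1 (fun h : {lrmorphism A -> C} => h (u k)) fg1).
exact: (congr1 (fun h : {lrmorphism B -> C} => h (v k)) fg2).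
Qed.

Variables (n : nat) (e : 'I_n -> A) (c : {linear A -> 'rV[R]_n}).
Hypothesis ec : free_on e c.

Lemma tensor_coord t : exists w, t = \sum_k i1 (e k) * i2 (w k).
Proof.
have [_ gen _] := AB; have [m [u [v tE]]] := gen t.
exists (fun k => \sum_l c (u l) 0 k *: v l); rewrite tE.
under [RHS]eq_bigr do rewrite linear_sum mulr_sumr.
rewrite exchange_big; apply: eq_bigr => l _.
rewrite {1}[u l]ec.1 linear_sum mulr_suml; apply: eq_bigr => k _.
by rewrite /= !linearZ /= -scalerAl scalerAr.
Qed.

Lemma coord_bilinear k : bilinear_map (fun (a : A) (b : B) => c a 0 k *: b).
Proof.
split=> [b r x y|a r x y]; first by rewrite linearP !mxE scalerDl scalerA.
by rewrite scalerDr !scalerA mulrC.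
Qed.

Lemma tensor_sum_coord (w : 'I_n -> B) k :
  \sum_l c (e l) 0 k *: w l = w k.
Proof.
rewrite (bigD1 k) //= ec.2 mxE !eqxx scale1r big1 ?addr0 // => l lk.
by rewrite ec.2 mxE eq_sym (negbTE lk) scale0r.
Qed.

Lemma tensor_coord_inj (w w' : 'I_n -> B) :
  \sum_k i1 (e k) * i2 (w k) = \sum_k i1 (e k) * i2 (w' k) -> w =1 w'.
Proof.
move=> ww k; rewrite -(tensor_sum_coord w) -(tensor_sum_coord w').
exact: (tensor_eq (coord_bilinear k) ww).
Qed.

Lemma tensor_torsion_free : torsion_free B -> torsion_free T.
Proof.
move=> tfB d t d0; have [w ->] := tensor_coord t => dw0.
have w0 k : w k = 0.
  apply: (tfB d) => //.
  pose z (_ : 'I_n) : B := 0.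
  have := @tensor_coord_inj (fun k => d *: w k) z; apply.
  rewrite [RHS]big1 => [|l _]; last by rewrite rmorph0 mulr0.
  rewrite -[RHS]dw0 scaler_sumr; apply: eq_bigr => l _.
  by rewrite linearZ /= scalerAr.
by rewrite big1 // => k _; rewrite w0 rmorph0 mulr0.
Qed.

Lemma tensor_finite : finite_module B -> finite_module T.
Proof.
move=> [m [e' gen']].
exists #|{: 'I_n * 'I_m}|,
  (fun k => i1 (e (enum_val k).1) * i2 (e' (enum_val k).2)) => t.
have [w ->] := tensor_coord t.
pose a k := sval (cid (gen' (w k))).
have aE k : w k = \sum_l a k l *: e' l by rewrite /a; case: cid.
exists (fun k => a (enum_val k).1 (enum_val k).2).
rewrite (reindex enum_rank) /=; last exact/onW_bij/enum_rank_bij.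
under [RHS]eq_bigr do rewrite enum_rankK.
rewrite -(pair_bigA _ (fun k l => a k l *: (i1 (e k) * i2 (e' l)))) /=.
apply: eq_bigr => k _; rewrite aE linear_sum mulr_sumr; apply: eq_bigr => l _.
by rewrite linearZ scalerAr.
Qed.

End TensorTheory.

End Tensor.

Section GenericAlgebra.
Variables (R S : comNzRingType) (j : {rmorphism R -> S}).
Hypothesis j_inj : injective j.
Hypothesis j_frac : forall x, exists a d, d != 0 /\ j d * x = j a.

Hypothesis R_domain : forall a b : R, a * b = 0 -> a = 0 \/ b = 0.

Lemma domain_mul_neq0 (a b : R) : a != 0 -> b != 0 -> a * b != 0.
Proof.
move=> a0 b0; apply/eqP => /R_domain[] /eqP.
  by rewrite (negbTE a0).
by rewrite (negbTE b0).
Qed.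

Lemma domain_prod_neq0 (I : finType) (P : pred I) (f : I -> R) :
  (forall i, f i != 0) -> \prod_(i | P i) f i != 0.
Proof.
move=> f0; apply: (big_ind (fun x : R => x != 0)) => //.
- by rewrite oner_eq0.
- by move=> x y; apply: domain_mul_neq0.
Qed.

Lemma common_denominator (I : finType) (v : I -> S) :
  exists d, d != 0 /\ exists a : I -> R, forall i, j d * v i = j (a i).
Proof.
pose num i := sval (cid (j_frac (v i))).
pose den i := sval (cid (svalP (cid (j_frac (v i))))).
have numden i : den i != 0 /\ j (den i) * v i = j (num i).
  exact: svalP (cid (svalP (cid (j_frac (v i))))).
exists (\prod_i den i); split.
  by apply: domain_prod_neq0 => i; have [] := numden i.
exists (fun i => num i * \prod_(l | l != i) den l) => i.
by rewrite (bigD1 i) //= !rmorphM mulrAC (numden i).2.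
Qed.

(** AK is the tensor product of A with S, when S is the fraction field of R: the
    points of the generic fibre are the S-algebra maps out of AK. *)
Definition is_generic (A : comAlgType R) (AK : comAlgType S)
    (i : {lrmorphism A -> restr_scalars j AK}) :=
  [/\ forall (B : comAlgType S) (x : {lrmorphism A -> restr_scalars j B}),
        exists h : {lrmorphism AK -> B}, lrcomp (restr_morphism j h) i = x,
      injective i &
      forall t : AK, exists d a, d != 0 /\ j d *: t = (i a : AK)].

Lemma generic_exists (A : comAlgType R) : free_mod A ->
  exists (AK : comAlgType S) (i : {lrmorphism A -> restr_scalars j AK}),
    is_generic i.
Proof.
move=> [n [e [c ec]]]; pose T := base_change j ec.
pose AK : comAlgType S := alg_of (bc_const j ec).
have scaleT s (t : AK) : s *: t = (s *: (t : T) : T).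
  exact: (@bc_constM R S j A n e c ec s t).
have [||||i iE] := @lrmorphism_of R A (restr_scalars j AK) (bc_in j ec).
- exact: bc_inD.
- exact: bc_inM.
- by [].
- by move=> r a; rewrite bc_inZ; apply/esym/(scaleT (j r)).
exists AK, i; split.
- move=> B x.
  pose y : {rmorphism S -> B} := in_alg B.
  have [||||g [gD gM gin gZ]] := @bc_lift R S j A n e c ec B y x.
  + exact: rmorphD.
  + exact: rmorphM.
  + exact: rmorph1.
  + move=> r a; rewrite linearZ /y /= -scalerAl mul1r; exact: erefl.
  have [||||f fE] := @lrmorphism_of S AK B g.
  + exact: gD.
  + exact: gM.
  + by have := gin 1; rewrite rmorph1.
  + by move=> r t; rewrite scaleT gZ /y /= -scalerAl mul1r.
  exists f; apply: lrmorphism_ext => a.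
  by rewrite /= /restr_fun fE iE gin.
- move=> a b; rewrite !iE => /rowP ab; rewrite (ec.1 a) (ec.1 b).
  apply: eq_bigr => k _; congr (_ *: _); apply: j_inj.
  by have := ab k; rewrite !mxE.
- move=> t; have [d [d0 [a aE]]] := common_denominator (fun k => (t : T) 0 k).
  exists d, (\sum_k a k *: e k); split=> //; rewrite scaleT iE bc_in_sum.
  rewrite [t in LHS](bc_sum (t : T)) scaler_sumr; apply: eq_bigr => k _.
  by rewrite scalerA aE bc_inZ.
Qed.

End GenericAlgebra.

Section LinearMatrix.
Variables (R : comNzRingType).

Definition matrix_of (M N : lmodType R) m n (e : 'I_m -> M)
    (c : {linear N -> 'rV[R]_n}) (f : {linear M -> N}) : 'M[R]_(m, n) :=
  \matrix_(k, l) c (f (e k)) 0 l.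

Lemma matrix_ofE (M N : lmodType R) m n (e : 'I_m -> M)
    (c : {linear M -> 'rV[R]_m}) (c' : {linear N -> 'rV[R]_n})
    (f : {linear M -> N}) x : free_on e c ->
  c' (f x) = c x *m matrix_of e c' f.
Proof.
move=> ec; rewrite {1}[x]ec.1 !linear_sum; apply/rowP => l.
by rewrite summxE !mxE; apply: eq_bigr => k _; rewrite !linearZ !mxE.
Qed.

Lemma matrix_of_comp (L M N : lmodType R) l m n (e : 'I_l -> L) (e' : 'I_m -> M)
    (c' : {linear M -> 'rV[R]_m}) (c'' : {linear N -> 'rV[R]_n})
    (f : {linear L -> M}) (g : {linear M -> N}) (h : {linear L -> N}) :
  free_on e' c' -> h =1 g \o f ->
  matrix_of e c'' h = matrix_of e c' f *m matrix_of e' c'' g.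
Proof.
move=> ec' hgf; apply/row_matrixP => k; rewrite row_mul.
have rowE (N' : lmodType R) q (c : {linear N' -> 'rV[R]_q})
    (u : {linear L -> N'}) :
    row k (matrix_of e c u) = c (u (e k)) by apply/rowP => i; rewrite !mxE.
by rewrite !rowE hgf /=; apply: matrix_ofE.
Qed.

Lemma matrix_of_id (M : lmodType R) m (e : 'I_m -> M)
    (c : {linear M -> 'rV[R]_m}) (f : {linear M -> M}) :
  free_on e c -> f =1 id -> matrix_of e c f = 1%:M.
Proof.
move=> ec f1; apply/matrixP => k l; rewrite !mxE f1 ec.2 mxE eqxx.
by rewrite eq_sym.
Qed.

Lemma matrix_of_scale (M : lmodType R) m (e : 'I_m -> M)
    (c : {linear M -> 'rV[R]_m}) (f : {linear M -> M}) d :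
  free_on e c -> f =1 *:%R d -> matrix_of e c f = d%:M.
Proof.
move=> ec fd; apply/matrixP => k l.
by rewrite !mxE fd linearZ /= ec.2 !mxE eqxx [l == k]eq_sym mulr_natr.
Qed.

Lemma linear_lifting (L M N : lmodType R) (f : {linear L -> N})
    (g : {linear M -> N}) : free_mod M ->
  (forall y, exists x, f x = g y) -> exists s : {linear M -> L}, f \o s =1 g.
Proof.
move=> [n [e [c ec]]] img; pose v i := sval (cid (img (e i))).
have vE i : f (v i) = g (e i) by rewrite /v; case: cid.
have [|s sE] := @linear_of R M L (fun y => \sum_i c y 0 i *: v i).
  move=> r x y; rewrite scaler_sumr -big_split; apply: eq_bigr => i _ /=.
  by rewrite linearP !mxE scalerDl scalerA.
exists s => y; rewrite /= sE linear_sum [in RHS](ec.1 y) linear_sum.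
by apply: eq_bigr => i _; rewrite !linearZ /= vE.
Qed.

Lemma linear_section (M N : lmodType R) (f : {linear M -> N}) :
  free_mod N -> (forall y, exists x, f x = y) ->
  exists s : {linear N -> M}, cancel s f.
Proof.
move=> freeN onto; have [|id_N id_NE] := @linear_of R N N idfun; first by [].
have [|s sE] := linear_lifting (f := f) (g := id_N) freeN.
  by move=> y; have [x xE] := onto y; exists x; rewrite xE id_NE.
by exists s => y; have := sE y; rewrite /= id_NE.
Qed.

End LinearMatrix.

(** * Modules over a discrete valuation ring *)

Record dvr_in (R : comNzRingType) (K : fieldType) (j : {rmorphism R -> K})
    (pi : R) : Prop := DvrIn {
  dvr_inj : injective j;
  dvr_frac : forall x, exists a d, d != 0 /\ j d * x = j a;
  dvr_pi : pi != 0;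
  dvr_nonunit : forall x, pi * x != 1;
  dvr_val : forall r, r != 0 ->
    exists u u' v, u * u' = 1 /\ r = u * pi ^+ v }.

Section Dvr.
Variables (R : comNzRingType) (K : fieldType) (j : {rmorphism R -> K}) (pi : R).
Hypothesis dvr : dvr_in j pi.

Lemma dvr_domain (a b : R) : a * b = 0 -> a = 0 \/ b = 0.
Proof.
move=> /(congr1 j) /eqP; rewrite rmorphM rmorph0 mulf_eq0 => /orP[]/eqP j0;
  [left | right]; by apply: (dvr_inj dvr); rewrite j0 rmorph0.
Qed.

Lemma dvr_mul_neq0 (a b : R) : a != 0 -> b != 0 -> a * b != 0.
Proof. exact: (domain_mul_neq0 dvr_domain). Qed.

Lemma dvr_mulI (a x y : R) : a != 0 -> a * x = a * y -> x = y.
Proof.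
move=> a0 /eqP; rewrite -subr_eq0 -mulrBr => /eqP/dvr_domain[/eqP|/subr0_eq //].
by rewrite (negbTE a0).
Qed.

Lemma dvr_exp_neq0 (a : R) n : a != 0 -> a ^+ n != 0.
Proof.
move=> a0; elim: n => [|n IH]; first by rewrite expr0 oner_neq0.
by rewrite exprS dvr_mul_neq0.
Qed.

Lemma dvr_ratio (s : seq R) : s != [::] ->
  exists2 g, g \in s & forall x, x \in s -> exists q, x = q * g.
Proof.
have total (a b : R) : (exists q, a = q * b) \/ (exists q, b = q * a).
  have [->|a0] := eqVneq a 0; first by left; exists 0; rewrite mul0r.
  have [->|b0] := eqVneq b 0; first by right; exists 0; rewrite mul0r.
  have [u [u' [v [uu' ->]]]] := dvr_val dvr a0.
  have [w [w' [m [ww' ->]]]] := dvr_val dvr b0.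
  have [vm|/ltnW mv] := leqP v m.
    right; exists (w * u' * pi ^+ (m - v)); rewrite -{1}(subnK vm) exprD.
    transitivity (u * u' * (w * (pi ^+ (m - v) * pi ^+ v))); last by ring.
    by rewrite uu' mul1r.
  left; exists (u * w' * pi ^+ (v - m)); rewrite -{1}(subnK mv) exprD.
  transitivity (w * w' * (u * (pi ^+ (v - m) * pi ^+ m))); last by ring.
  by rewrite ww' mul1r.
elim: s => // x s IH _; have [->|s0] := eqVneq s [::].
  exists x; rewrite ?mem_head // => y; rewrite inE => /eqP->.
  by exists 1; rewrite mul1r.
have [g gs g_div] := IH s0; have [[q xq]|[q gq]] := total x g.
  exists g; first by rewrite inE gs orbT.
  by move=> y; rewrite inE => /predU1P[->|/g_div //]; exists q.
exists x; first exact: mem_head.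
move=> y; rewrite inE => /predU1P[->|/g_div[r ->]]; last first.
  by exists (r * q); rewrite gq mulrA.
by exists 1; rewrite mul1r.
Qed.

(** In a nontrivial relation between generators, a coefficient that divides all
    the others can be cancelled, so its generator is redundant: a minimal system
    of generators is a basis. *)
Lemma finite_torsion_free (M : lmodType R) :
  finite_module M -> torsion_free M -> free_mod M.
Proof.
move=> [m0 gen0] tf.
pose gen n := exists e : 'I_n -> M, forall m, exists c : 'I_n -> R,
  m = \sum_i c i *: e i.
have ex_n : exists n, `[< gen n >] by exists m0; apply/asboolP.
case: (ex_minnP ex_n) => n /asboolP[e e_gen] n_min.
have indep (c : 'I_n -> R) : \sum_i c i *: e i = 0 -> forall i, c i = 0.
  move=> c0; apply: contrapT => /existsNP[i /eqP ci0].
  pose s := [seq c i | i <- enum 'I_n].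
  have [|g /mapP[k _ gE] g_div] := @dvr_ratio s.
    by apply/eqP => /(congr1 (fun s => c i \in s)); rewrite map_f ?mem_enum.
  have q l : exists q, c l = q * c k.
    by rewrite -gE; apply: g_div; rewrite map_f ?mem_enum.
  pose q' l := sval (cid (q l)).
  have q'E l : c l = q' l * c k by rewrite /q'; case: cid.
  have ck0 : c k != 0 by apply: contraNneq ci0 => ck; rewrite q'E ck mulr0.
  have qk : q' k = 1.
    by apply: (dvr_mulI ck0); rewrite mulrC -q'E mulr1.
  have rel : \sum_i q' i *: e i = 0.
    apply: (tf _ _ ck0); rewrite -[RHS]c0 scaler_sumr; apply: eq_bigr => l _.
    by rewrite scalerA mulrC -q'E.
  case: n e e_gen n_min c c0 i ci0 s k g gE g_div q q' q'E ck0 qk rel =>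
    [|n] e e_gen n_min c c0 i ci0 s k g gE g_div q q' q'E ck0 qk rel.
    by case: k {gE q q'E ck0 qk}.
  suff : (n.+1 <= n)%N by rewrite ltnn.
  apply: n_min; apply/asboolP; exists (fun l => e (lift k l)) => m.
  have [d ->] := e_gen m.
  exists (fun l => d (lift k l) - d k * q' (lift k l)).
  have -> : \sum_i d i *: e i = \sum_i (d i - d k * q' i) *: e i.
    under [RHS]eq_bigr do rewrite scalerBl -scalerA.
    by rewrite sumrB -scaler_sumr rel scaler0 subr0.
  rewrite (bigD1_ord k) //= qk mulr1 subrr scale0r add0r.
  exact: erefl.
pose co m := \row_i sval (cid (e_gen m)) i.
have coE m : m = \sum_i co m 0 i *: e i.
  by rewrite /co; under eq_bigr do rewrite mxE; case: cid.
have co_uniq m (v : 'rV[R]_n) : m = \sum_i v 0 i *: e i -> co m = v.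
  move=> mv; apply/rowP => i; apply/subr0_eq.
  apply: (indep (fun i => co m 0 i - v 0 i)).
  by under eq_bigr do rewrite scalerBl; rewrite sumrB -coE -mv subrr.
have [|c cE] := @linear_of R M 'rV[R]_n co.
  move=> r x y; apply: co_uniq; rewrite [in LHS](coE x) [in LHS](coE y).
  rewrite scaler_sumr -big_split; apply: eq_bigr => i _.
  by rewrite !mxE scalerDl scalerA.
exists n, e, c; split=> [m|i]; rewrite ?cE; last apply: co_uniq.
  exact: coE.
rewrite (bigD1 i) //= mxE !eqxx scale1r big1 ?addr0 // => k ki.
by rewrite mxE (negbTE ki) andbF scale0r.
Qed.

Lemma free_finite (M : lmodType R) : free_mod M -> finite_module M.
Proof.
by move=> [n [e [c [ec _]]]]; exists n, e => m; exists (fun i => c m 0 i).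
Qed.

Lemma free_torsion_free (M : lmodType R) : free_mod M -> torsion_free M.
Proof.
move=> [n [e [c [ec _]]]] d m d0 dm; rewrite [m]ec big1 // => i _.
suff -> : c m 0 i = 0 by rewrite scale0r.
apply: (dvr_mulI d0); rewrite mulr0.
have /rowP/(_ i) : c (d *: m) = d *: c m by rewrite linearZ.
by rewrite dm linear0 !mxE => <-.
Qed.

Lemma free_flat (M : lmodType R) : free_mod M -> flat_module M.
Proof.
move=> [n [e [c [ec _]]]] N N' f f_inj s s0 P b bb.
have coord0 i : \sum_(t <- s) c t.2 0 i *: t.1 = 0.
  apply: f_inj; rewrite linear_sum linear0.
  have := s0 N' (fun x a => c a 0 i *: x); rewrite big_map => s0'.
  rewrite -[RHS]s0'; first by apply: eq_bigr => t _; rewrite linearZ.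
  split=> [a r x y|x r a a']; first by rewrite scalerDr !scalerA mulrC.
  by rewrite linearP !mxE scalerDl scalerA.
under eq_bigr => t _ do rewrite [t.2]ec bilinear_sum2 //.
rewrite exchange_big big1 // => i _.
rewrite -[RHS](bilinear01 (e i) bb) -(coord0 i) bilinear_sum1 //.
by apply: eq_bigr => t _; rewrite bilinearZ1 // bilinearZ2.
Qed.

Lemma flat_torsion_free (M : lmodType R) : flat_module M -> torsion_free M.
Proof.
move=> flat d m d0 dm.
have [|f fE] := @linear_of R R^o R^o (fun x => d * x).
  by move=> r x y; rewrite mulrDr mulrCA.
have f_inj : injective f by move=> x y; rewrite !fE => /(dvr_mulI d0).
have := flat R^o R^o f f_inj [:: (1, m)] _ M (fun r a => (r : R) *: a).
rewrite big_seq1 scale1r; apply; last first.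
  split=> [a r x y|x r a a']; first by rewrite scalerDl scalerA.
  by rewrite scalerDr !scalerA mulrC.
move=> P b bb; rewrite big_seq1 /= fE -[d * 1]/(d *: (1 : R^o)) bilinearZ1 //.
by rewrite -bilinearZ2 // dm bilinear02.
Qed.

Lemma finite_flat_free (M : lmodType R) :
  finite_module M /\ flat_module M <-> free_mod M.
Proof.
split=> [[fin /flat_torsion_free]|free]; first exact: finite_torsion_free.
by split; [apply: free_finite | apply: free_flat].
Qed.

Lemma free_quotient (M N : lmodType R) (f : {linear M -> N}) :
  free_mod M -> torsion_free N -> (forall y, exists x, f x = y) -> free_mod N.
Proof.
move=> /free_finite[n [e gen]] tf onto; apply: finite_torsion_free => //.
exists n, (f \o e) => y; have [x <-] := onto y; have [c ->] := gen x.
by exists c; rewrite linear_sum; apply: eq_bigr => i _; rewrite linearZ.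
Qed.

(** Induction on n.  If the first coordinate of b has the smallest valuation in
    N, it divides the first coordinates of all the elements of N, so N is
    generated by b and by the elements whose first coordinate vanishes. *)
Lemma row_submodule_finite n (N : 'rV[R]_n -> Prop) :
  N 0 -> (forall r x y, N x -> N y -> N (r *: x + y)) ->
  exists m (g : 'I_m -> 'rV[R]_n), (forall i, N (g i)) /\
    forall x, N x -> exists c, x = \sum_i c i *: g i.
Proof.
elim: n N => [|n IH] N N0 NP.
  exists 0%N, (fun=> 0); split=> // x _; exists (fun=> 0).
  by rewrite big_ord0; apply/rowP => -[].
move: N N0 NP; rewrite -[n.+1]/(1 + n)%N => N N0 NP.
have [||m [g [gN g_gen]]] := IH (fun x => N (row_mx (0 : 'M_1) x)).
- by rewrite row_mx0.
- move=> r x y Nx Ny; have := NP r _ _ Nx Ny.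
  by rewrite scale_row_mx add_row_mx scaler0 addr0.
have [all0|] := pselect (forall x : 'rV_(1 + n), N x -> x 0 0 = 0).
  exists m, (fun i => row_mx (0 : 'M_1) (g i)); split=> // x Nx.
  have xE : x = row_mx (0 : 'M_1) (rsubmx (x : 'rV_(1 + n))).
    rewrite -[LHS]hsubmxK; congr row_mx; apply/rowP => i.
    by rewrite ord1 !mxE -[RHS](all0 _ Nx); congr (x _ _); apply: val_inj.
  have [|c cE] := g_gen (rsubmx (x : 'rV_(1 + n))); first by rewrite -xE.
  exists c; rewrite [LHS]xE cE.
  under [RHS]eq_bigr do rewrite scale_row_mx scaler0.
  apply/rowP => i; rewrite summxE -[i]splitK; case: split => k /=.
    by rewrite row_mxEl mxE big1 // => l _; rewrite row_mxEl mxE.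
  by rewrite row_mxEr summxE; apply: eq_bigr => l _; rewrite row_mxEr.
move=> /existsNP[x0 /not_implyP[Nx0 /eqP x00]].
pose has_val v := `[< exists x : 'rV_(1 + n), N x /\
  exists u u', u * u' = 1 /\ x 0 0 = u * pi ^+ v >].
have ex_v : exists v, has_val v.
  have [u [u' [v [uu' xv]]]] := dvr_val dvr x00.
  by exists v; apply/asboolP; exists x0; split=> //; exists u, u'.
case: (ex_minnP ex_v) => v /asboolP[b [Nb [u [u' [uu' bv]]]]] v_min.
have div (x : 'rV_(1 + n)) : N x -> exists q, x 0 0 = q * b 0 0.
  move=> Nx; have [->|x0'] := eqVneq (x 0 0) 0.
    by exists 0; rewrite mul0r.
  have [w [w' [k [ww' xk]]]] := dvr_val dvr x0'.
  have vk : (v <= k)%N.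
    by apply: v_min; apply/asboolP; exists x; split=> //; exists w, w'.
  exists (w * pi ^+ (k - v) * u'); rewrite bv xk -{1}(subnK vk) exprD.
  transitivity (u * u' * (w * (pi ^+ (k - v) * pi ^+ v))); last by ring.
  by rewrite uu' mul1r.
exists m.+1, (fun i => if unlift ord0 i is Some k
  then row_mx (0 : 'M_1) (g k) else b); split=> [i|x Nx].
  by case: unlift => [k|].
have [q xq] := div x Nx.
pose y : 'rV_(1 + n) := x - q *: b.
have Ny : N y by have := NP (- q) _ _ Nb Nx; rewrite scaleNr addrC.
have yE : y = row_mx (0 : 'M_1) (rsubmx y).
  rewrite -[LHS]hsubmxK; congr row_mx.
  apply/rowP => i; rewrite ord1 /y !mxE.
  have -> : lshift n (0 : 'I_1) = 0 by apply: val_inj.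
  by rewrite xq subrr.
have [|c cE] := g_gen (rsubmx y); first by rewrite -yE.
exists (fun i => if unlift ord0 i is Some k then c k else q).
rewrite big_ord_recl unlift_none.
under eq_bigr do rewrite liftK.
rewrite -[LHS](subrK (q *: b)) addrC; congr (_ + _); rewrite -/y yE cE.
under [RHS]eq_bigr do rewrite scale_row_mx scaler0.
apply/rowP => i; rewrite summxE -[i](@splitK 1 n); case: split => k /=.
  by rewrite row_mxEl mxE big1 // => l _; rewrite row_mxEl mxE.
by rewrite row_mxEr summxE; apply: eq_bigr => l _; rewrite row_mxEr.
Qed.

Lemma free_submodule (M N : lmodType R) (f : {linear M -> N}) :
  free_mod N -> injective f -> free_mod M.
Proof.
move=> freeN f_inj; have tfN := free_torsion_free freeN.
have tfM : torsion_free M.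
  move=> d m d0 dm; apply: f_inj; rewrite linear0.
  by apply: (tfN d) => //; rewrite -linearZ dm linear0.
have [n [e [c [ec _]]]] := freeN.
have c_inj x y : c x = c y -> x = y by move=> cxy; rewrite [x]ec [y]ec cxy.
have [||m [g [gN g_gen]]] := @row_submodule_finite n
  (fun v => exists x, c (f x) = v).
- by exists 0; rewrite !linear0.
- by move=> r _ _ [x <-] [y <-]; exists (r *: x + y); rewrite !linearP.
pose h i := sval (cid (gN i)).
have hE i : c (f (h i)) = g i by rewrite /h; case: cid.
apply: finite_torsion_free => //; exists m, h => x.
have [|a aE] := g_gen (c (f x)); first by exists x.
exists a; apply/f_inj/c_inj; rewrite aE !linear_sum; apply: eq_bigr => i _.
by rewrite !linearZ /= hE.
Qed.

(** Clearing denominators shows that F remains injective over K, where it has a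
    right inverse; clearing the denominators of that inverse gives G. *)
Lemma injective_matrix m n (F : 'M[R]_(m, n)) :
  (forall v : 'rV[R]_m, v *m F = 0 -> v = 0) ->
  exists d (G : 'M[R]_(n, m)), d != 0 /\ F *m G = d%:M.
Proof.
move=> F_inj; pose FK := map_mx j F.
have map_inj p q (X Y : 'M[R]_(p, q)) : map_mx j X = map_mx j Y -> X = Y.
  move=> /matrixP XY; apply/matrixP => i k; apply: (dvr_inj dvr).
  by have := XY i k; rewrite !mxE.
have denom := common_denominator (dvr_frac dvr) dvr_domain.
have FK_free : row_free FK.
  apply: inj_row_free => v vF.
  have [d [d0 [a aE]]] := denom _ (fun i => v 0 i).
  pose w := \row_i a i.
  have wE : map_mx j w = j d *: v by apply/rowP => i; rewrite !mxE aE.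
  have w0 : w = 0.
    apply: F_inj; apply: map_inj.
    by rewrite map_mxM wE -scalemxAl vF scaler0 map_mx0.
  apply/eqP; have : j d *: v == 0 by rewrite -wE w0 map_mx0.
  by rewrite scaler_eq0 -(rmorph0 j) (inj_eq (dvr_inj dvr)) (negbTE d0).
have [G FG] := row_freeP FK_free.
have [d [d0 [a aE]]] := denom _ (fun t : 'I_n * 'I_m => G t.1 t.2).
exists d, (\matrix_(i, k) a (i, k)); split=> //.
apply: map_inj.
rewrite map_mxM map_scalar_mx -[_%:M]mulr1.
have -> : map_mx j (\matrix_(i, k) a (i, k)) = j d *: G.
  by apply/matrixP => i k; rewrite !mxE -(aE (i, k)).
by rewrite -scalemxAr FG scalemx1 mulr1.
Qed.

(** Multiply the relations by the matrix G with F *m G = d%:M. *)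
Lemma independent_torsion_free m n (F : 'M[R]_(m, n)) (B : lmodType R)
    (w : 'I_m -> B) :
  (forall v : 'rV[R]_m, v *m F = 0 -> v = 0) -> torsion_free B ->
  (forall k, \sum_l F l k *: w l = 0) -> forall l, w l = 0.
Proof.
move=> /injective_matrix[d [G [d0 FG]]] tf Fw l; apply: (tf d) => //.
transitivity (\sum_k (F *m G)^T l k *: w k).
  rewrite FG tr_scalar_mx (bigD1 l) //= !mxE eqxx mulr1n big1 ?addr0 // => k.
  by rewrite eq_sym => /negbTE kl; rewrite mxE kl scale0r.
under eq_bigr do rewrite !mxE scaler_suml.
rewrite exchange_big big1 // => k _.
transitivity (G k l *: \sum_i F i k *: w i); last by rewrite Fw scaler0.
by rewrite scaler_sumr; apply: eq_bigr => i _; rewrite scalerA mulrC.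
Qed.

End Dvr.

(** * The additive category of group schemes *)

Arguments gopp {R g B}.
Definition gsub (R : comNzRingType) (G : group_scheme R) (B : comAlgType R)
  (x y : point G B) : point G B := gadd x (gopp y).

Section Points.
Variables (R : comNzRingType) (G : group_scheme R).
Implicit Types B C : comAlgType R.

Lemma gadd_r0 B (x : point G B) : gadd x (gzero G B) = x.
Proof. by rewrite gaddC gadd0. Qed.

Lemma gadd_rN B (x : point G B) : gadd x (gopp x) = gzero G B.
Proof. by rewrite gaddC gaddN. Qed.

Lemma gadd_cancel B (x y z : point G B) : gadd x y = gadd x z -> y = z.
Proof. by move=> /(congr1 (gadd (gopp x))); rewrite !gaddA !gaddN !gadd0. Qed.

Lemma gsubK B (x y : point G B) : gadd (gsub x y) y = x.
Proof. by rewrite /gsub -gaddA gaddN gadd_r0. Qed.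

Lemma gsubxx B (x : point G B) : gsub x x = gzero G B.
Proof. exact: gadd_rN. Qed.

Lemma goppK B (x : point G B) : gopp (gopp x) = x.
Proof. by apply: (@gadd_cancel _ (gopp x)); rewrite gadd_rN gaddN. Qed.

Lemma gaddACA B (x y z t : point G B) :
  gadd (gadd x y) (gadd z t) = gadd (gadd x z) (gadd y t).
Proof.
by rewrite -!gaddA; congr gadd; rewrite !gaddA [gadd y z]gaddC.
Qed.

Lemma goppD B (x y : point G B) : gopp (gadd x y) = gadd (gopp x) (gopp y).
Proof.
apply: (@gadd_cancel _ (gadd x y)).
by rewrite gadd_rN gaddACA !gadd_rN gadd0.
Qed.

Lemma gzero_nat B C (f : {lrmorphism B -> C}) :
  lrcomp f (gzero G B) = gzero G C.
Proof.
apply: (@gadd_cancel _ (lrcomp f (gzero G B))).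
by rewrite -gadd_nat gadd0 gadd_r0.
Qed.

Lemma gopp_nat B C (f : {lrmorphism B -> C}) (x : point G B) :
  lrcomp f (gopp x) = gopp (lrcomp f x).
Proof.
apply: (@gadd_cancel _ (lrcomp f x)).
by rewrite -gadd_nat !gadd_rN gzero_nat.
Qed.

Lemma gsub_nat B C (f : {lrmorphism B -> C}) (x y : point G B) :
  lrcomp f (gsub x y) = gsub (lrcomp f x) (lrcomp f y).
Proof. by rewrite gadd_nat gopp_nat. Qed.

Lemma gmuln_nat B C (f : {lrmorphism B -> C}) n (x : point G B) :
  lrcomp f (gmuln n x) = gmuln n (lrcomp f x).
Proof.
elim: n => [|n IH]; first exact: gzero_nat.
by rewrite /gmuln !iterS gadd_nat -/(gmuln n x) IH.
Qed.

Lemma gmuln0 B n : gmuln n (gzero G B) = gzero G B.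
Proof. by elim: n => // n IH; rewrite /gmuln iterS gadd0. Qed.

Lemma gmulnM B m n (x : point G B) : gmuln (n * m) x = gmuln n (gmuln m x).
Proof.
have gmulnD a b : gmuln (a + b) x = gadd (gmuln a x) (gmuln b x).
  elim: a => [|a IH]; first by rewrite gadd0.
  by rewrite addSn /gmuln !iterS -/(gmuln _ x) IH gaddA.
elim: n => // n IH.
by rewrite mulSn gmulnD IH.
Qed.

Lemma unit_exists B : exists h : {lrmorphism R^o -> B}, forall r, h r = r%:A.
Proof.
have [||||h hE] := @lrmorphism_of R R^o B (fun r => (r : R)%:A).
- by move=> r s; rewrite scalerDl.
- by move=> r s; rewrite -scalerAl mul1r scalerA.
- exact: scale1r.
- by move=> r s; rewrite scalerA.
by exists h.
Qed.

Lemma gzeroE B a : gzero G B a = (gzero G R^o a)%:A.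
Proof. by have [h hE] := unit_exists B; rewrite -(gzero_nat h) /= hE. Qed.

End Points.

Section Category.
Variable R : comNzRingType.
Implicit Types G H L : group_scheme R.

Lemma gs_hom_eq G H (f g : gs_hom G H) : comorph f = comorph g -> f = g.
Proof. by move=> fg; apply: gs_hom_ext => a; rewrite fg. Qed.

Lemma on_pointsD G H (f : gs_hom G H) (B : comAlgType R) (x y : point G B) :
  on_points f (gadd x y) = gadd (on_points f x) (on_points f y).
Proof. exact: gs_hom_add. Qed.

Lemma on_points0 G H (f : gs_hom G H) (B : comAlgType R) :
  on_points f (gzero G B) = gzero H B.
Proof.
apply: (@gadd_cancel _ _ _ (on_points f (gzero G B))).
by rewrite -on_pointsD gadd0 gadd_r0.
Qed.

Lemma on_pointsN G H (f : gs_hom G H) (B : comAlgType R) (x : point G B) :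
  on_points f (gopp x) = gopp (on_points f x).
Proof.
apply: (@gadd_cancel _ _ _ (on_points f x)).
by rewrite -on_pointsD !gadd_rN on_points0.
Qed.

Lemma on_pointsB G H (f : gs_hom G H) (B : comAlgType R) (x y : point G B) :
  on_points f (gsub x y) = gsub (on_points f x) (on_points f y).
Proof. by rewrite on_pointsD on_pointsN. Qed.

Lemma on_points_nat G H (f : gs_hom G H) (B C : comAlgType R)
    (h : {lrmorphism B -> C}) (x : point G B) :
  lrcomp h (on_points f x) = on_points f (lrcomp h x).
Proof. exact: lrcompA. Qed.

Lemma on_points_muln G H (f : gs_hom G H) (B : comAlgType R) n (x : point G B) :
  on_points f (gmuln n x) = gmuln n (on_points f x).
Proof.
elim: n => [|n IH]; first exact: on_points0.
by rewrite /gmuln !iterS on_pointsD -/(gmuln n x) IH.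
Qed.

Definition gs_add G H (f g : gs_hom G H) : gs_hom G H.
Proof.
exists (gadd (comorph f : point H (coord G)) (comorph g)) => B x y.
by rewrite !gadd_nat !gs_hom_add gaddACA.
Defined.

Definition gs_zero G H : gs_hom G H.
Proof.
by exists (gzero H (coord G)) => B x y; rewrite !gzero_nat gadd0.
Defined.

Definition gs_opp G H (f : gs_hom G H) : gs_hom G H.
Proof.
exists (gopp (comorph f : point H (coord G))) => B x y.
by rewrite !gopp_nat !gs_hom_add goppD.
Defined.

Lemma on_points_add G H (f g : gs_hom G H) B (x : point G B) :
  on_points (gs_add f g) x = gadd (on_points f x) (on_points g x).
Proof. exact: gadd_nat. Qed.

Lemma on_points_zero G H B (x : point G B) :
  on_points (gs_zero G H) x = gzero H B.
Proof. exact: gzero_nat. Qed.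

Lemma on_points_opp G H (f : gs_hom G H) B (x : point G B) :
  on_points (gs_opp f) x = gopp (on_points f x).
Proof. exact: gopp_nat. Qed.

Lemma on_points_comp G H L (g : gs_hom H L) (f : gs_hom G H) B
    (x : point G B) : on_points (gs_comp g f) x = on_points g (on_points f x).
Proof. exact: lrcompA. Qed.

Lemma on_points_id G B (x : point G B) : on_points (gs_id G) x = x.
Proof. exact: lrid_comp. Qed.

(** Yoneda: the comorphism is the image of the universal point. *)
Lemma gs_hom_points G H (f g : gs_hom G H) :
  (forall B (x : point G B), on_points f x = on_points g x) -> f = g.
Proof.
by move=> fg; apply: gs_hom_eq; have := fg _ (lrid _);
  rewrite /on_points !lrcomp_id.
Qed.

Definition group_schemes_preadditive : preadditive (group_schemes R).
Proof.
exists gs_add gs_zero gs_opp =>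
  [X Y f g h|X Y f g|X Y f|X Y f|X Y Z g h f|X Y Z g f h];
  apply: gs_hom_points => B x; rewrite ?on_points_comp ?on_points_add.
- exact: gaddA.
- exact: gaddC.
- by rewrite on_points_zero gadd0.
- by rewrite on_points_opp gaddN on_points_zero.
- by congr gadd; apply/esym/on_points_comp.
- by rewrite on_pointsD; congr gadd; apply/esym/on_points_comp.
Defined.

End Category.

(** * Products and closed subgroups *)

Section Constructions.
Variables (R : comNzRingType).
Implicit Types (G H : group_scheme R) (B C D T : comAlgType R).

Lemma product_exists G H : free_mod (coord G) ->
  exists (P : group_scheme R) (p1 : gs_hom P G) (p2 : gs_hom P H),
    is_tensor (comorph p1) (comorph p2).
Proof.
move=> freeG; have [T [i1 [i2 T12]]] := tensor_exists (coord H) freeG.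
have [ext gen _] := T12.
pose pair B (x : point G B) (y : point H B) := sval (cid (ext B x y)).
have pair1 B (x : point G B) (y : point H B) : lrcomp (pair B x y) i1 = x.
  by rewrite /pair; case: cid => ? [].
have pair2 B (x : point G B) (y : point H B) : lrcomp (pair B x y) i2 = y.
  by rewrite /pair; case: cid => ? [].
have T_eq B (z w : {lrmorphism T -> B}) :
    lrcomp z i1 = lrcomp w i1 -> lrcomp z i2 = lrcomp w i2 -> z = w.
  exact: (tensor_hom_eq T12).
pose add B (z w : {lrmorphism T -> B}) :=
  pair B (gadd (lrcomp z i1 : point G B) (lrcomp w i1))
         (gadd (lrcomp z i2 : point H B) (lrcomp w i2)).
pose zero B := pair B (gzero G B) (gzero H B).
pose opp B (z : {lrmorphism T -> B}) :=
  pair B (gopp (lrcomp z i1 : point G B)) (gopp (lrcomp z i2 : point H B)).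
have addA B : associative (@add B).
  by move=> x y z; apply: T_eq; rewrite !(pair1, pair2) gaddA.
have addC B : commutative (@add B).
  by move=> x y; apply: T_eq; rewrite !(pair1, pair2) gaddC.
have add0 B : left_id (zero B) (@add B).
  by move=> x; apply: T_eq; rewrite !(pair1, pair2) gadd0.
have addN B : left_inverse (zero B) (@opp B) (@add B).
  by move=> x; apply: T_eq; rewrite !(pair1, pair2) gaddN.
have add_nat B C (f : {lrmorphism B -> C}) x y :
    lrcomp f (@add B x y) = @add C (lrcomp f x) (lrcomp f y).
  by apply: T_eq; rewrite -lrcompA !(pair1, pair2) gadd_nat !lrcompA.
pose P := GroupScheme addA addC add0 addN add_nat.
have p1D B (x y : point P B) :
    lrcomp (gadd x y) i1 = gadd (lrcomp x i1 : point G B) (lrcomp y i1).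
  exact: pair1.
have p2D B (x y : point P B) :
    lrcomp (gadd x y) i2 = gadd (lrcomp x i2 : point H B) (lrcomp y i2).
  exact: pair2.
by exists P, (@GsHom R P G i1 p1D), (@GsHom R P H i2 p2D).
Qed.

(** The comultiplication is a |-> \sum_k e k (x) d k a: expand the value at a of
    the sum of the two universal points in the basis e. *)
Lemma comultiplication G n (e : 'I_n -> coord G)
    (c : {linear coord G -> 'rV[R]_n}) : free_on e c ->
  exists d : 'I_n -> coord G -> coord G, forall B (x y : point G B) a,
    gadd x y a = \sum_k x (e k) * y (d k a).
Proof.
move=> ec; have freeG : free_mod (coord G) by exists n, e, c.
have [T [i1 [i2 T12]]] := tensor_exists (coord G) freeG.
have [ext _ _] := T12.
pose Delta := gadd (i1 : point G T) i2.
pose d k a := sval (cid (tensor_coord T12 ec (Delta a))) k.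
have dE a : Delta a = \sum_k i1 (e k) * i2 (d k a) by rewrite /d; case: cid.
exists d => B x y a; have [h [<- <-]] := ext B x y.
rewrite -gadd_nat /= -/Delta dE rmorph_sum; apply: eq_bigr => k _.
by rewrite rmorphM.
Qed.

Variables (K : fieldType) (j : {rmorphism R -> K}) (pi : R).
Hypothesis dvr : dvr_in j pi.

Definition kills (A B : comAlgType R) (J : A -> Prop)
    (x : {lrmorphism A -> B}) :=
  forall a, J a -> x a = 0.

(** The points killing J form a subgroup as soon as they do over free algebras,
    since the universal pair of such points lives in the tensor square of A / J,
    which is free because J is saturated. *)
Lemma closed_subgroup G (J : coord G -> Prop) : free_mod (coord G) ->
  ~ J 1 -> J 0 -> (forall a x y, J x -> J y -> J (a * x + y)) ->
  (forall d a, d != 0 -> J (d *: a) -> J a) ->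
  kills J (gzero G R^o) ->
  (forall T : comAlgType R, free_mod T -> forall x y : point G T,
     kills J x -> kills J y -> kills J (gsub x y)) ->
  exists (N : group_scheme R) (i : gs_hom N G), [/\ free_mod (coord N),
    forall c, exists a, comorph i a = c & forall a, comorph i a = 0 <-> J a].
Proof.
move=> freeG J1 J0 JM Jsat Jzero Jsub.
have [C [q [q_onto qJ]]] := quotient_algebra J1 J0 JM.
have tfC : torsion_free C.
  move=> d c d0; have [a <-] := q_onto c; rewrite -linearZ => /qJ/(Jsat _ _ d0).
  by move=> /qJ.
have freeC : free_mod C := free_quotient dvr freeG tfC q_onto.
have [T [i1 [i2 T12]]] := tensor_exists C freeC.
have freeT : free_mod T.
  have [n [e [c ec]]] := freeC; apply: (finite_torsion_free dvr).
    exact (tensor_finite T12 ec (free_finite freeC)).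
  exact (tensor_torsion_free T12 ec tfC).
have killsq B (x : {lrmorphism C -> B}) : kills J (lrcomp x q).
  by move=> a /qJ /= ->; rewrite rmorph0.
have zero_kills B : kills J (gzero G B).
  by move=> a Ja; rewrite gzeroE Jzero // scale0r.
have sub_kills B (x y : {lrmorphism C -> B}) :
    kills J (gsub (lrcomp x q : point G B) (lrcomp y q)).
  move=> a Ja; have [ext _ _] := T12; have [h [<- <-]] := ext B x y.
  rewrite -!lrcompA -gsub_nat /=.
  by rewrite (Jsub T freeT (lrcomp i1 q) (lrcomp i2 q)) ?rmorph0.
have lift B (z : point G B) : kills J z -> exists h, lrcomp h q = z.
  by move=> zJ; apply: factor_surj => // a /qJ/zJ.
have C_eq B (x y : {lrmorphism C -> B}) : lrcomp x q = lrcomp y q -> x = y.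
  exact: lrcomp_surj.
have ex_opp B (x : {lrmorphism C -> B}) :
    exists h, lrcomp h q = gopp (lrcomp x q : point G B).
  have [z zE] := lift B _ (@zero_kills B); apply: lift.
  by have := sub_kills B z x; rewrite zE /gsub gadd0.
pose opp B x := sval (cid (ex_opp B x)).
have oppE B x : lrcomp (opp B x) q = gopp (lrcomp x q : point G B).
  by rewrite /opp; case: cid.
have ex_add B (x y : {lrmorphism C -> B}) :
    exists h, lrcomp h q = gadd (lrcomp x q : point G B) (lrcomp y q).
  apply: lift; have := sub_kills B x (opp B y).
  by rewrite oppE /gsub goppK.
pose add B x y := sval (cid (ex_add B x y)).
have addE B x y :
    lrcomp (add B x y) q = gadd (lrcomp x q : point G B) (lrcomp y q).
  by rewrite /add; case: cid.
pose zero B := sval (cid (lift B _ (@zero_kills B))).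
have zeroE B : lrcomp (zero B) q = gzero G B by rewrite /zero; case: cid.
have addA B : associative (add B).
  by move=> x y z; apply: C_eq; rewrite !addE gaddA.
have addC B : commutative (add B).
  by move=> x y; apply: C_eq; rewrite !addE gaddC.
have add0 B : left_id (zero B) (add B).
  by move=> x; apply: C_eq; rewrite addE zeroE gadd0.
have addN B : left_inverse (zero B) (opp B) (add B).
  by move=> x; apply: C_eq; rewrite addE oppE zeroE gaddN.
have add_nat B D (f : {lrmorphism B -> D}) x y :
    lrcomp f (add B x y) = add D (lrcomp f x) (lrcomp f y).
  by apply: C_eq; rewrite -lrcompA !addE gadd_nat !lrcompA.
pose N := GroupScheme addA addC add0 addN add_nat.
by exists N, (@GsHom R N G q addE).
Qed.

(** The ideal of the schematic closure of the generic kernel.  Torsion-free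
    algebras embed in their generic fibres, so testing on them forgets whatever
    the kernel of f has in the special fibre only. *)
Definition generic_kernel G H (f : gs_hom G H) (a : coord G) :=
  forall T : comAlgType R, torsion_free T -> forall x : point G T,
    on_points f x = gzero H T -> x a = 0.

Lemma torsion_free_regular : torsion_free R^o.
Proof.
move=> d r d0 dr; apply: (dvr_mulI dvr d0).
by rewrite mulr0; apply: dr.
Qed.

(** A point that kills the generic kernel lies in the kernel of f, since the
    pullback of a function vanishing at the origin is in the generic kernel;
    such points are stable under subtraction. *)
Lemma kernel_exists G H (f : gs_hom G H) : free_mod (coord G) ->
  exists (N : group_scheme R) (i : gs_hom N G), [/\ free_mod (coord N),
    forall c, exists a, comorph i a = c &
    forall a, comorph i a = 0 <-> generic_kernel f a].
Proof.
move=> freeG; apply: closed_subgroup => //.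
- have zf : on_points f (gzero G R^o) = gzero H R^o by rewrite on_points0.
  move=> /(_ _ torsion_free_regular _ zf)/eqP.
  by rewrite rmorph1 oner_eq0.
- by move=> T tfT x fx; rewrite rmorph0.
- move=> a u v Ju Jv T tfT x fx.
  by rewrite rmorphD rmorphM /= (Ju T tfT x fx) (Jv T tfT x fx) mulr0 addr0.
- move=> d a d0 Ja T tfT x fx; apply: (tfT d) => //.
  by have := Ja T tfT x fx; rewrite linearZ.
- move=> a; apply; last exact: on_points0.
  exact: torsion_free_regular.
- move=> T /(free_torsion_free dvr) tfT x y xJ yJ a; apply=> //.
  have f0 (z : point G T) : kills (generic_kernel f) z ->
      on_points f z = gzero H T.
    move=> zJ; apply: lrmorphism_ext => b.
    rewrite gzeroE; set r : R := gzero H R^o b.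
    have inJ : generic_kernel f (comorph f (b - r%:A)).
      move=> T' tfT' w fw.
      have -> : w (comorph f (b - r%:A)) = on_points f w (b - r%:A) by [].
      by rewrite fw rmorphB /= linearZ rmorph1 gzeroE subrr.
    have zr : z (comorph f r%:A) = r%:A.
      by rewrite linearZ /= linearZ /= !rmorph1.
    by have := zJ _ inJ; rewrite !rmorphB /= zr => /eqP;
      rewrite subr_eq0 => /eqP.
  by rewrite on_pointsB !f0 // gsubxx.
Qed.

End Constructions.

(** * Quotients *)

Section Quotients.
Variables (R : comNzRingType) (K : fieldType) (j : {rmorphism R -> K}) (pi : R).
Hypothesis dvr : dvr_in j pi.
Implicit Types (G H : group_scheme R) (A B C D T : comAlgType R).

(** Vectors of A that are independent over R stay independent over B in the
    tensor product.  They need not be part of a basis of A, which is why B has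
    to be torsion-free. *)
Lemma tensor_independent A B T (i1 : {lrmorphism A -> T})
    (i2 : {lrmorphism B -> T}) m (v : 'I_m -> A) (w : 'I_m -> B) :
  is_tensor i1 i2 -> free_mod A -> torsion_free B ->
  (forall r : 'I_m -> R, \sum_k r k *: v k = 0 -> forall k, r k = 0) ->
  \sum_k i1 (v k) * i2 (w k) = 0 -> forall k, w k = 0.
Proof.
move=> AB [n [e [c ec]]] tfB v_free vw0.
pose F := \matrix_(k < m, l < n) c (v k) 0 l.
apply: (independent_torsion_free dvr (F := F)) => // [r rF|l].
  apply/rowP => k; rewrite mxE; apply: (v_free (fun k => r 0 k)).
  have cinj a : c a = 0 -> a = 0.
    by move=> ca; rewrite [a]ec.1 ca big1 // => i _; rewrite mxE scale0r.
  apply: cinj; rewrite -[RHS]rF; apply/rowP => l.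
  rewrite linear_sum summxE !mxE; apply: eq_bigr => i _.
  by rewrite linearZ !mxE.
have zero_sum : \sum_k i1 (v k) * i2 (w k) =
    \sum_(k < m) i1 ((fun=> 0) k) * i2 ((fun=> 0) k).
  by rewrite vw0 big1 // => k _; rewrite rmorph0 mul0r.
have := tensor_eq AB (@coord_bilinear R A B n c l) zero_sum.
rewrite [RHS]big1 => [sum0|k _]; last by rewrite scaler0.
by rewrite -[RHS]sum0; apply: eq_bigr => k _; rewrite mxE.
Qed.

Lemma free_on_independent (M N : lmodType R) n (e : 'I_n -> M)
    (c : {linear M -> 'rV[R]_n}) (f : {linear M -> N}) :
  free_on e c -> injective f -> forall r : 'I_n -> R,
  \sum_k r k *: f (e k) = 0 -> forall k, r k = 0.
Proof.
move=> ec f_inj r re k.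
have re0 : \sum_k r k *: e k = 0.
  apply: f_inj; rewrite linear0 linear_sum -[RHS]re.
  by apply: eq_bigr => i _; rewrite linearZ.
have : c (\sum_k r k *: e k) 0 k = 0 by rewrite re0 linear0 mxE.
rewrite linear_sum summxE (bigD1 k) //= linearZ /= ec.2 !mxE !eqxx mulr1.
rewrite big1 ?addr0 // => i ik.
by rewrite linearZ /= ec.2 !mxE eq_sym (negbTE ik) andbF mulr0.
Qed.

Lemma tensor_injective A B C D T T' (i1 : {lrmorphism A -> T})
    (i2 : {lrmorphism B -> T}) (k1 : {lrmorphism C -> T'})
    (k2 : {lrmorphism D -> T'}) (f : {lrmorphism C -> A})
    (g : {lrmorphism D -> B}) (h : {lrmorphism T' -> T}) :
  is_tensor i1 i2 -> is_tensor k1 k2 -> free_mod A -> free_mod C ->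
  torsion_free B -> injective f -> injective g ->
  lrcomp h k1 = lrcomp i1 f -> lrcomp h k2 = lrcomp i2 g -> injective h.
Proof.
move=> AB CD freeA [n [e [c ec]]] tfB f_inj g_inj hk1 hk2.
suff h0 t : h t = 0 -> t = 0.
  by move=> x y xy; apply/subr0_eq/h0; rewrite rmorphB /= xy subrr.
have [w ->] := tensor_coord CD ec t; rewrite rmorph_sum => hw0.
suff w0 k : w k = 0 by rewrite big1 // => k _; rewrite w0 rmorph0 mulr0.
apply: g_inj; rewrite rmorph0.
apply: (tensor_independent (v := f \o e) (w := g \o w) AB) => //.
  exact: free_on_independent ec f_inj.
rewrite -[RHS]hw0; apply: eq_bigr => l _; rewrite rmorphM /=.
congr (_ * _).
  exact: (congr1 (fun z : {lrmorphism C -> T} => z (e l)) (esym hk1)).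
exact: (congr1 (fun z : {lrmorphism D -> T} => z (w l)) (esym hk2)).
Qed.

(** A point of D need not come from a point of H.  But the tensor powers of D
    embed in those of A = coord H, where the universal points of D come from
    points of H: the group axioms for D follow from those for H. *)
Lemma hopf_subalgebra H D (i : {lrmorphism D -> coord H}) :
  free_mod (coord H) -> free_mod D -> injective i ->
  (forall a, exists n (u v : 'I_n -> D), forall B (x y : point H B),
     gadd x y (i a) = \sum_k x (i (u k)) * y (i (v k))) ->
  (forall a, exists b, gopp (lrid (coord H) : point H _) (i a) = i b) ->
  exists (Q : group_scheme R) (q : gs_hom H Q), [/\ free_mod (coord Q),
    injective (comorph q) &
    forall a, (exists b, comorph q b = a) <-> (exists b, i b = a)].
Proof.
move=> freeH freeD i_inj i_add i_opp.
have [TA [i1 [i2 TA12]]] := tensor_exists (coord H) freeH.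
have [TD [j1 [j2 TD12]]] := tensor_exists D freeD.
have [extA _ _] := TA12; have [extD genD _] := TD12.
have tfH := free_torsion_free dvr freeH.
have tfTA : torsion_free TA.
  by have [n [e [c ec]]] := freeH; apply: (tensor_torsion_free TA12 ec).
have [k [k1 k2]] := extD TA (lrcomp i1 i) (lrcomp i2 i).
have k_inj : injective k.
  exact: (tensor_injective TA12 TD12 freeH freeD tfH i_inj i_inj k1 k2).
have [Delta DeltaE] : exists Delta : {lrmorphism D -> TD},
    lrcomp k Delta = lrcomp (gadd (i1 : point H TA) i2) i.
  apply: factor_inj => // a; have [n [u [v uvE]]] := i_add a.
  exists (\sum_l j1 (u l) * j2 (v l)); rewrite rmorph_sum [RHS]uvE.
  apply: eq_bigr => l _; rewrite rmorphM /=; congr (_ * _).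
    exact: (congr1 (fun z : {lrmorphism D -> TA} => z (u l)) k1).
  exact: (congr1 (fun z : {lrmorphism D -> TA} => z (v l)) k2).
have [S SE] : exists S : {lrmorphism D -> D},
    lrcomp i S = lrcomp (gopp (lrid (coord H) : point H _)) i.
  by apply: factor_inj => // a; have [b bE] := i_opp a; exists b; rewrite -bE.
pose pair B (x y : {lrmorphism D -> B}) := sval (cid (extD B x y)).
have pair1 B (x y : {lrmorphism D -> B}) : lrcomp (pair B x y) j1 = x.
  by rewrite /pair; case: cid => ? [].
have pair2 B (x y : {lrmorphism D -> B}) : lrcomp (pair B x y) j2 = y.
  by rewrite /pair; case: cid => ? [].
pose add B (x y : {lrmorphism D -> B}) := lrcomp (pair B x y) Delta.
have add_compat B C (g : {lrmorphism B -> C}) (x y : {lrmorphism D -> B})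
    (x' y' : point H C) : lrcomp g x = lrcomp x' i ->
      lrcomp g y = lrcomp y' i ->
    lrcomp g (add B x y) = lrcomp (gadd x' y') i.
  move=> gx gy; have [h [hx hy]] := extA C x' y'.
  rewrite -hx -hy -gadd_nat -lrcompA -DeltaE /add !lrcompA.
  congr (lrcomp _ Delta); apply: (tensor_hom_eq TD12).
    by rewrite -!lrcompA pair1 gx k1 lrcompA hx.
  by rewrite -!lrcompA pair2 gy k2 lrcompA hy.
have add_nat B C (f : {lrmorphism B -> C}) x y :
    lrcomp f (add B x y) = add C (lrcomp f x) (lrcomp f y).
  rewrite /add lrcompA; congr (lrcomp _ Delta); apply: (tensor_hom_eq TD12).
    by rewrite -lrcompA !pair1.
  by rewrite -lrcompA !pair2.
have addC B : commutative (add B).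
  suff univ : add TD j1 j2 = add TD j2 j1.
    move=> x y; have [h [<- <-]] := extD B x y.
    by rewrite -!add_nat univ.
  apply: (lrcomp_inj k_inj).
  by rewrite (add_compat _ _ k _ _ i1 i2) //
    (add_compat _ _ k _ _ i2 i1) // gaddC.
have addA B : associative (add B).
  have [SA [l1 [l2 SA12]]] := tensor_exists TA freeH.
  have [SD [m1 [m2 SD12]]] := tensor_exists TD freeD.
  have [extS _ _] := SD12.
  have [h [h1 h2]] := extS SA (lrcomp l1 i) (lrcomp l2 k).
  have h_inj : injective h.
    exact: (tensor_injective SA12 SD12 freeH freeD tfTA i_inj k_inj h1 h2).
  have univ : add SD m1 (add SD (lrcomp m2 j1) (lrcomp m2 j2)) =
              add SD (add SD m1 (lrcomp m2 j1)) (lrcomp m2 j2).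
    have hj1 : lrcomp h (lrcomp m2 j1) = lrcomp (lrcomp l2 i1) i.
      by rewrite lrcompA h2 -lrcompA k1 lrcompA.
    have hj2 : lrcomp h (lrcomp m2 j2) = lrcomp (lrcomp l2 i2) i.
      by rewrite lrcompA h2 -lrcompA k2 lrcompA.
    apply: (lrcomp_inj h_inj).
    rewrite (add_compat _ _ h _ _ l1
      (gadd (lrcomp l2 i1 : point H SA) (lrcomp l2 i2))) //;
      last exact: add_compat.
    by rewrite gaddA; apply/esym/add_compat => //; apply: add_compat.
  move=> x y z; have [yz [yzE1 yzE2]] := extD B y z.
  have [g [g1 g2]] := extS B x yz.
  by have := congr1 (lrcomp g) univ; rewrite !add_nat !lrcompA g1 g2 yzE1 yzE2.
pose zero B : {lrmorphism D -> B} := lrcomp (gzero H B) i.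
have add0 B : left_id (zero B) (add B).
  move=> x; have univ : add D (zero D) (lrid D) = lrid D.
    apply: (lrcomp_inj i_inj).
    rewrite (add_compat _ _ i _ _ (gzero H _) (lrid _)).
    - by rewrite gadd0 lrcomp_id lrid_comp.
    - by rewrite /zero lrcompA gzero_nat.
    - by rewrite lrcomp_id lrid_comp.
  have := congr1 (lrcomp x) univ; rewrite add_nat lrid_comp.
  by rewrite /zero lrcompA gzero_nat.
pose opp B (x : {lrmorphism D -> B}) := lrcomp x S.
have addN B : left_inverse (zero B) (@opp B) (add B).
  move=> x; have univ : add D (opp D (lrid D)) (lrid D) = zero D.
    apply: (lrcomp_inj i_inj).
    rewrite (add_compat _ _ i _ _ (gopp (lrid _ : point H _)) (lrid _)).
    - by rewrite gaddN /zero lrcompA gzero_nat.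
    - by rewrite /opp lrcomp_id SE.
    - by rewrite lrcomp_id lrid_comp.
  have := congr1 (lrcomp x) univ; rewrite add_nat lrid_comp.
  by rewrite /zero /opp !lrcompA gzero_nat lrid_comp.
pose Q := GroupScheme addA addC add0 addN add_nat.
have q_add B (x y : point H B) :
    lrcomp (gadd x y) i = gadd (lrcomp x i : point Q B) (lrcomp y i).
  apply/esym; rewrite -[LHS]lrcomp_id; apply: add_compat; exact: lrcomp_id.
by exists Q, (@GsHom R H Q i q_add); split.
Qed.

Definition invariant G H (f : gs_hom G H) (a : coord H) :=
  forall T, torsion_free T -> forall (x : point G T) (y : point H T),
    gadd (on_points f x) y a = y a.

(** Write the sum law on an invariant function as \sum_k e k (x) t k.
    Translating the second argument, for a universal first argument, shows that
    the t k are invariant.  In a basis b of the invariant functions the law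
    becomes \sum_l g l (x) b l, and translating the first argument shows that
    the g l are invariant: the comultiplication preserves the subalgebra. *)
Lemma cokernel_exists G H (f : gs_hom G H) : free_mod (coord H) ->
  exists (Q : group_scheme R) (q : gs_hom H Q), [/\ free_mod (coord Q),
    injective (comorph q) &
    forall a, (exists b, comorph q b = a) <-> invariant f a].
Proof.
move=> freeH; have tfH := free_torsion_free dvr freeH.
have [||||D [i [i_inj iD]]] := @subalgebra R (coord H) (invariant f).
- by move=> T tfT x y; rewrite !rmorph1.
- by move=> a b Da Db T tfT x y; rewrite !rmorphB /= Da // Db.
- by move=> a b Da Db T tfT x y; rewrite !rmorphM /= Da // Db.
- by move=> r a Da T tfT x y; rewrite !linearZ /= Da.
have freeD : free_mod D := free_submodule dvr freeH i_inj.
have [n [e [c ec]]] := freeH; have [m [b [b' bb']]] := freeD.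
have i_add a : exists n (u v : 'I_n -> D), forall B (x y : point H B),
    gadd x y (i a) = \sum_k x (i (u k)) * y (i (v k)).
  have inv_a : invariant f (i a) by apply/iD; exists a.
  have [d dE] := comultiplication ec.
  pose t k := d k (i a).
  have tP B (x y : point H B) : gadd x y (i a) = \sum_k x (e k) * y (t k).
    exact: dE.
  have inv_t k : invariant f (t k).
    move=> B tfB x z; have [U [a1 [a2 U12]]] := tensor_exists B freeH.
    have tfU : torsion_free U := tensor_torsion_free U12 ec tfB.
    have := inv_a U tfU (lrcomp a2 x) (gadd (a1 : point H U) (lrcomp a2 z)).
    rewrite gaddA [gadd _ (a1 : point H U)]gaddC -gaddA !tP.
    rewrite -on_points_nat -gadd_nat => /(tensor_coord_inj U12 ec (w := fun k =>
      gadd (on_points f x) z (t k)) (w' := fun k => z (t k))); exact.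
  pose s k := sval (cid ((iD (t k)).1 (inv_t k))).
  have sE k : i (s k) = t k by rewrite /s; case: cid.
  pose g l := \sum_k b' (s k) 0 l *: e k.
  have gP B (x y : point H B) : gadd x y (i a) = \sum_l x (g l) * y (i (b l)).
    rewrite tP; under [RHS]eq_bigr do rewrite linear_sum mulr_suml.
    rewrite exchange_big; apply: eq_bigr => k _ /=.
    rewrite -sE {1}[s k]bb'.1 !linear_sum mulr_sumr; apply: eq_bigr => l _.
    by rewrite !linearZ /= -scalerAl -scalerAr.
  have inv_g l : invariant f (g l).
    move=> B tfB x y; have [U [a1 [a2 U12]]] := tensor_exists B freeH.
    have tfU : torsion_free U := tensor_torsion_free U12 ec tfB.
    have := inv_a U tfU (lrcomp a2 x) (gadd (lrcomp a2 y) (a1 : point H U)).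
    rewrite gaddA !gP -on_points_nat -gadd_nat => /eqP.
    rewrite -subr_eq0 -sumrB => /eqP sum0; apply/subr0_eq.
    move: l; apply: (tensor_independent (v := i \o b) (w := fun l =>
      gadd (on_points f x) y (g l) - y (g l)) U12 freeH tfB).
      exact: free_on_independent bb' i_inj.
    rewrite -[RHS]sum0; apply: eq_bigr => l _.
    by rewrite rmorphB mulrBr ![a1 _ * _]mulrC.
  pose u l := sval (cid ((iD (g l)).1 (inv_g l))).
  have uE l : i (u l) = g l by rewrite /u; case: cid.
  by exists m, u, b => B x y; rewrite gP; apply: eq_bigr => l _; rewrite uE.
have i_opp a : exists b, gopp (lrid (coord H) : point H _) (i a) = i b.
  have inv_a : invariant f (i a) by apply/iD; exists a.
  suff /iD[d dE] : invariant f (gopp (lrid (coord H) : point H _) (i a)).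
    by exists d.
  move=> B tfB x y.
  have oppE (z : point H B) : z (gopp (lrid (coord H) : point H _) (i a)) =
      gopp z (i a).
    by rewrite -[in RHS](lrid_comp z) -gopp_nat.
  by rewrite !oppE goppD -on_pointsN inv_a.
have [Q [q [freeQ q_inj qE]]] := hopf_subalgebra freeH freeD i_inj i_add i_opp.
exists Q, q; split=> // a; split=> [/qE[d dE]|/iD[d dE]].
  by apply/iD; exists d.
by apply/qE; exists d.
Qed.

End Quotients.

(** * Integrals and separability *)

Section Integrals.
Variables (R : comNzRingType) (K : fieldType) (j : {rmorphism R -> K}) (pi : R).
Hypothesis dvr : dvr_in j pi.
Implicit Types (G H X Y Z : group_scheme R) (A B C D T : comAlgType R).

Definition counit G : {lrmorphism coord G -> R^o} := gzero G R^o.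

Definition is_integral G (t : coord G) :=
  forall a, a * t = (counit G a : R) *: t.

Lemma counitE G B a : gzero G B a = (counit G a : R)%:A.
Proof. exact: gzeroE. Qed.

(** On the augmentation ideal I, multiplication by N on the group acts as N
    modulo I^2.  If it is zero, then N annihilates I / I^2, and the determinant
    trick gives an element of N^n + I that annihilates I. *)
Lemma integral_exists G n (e : 'I_n -> coord G)
    (c : {linear coord G -> 'rV[R]_n}) N : free_on e c ->
  (forall B (x : point G B), gmuln N x = gzero G B) ->
  exists t, is_integral t /\ counit G t = (N%:R ^+ n : R).
Proof.
move=> ec killN; pose A := coord G; have [d dE] := comultiplication ec.
pose eps (a : A) : R := counit G a.
have epsA a : gzero G A a = (eps a)%:A by rewrite counitE.
pose aug (a : A) : A := a - (eps a)%:A.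
have eps1 r : eps r%:A = r.
  by rewrite /eps linearZ /= rmorph1 [_ *: _]mulr1.
have eps_aug a : eps (aug a) = 0.
  by rewrite /eps /aug rmorphB [X in _ - X]eps1 subrr.
have aug_basis a : aug a = \sum_i c (aug a) 0 i *: aug (e i).
  under eq_bigr do rewrite scalerBr scalerA.
  rewrite sumrB -ec.1 -scaler_suml -[LHS]subr0; congr (_ - _).
  have -> : \sum_i c (aug a) 0 i * eps (e i) = eps (aug a).
    rewrite {2}[aug a]ec.1 /eps linear_sum; apply: eq_bigr => i _.
    by rewrite linearZ.
  by rewrite eps_aug scale0r.
pose X M : point G A := gmuln M (lrid A).
have eps_X M a : eps (X M a) = eps a.
  have -> : eps (X M a) = lrcomp (counit G) (X M) a by [].
  rewrite gmuln_nat lrid_comp gmuln0; exact: erefl.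
have step (Y : point G A) a : gadd (lrid A) Y a = aug a + Y a +
    \sum_k (Y (e k) - (eps (e k))%:A) * aug (d k a).
  have ->: \sum_k (Y (e k) - (eps (e k))%:A) * aug (d k a) =
      gadd Y (lrid A) a - gadd (gzero G A) (lrid A) a -
      (gadd Y (gzero G A) a - gadd (gzero G A) (gzero G A) a).
    rewrite !dE -!sumrB; apply: eq_bigr => k _.
    by rewrite !epsA /aug /=; ring.
  rewrite gaddC !gadd0 gadd_r0 epsA /aug /=.
  by ring.
(* The last sum lies in I^2, since the coefficients u i lie in I. *)
have claim M a : exists u : 'I_n -> A, (forall i, eps (u i) = 0) /\
    X M a = (eps a)%:A + M%:R * aug a + \sum_i u i * aug (e i).
  elim: M a => [|M IH] a.
    exists (fun=> 0); split=> [i|]; first by rewrite /eps rmorph0.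
    rewrite big1 => [|i _]; last by rewrite mul0r.
    by rewrite mul0r !addr0 [LHS]epsA.
  have [u [u0 uE]] := IH a.
  pose w k i := (X M (e k) - (eps (e k))%:A) * (c (aug (d k a)) 0 i)%:A.
  exists (fun i => u i + \sum_k w k i); split=> [i|].
    rewrite /eps rmorphD [X in X + _]u0 add0r rmorph_sum big1 // => k _.
    by rewrite rmorphM rmorphB [X in X - _]eps_X [X in _ - X]eps1 subrr mul0r.
  have -> : X M.+1 a = gadd (lrid A) (X M) a by [].
  rewrite step uE; under [in RHS]eq_bigr do rewrite mulrDl mulr_suml.
  rewrite big_split /= [X in _ = _ + (_ + X)]exchange_big /=.
  have -> : \sum_k (X M (e k) - (eps (e k))%:A) * aug (d k a) =
      \sum_k \sum_i w k i * aug (e i).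
    apply: eq_bigr => k _; rewrite [in LHS]aug_basis mulr_sumr.
    by apply: eq_bigr => i _; rewrite /w -mulrA mulr_algl.
  by rewrite -[M.+1]addn1 natrD; ring.
pose u k := sval (cid (claim N (e k))).
have [u0 uE] : (forall k i, eps (u k i) = 0) /\ (forall k,
    X N (e k) = (eps (e k))%:A + N%:R * aug (e k) + \sum_i u k i * aug (e i)).
  by split=> k; rewrite /u; case: cid => ? [].
(* As X N is zero, the vector of the aug (e i), which generate I, is killed by
   a matrix that is N times the identity modulo I. *)
pose U : 'M[A]_n := \matrix_(k, i) (u k i + N%:R *+ (k == i)).
have Uaug : U *m \col_i aug (e i) = 0.
  apply/colP => k; rewrite !mxE.
  have := uE k; rewrite /X killN epsA -[LHS]addr0 -addrA => /addrI.
  move=> rel; rewrite [RHS]rel addrC; under eq_bigr do rewrite !mxE mulrDl.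
  rewrite big_split /=; congr (_ + _).
  rewrite (bigD1 k) //= eqxx mulr1n big1 ?addr0 // => i ik.
  by rewrite eq_sym (negbTE ik) mulr0n mul0r.
have det_aug i : \det U * aug (e i) = 0.
  have : (\adj U *m U) *m \col_i aug (e i) = 0 by rewrite -mulmxA Uaug mulmx0.
  by rewrite mul_adj_mx mul_scalar_mx => /colP/(_ i); rewrite !mxE.
exists (\det U); split=> [a|].
  rewrite mulrC; have -> : a = (eps a)%:A + aug a by rewrite addrC subrK.
  rewrite mulrDr [X in _ + X](_ : _ = 0) ?addr0; last first.
    rewrite aug_basis mulr_sumr big1 // => i _.
    by rewrite -scalerAr det_aug scaler0.
  have -> : counit G ((eps a)%:A + aug a) = eps a.
    by rewrite -[a in RHS](subrK (eps a)%:A) addrC.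
  by rewrite mulrC mulr_algl.
rewrite -det_map_mx.
suff -> : map_mx (counit G) U = (N%:R : R)%:M by rewrite det_scalar.
apply/matrixP => k i; rewrite !mxE rmorphD [X in X + _]u0 add0r.
by rewrite rmorphMn /= rmorph_nat.
Qed.

(** The element \sum_k u k (x) v k of the tensor square is mu times a
    separability idempotent: both actions of A on it agree, and its product is
    mu.  Equality in the tensor square is tested by bilinear maps. *)
Definition casimir A n (u v : 'I_n -> A) (mu : R) :=
  (forall (P : lmodType R) (b : A -> A -> P) a, bilinear_map b ->
     \sum_k b (a * u k) (v k) = \sum_k b (u k) (a * v k)) /\
  \sum_k u k * v k = mu%:A.

(** For t an integral, t(x - y) is supported on the diagonal: x = (x - y) + y,
    and the functions of x - y act on it through their value at the origin. *)
Lemma integral_gsub G (t : coord G) B (x y : point G B) a :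
  free_mod (coord G) -> is_integral t ->
  x a * gsub x y t = y a * gsub x y t.
Proof.
move=> [n [e [c ec]]] t_int; have [d dE] := comultiplication ec.
rewrite -{1}[x](gsubK x y) dE mulr_suml.
have -> : y a = gadd (gzero G B) y a by rewrite gadd0.
rewrite dE mulr_suml; apply: eq_bigr => k _.
rewrite mulrAC -rmorphM t_int /= linearZ /= counitE.
by rewrite mulr_algl -!scalerAl; congr (_ *: _); apply: mulrC.
Qed.

Lemma casimir_of_integral G (t : coord G) n (u v : 'I_n -> coord G) :
  free_mod (coord G) -> is_integral t ->
  (forall B (x y : point G B), gsub x y t = \sum_k x (u k) * y (v k)) ->
  casimir u v (counit G t).
Proof.
move=> freeG t_int uv; split=> [P b a bb|]; last first.
  by rewrite -(uv _ (lrid _) (lrid _)) gsubxx counitE.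
have [T [i1 [i2 T12]]] := tensor_exists (coord G) freeG.
apply: (tensor_eq T12 bb).
have := integral_gsub (i1 : point G T) i2 a freeG t_int.
rewrite uv !mulr_sumr => E.
rewrite (eq_bigr (fun k => i1 a * (i1 (u k) * i2 (v k)))) => [|k _]; last first.
  by rewrite rmorphM mulrA.
rewrite E; apply: eq_bigr => k _; rewrite rmorphM mulrCA; exact: erefl.
Qed.

Lemma integral_coords G (t : coord G) n (e : 'I_n -> coord G)
    (c : {linear coord G -> 'rV[R]_n}) : free_on e c ->
  exists v : 'I_n -> coord G, forall B (x y : point G B),
    gsub x y t = \sum_k x (e k) * y (v k).
Proof.
move=> ec; have [d dE] := comultiplication ec.
exists (fun k => gopp (lrid (coord G) : point G _) (d k t)) => B x y.
rewrite /gsub dE; apply: eq_bigr => k _; congr (_ * _).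
by rewrite -[in LHS](lrid_comp y) -gopp_nat.
Qed.

(** The coefficient of v k is the trace of the multiplication by a * u k.
    Moving a * e i across the Casimir element turns the sum of these traces into
    \sum_k a * (u k * v k). *)
Lemma casimir_trace A n m (e : 'I_n -> A) (c : {linear A -> 'rV[R]_n})
    (u v : 'I_m -> A) mu a : free_on e c -> casimir u v mu ->
  mu *: a = \sum_k (\sum_i c (a * u k * e i) 0 i) *: v k.
Proof.
move=> ec [uv_move uv].
under eq_bigr do rewrite scaler_suml.
rewrite exchange_big /=.
have swap i : \sum_k c (a * u k * e i) 0 i *: v k =
    \sum_k c (u k) 0 i *: (a * e i * v k).
  have := uv_move A (fun x y => c x 0 i *: y) (a * e i)
    (@coord_bilinear R A A n c i).
  by move=> <-; apply: eq_bigr => k _; rewrite mulrAC.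
rewrite (eq_bigr _ (fun i _ => swap i)) exchange_big /=.
transitivity (\sum_k a * (u k * v k)).
  by rewrite -mulr_sumr uv -scalerAr mulr1.
apply: eq_bigr => k _; rewrite {1}[u k]ec.1 mulr_suml mulr_sumr.
by apply: eq_bigr => i _; rewrite -scalerAl -scalerAr mulrA.
Qed.

(** An equation that holds after multiplication by t is an equality in the
    quotient by the annihilator of t; that quotient embeds in A as a module, so
    it is a test algebra without torsion. *)
Lemma annihilator_quotient A (t : A) : torsion_free A -> t != 0 ->
  exists T (q : {lrmorphism A -> T}), [/\ torsion_free T,
    forall c, exists a, q a = c & forall a, q a = 0 <-> a * t = 0].
Proof.
move=> tfA t0.
have [|||T [q [q_onto qJ]]] := @quotient_algebra R A (fun a => a * t = 0).
- by rewrite mul1r => /eqP; rewrite (negbTE t0).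
- by rewrite mul0r.
- by move=> a x y xt yt; rewrite mulrDl -mulrA xt yt mulr0 addr0.
exists T, q; split=> // d c d0; have [a <-] := q_onto c.
rewrite -linearZ => /qJ; rewrite -scalerAl => /(tfA _ _ d0) at0.
exact/qJ.
Qed.

(** The integral of Y restricts to an integral of X, because the generic kernel
    is trivial; so the Casimir element of X comes from Y, and the trace formula
    expresses every function on X through functions on Y. *)
Lemma generic_mono_bound X Y (f : gs_hom X Y) n (e : 'I_n -> coord Y)
    (c : {linear coord Y -> 'rV[R]_n}) N :
  free_mod (coord X) -> free_on e c ->
  (forall B (y : point Y B), gmuln N y = gzero Y B) -> N%:R != 0 :> R ->
  (forall a, counit X a = 0 -> generic_kernel f a) ->
  forall a, exists b, (N%:R ^+ n : R) *: a = comorph f b.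
Proof.
move=> freeX ec killN N0 f_mono a.
have tfX := free_torsion_free dvr freeX.
have [t [t_int t_eps]] := integral_exists ec killN.
pose s := comorph f t.
have eps_f b : counit X (comorph f b) = counit Y b.
  exact: (congr1 (fun h : {lrmorphism _ -> _} => h b) (on_points0 f R^o)).
have s_eps : counit X s = (N%:R ^+ n : R) by rewrite eps_f.
have s0 : s != 0.
  apply: contra_neq (dvr_exp_neq0 dvr n N0) => s0.
  by rewrite -s_eps s0 rmorph0.
have [T [q [tfT q_onto qs]]] := annihilator_quotient tfX s0.
have s_int : is_integral s.
  move=> x; apply/eqP; rewrite -subr_eq0 -[X in _ - X]mulr_algl -mulrBl.
  apply/eqP/qs; apply: (f_mono _ _ T tfT).
    by rewrite rmorphB /= linearZ /= rmorph1 [_ *: _]mulr1 subrr.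
  apply: lrmorphism_ext => b; rewrite counitE /=; apply/eqP.
  rewrite -(rmorph1 q) -linearZ -subr_eq0 -rmorphB; apply/eqP/qs.
  have -> : comorph f b - (counit Y b : R) *: 1 =
      comorph f (b - (counit Y b : R)%:A).
    by rewrite rmorphB /= [comorph f _%:A]linearZ /= rmorph1.
  by rewrite -rmorphM mulrBl t_int mulr_algl subrr rmorph0.
have [v vE] := integral_coords t ec.
have cas : casimir (comorph f \o e) (comorph f \o v) (N%:R ^+ n : R).
  rewrite -s_eps; apply: casimir_of_integral => // B x y.
  have -> : gsub x y s = on_points f (gsub x y) t by [].
  by rewrite on_pointsB vE.
have [m [e' [c' ec']]] := freeX.
rewrite (casimir_trace a ec' cas).
exists (\sum_k (\sum_i c' (a * comorph f (e k) * e' i) 0 i) *: v k).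
by rewrite linear_sum; apply: eq_bigr => k _; rewrite linearZ.
Qed.

End Integrals.

(** * Images and fibre products *)

Section Exactness.
Variables (R : comNzRingType) (K : fieldType) (j : {rmorphism R -> K}) (pi : R).
Hypothesis dvr : dvr_in j pi.
Implicit Types (G H X Y Z : group_scheme R) (A B C D T : comAlgType R).

Definition has_casimir A := exists n (u v : 'I_n -> A) (mu : R),
  mu != 0 /\ casimir u v mu.

Lemma group_casimir G N : free_mod (coord G) -> N%:R != 0 :> R ->
  (forall B (x : point G B), gmuln N x = gzero G B) -> has_casimir (coord G).
Proof.
move=> freeG N0 killN; have [n [e [c ec]]] := freeG.
have [t [t_int t_eps]] := integral_exists ec killN.
have [v vE] := integral_coords t ec.
exists n, e, v, (N%:R ^+ n); split; first exact: (dvr_exp_neq0 dvr n N0).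
by rewrite -t_eps; apply: casimir_of_integral.
Qed.

(** The image of f, with functions C, is stable under translation by f(x).  The
    universal pair (x, z) lives in the tensor product of coord X and C, which
    embeds in the tensor square of coord X, where z lifts to a point of X. *)
Lemma image_add X Y (f : gs_hom X Y) C (p : {lrmorphism coord Y -> C})
    (g : {lrmorphism C -> coord X}) B (x : point X B) (z : {lrmorphism C -> B})
    a :
  free_mod (coord X) -> free_mod C -> injective g -> lrcomp g p = comorph f ->
  comorph f a = 0 -> gadd (on_points f x) (lrcomp z p) a = 0.
Proof.
move=> freeX freeC g_inj gp fa.
have tfX := free_torsion_free dvr freeX.
have [T [i1 [i2 T12]]] := tensor_exists (coord X) freeX.
have [U [k1 [k2 U12]]] := tensor_exists C freeX.
have [extU _ _] := U12.
have [h [h1 h2]] := extU T i1 (lrcomp i2 g).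
have h_inj : injective h.
  apply: (tensor_injective dvr T12 U12 freeX freeX tfX (f := lrid _) _ g_inj).
  - by [].
  - by rewrite lrid_comp.
  - by [].
have [w [w1 w2]] := extU B x z.
have univ : gadd (on_points f (k1 : point X U)) (lrcomp k2 p) a = 0.
  apply: h_inj; rewrite rmorph0.
  have -> : h (gadd (on_points f (k1 : point X U)) (lrcomp k2 p) a) =
      lrcomp h (gadd (on_points f (k1 : point X U)) (lrcomp k2 p)) a by [].
  rewrite gadd_nat on_points_nat h1 lrcompA h2 -lrcompA gp.
  rewrite -[lrcomp i2 _]/(on_points f (i2 : point X T)) -on_pointsD /=.
  by rewrite fa rmorph0.
have := congr1 w univ; rewrite rmorph0 => <-.
have -> : w (gadd (on_points f (k1 : point X U)) (lrcomp k2 p) a) =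
    lrcomp w (gadd (on_points f (k1 : point X U)) (lrcomp k2 p)) a by [].
by rewrite gadd_nat on_points_nat w1 lrcompA w2.
Qed.

(** Let A = coord Y and let C be its quotient, the ring of functions on the
    image of f.  Contracting the Casimir element of A with a linear section of A
    -> C gives a function u that annihilates the kernel J of A -> C and equals
    mu modulo J: mu times the idempotent that cuts out the image.  Modulo the
    annihilator of y(u), the point y lies in the image, hence so does f(x) + y,
    on which u is mu; thus y(u) * (f(x) + y)(u) = mu * y(u).  Exchanging the
    roles of y and f(x) + y gives the invariance of u. *)
Lemma image_indicator X Y (f : gs_hom X Y) :
  free_mod (coord X) -> free_mod (coord Y) -> has_casimir (coord Y) ->
  exists u mu, [/\ mu != 0, invariant f u, counit Y u = (mu : R) &
    forall a, comorph f a = 0 -> u * a = 0].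
Proof.
move=> freeX freeY [n [e [v [mu [mu0 [ev_move ev]]]]]].
have tfX := free_torsion_free dvr freeX.
have [|||C [p [p_onto pJ]]] := @quotient_algebra R (coord Y)
  (fun a => comorph f a = 0).
- by rewrite rmorph1 => /eqP; rewrite oner_eq0.
- exact: rmorph0.
- by move=> a x y fx fy; rewrite rmorphD rmorphM /= fx fy mulr0 addr0.
have [g gp] : exists g : {lrmorphism C -> coord X}, lrcomp g p = comorph f.
  by apply: factor_surj => // a /pJ.
have gpE a : g (p a) = comorph f a.
  exact: (congr1 (fun h : {lrmorphism _ -> _} => h a) gp).
have g_inj : injective g.
  move=> c d; have [a <-] := p_onto c; have [b <-] := p_onto d.
  rewrite !gpE => ab; apply/subr0_eq; rewrite -rmorphB; apply/pJ.
  by rewrite rmorphB /= ab subrr.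
have freeC : free_mod C := free_submodule dvr freeX g_inj.
have [s sK] := linear_section freeC p_onto.
pose u := \sum_k e k * s (p (v k)).
have bb : bilinear_map (fun a b => a * s (p b)).
  split=> [b r a a'|a r b b']; first by rewrite mulrDl -scalerAl.
  by rewrite !linearP /= mulrDr -scalerAr.
have uJ a : comorph f a = 0 -> u * a = 0.
  move=> /pJ pa; rewrite mulrC mulr_sumr.
  transitivity (\sum_k e k * s (p (a * v k))).
    rewrite -(ev_move _ _ a bb); apply: eq_bigr => k _; exact: mulrA.
  by rewrite big1 // => k _; rewrite rmorphM /= pa mul0r linear0 mulr0.
have u_mu : comorph f (u - mu%:A) = 0.
  apply/pJ; rewrite rmorphB rmorph_sum -ev rmorph_sum -sumrB big1 // => k _.
  by rewrite !rmorphM /= sK subrr.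
have u_add B (x : point X B) (y : point Y B) : torsion_free B ->
    y u * gadd (on_points f x) y u = mu *: y u.
  move=> tfB; have [->|yu0] := eqVneq (y u) 0; first by rewrite mul0r scaler0.
  have [B' [q [tfB' q_onto qE]]] := annihilator_quotient tfB yu0.
  have [z zp] : exists z, lrcomp z p = lrcomp q y.
    apply: factor_surj => // a /pJ fa; apply/qE.
    by rewrite mulrC -rmorphM uJ // rmorph0.
  have := image_add (lrcomp q x) z freeX freeC g_inj gp u_mu.
  rewrite zp -on_points_nat -gadd_nat /= => /qE.
  move=> S_mu; apply/subr0_eq; rewrite -[RHS]S_mu rmorphB /= mulrBl.
  have -> : gadd (on_points f x) y mu%:A = mu%:A by rewrite linearZ /= rmorph1.
  by rewrite mulr_algl; congr (_ - _); apply: mulrC.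
exists u, mu; split=> //.
  move=> B tfB x y; apply/subr0_eq/(tfB mu _ mu0).
  rewrite scalerBr -(u_add _ x y) //.
  have := u_add _ (gopp x) (gadd (on_points f x) y) tfB.
  by rewrite gaddA on_pointsN gaddN gadd0 => <-; rewrite mulrC subrr.
have : counit Y (u - mu%:A) = 0.
  transitivity (counit X (comorph f (u - mu%:A))); last by rewrite u_mu rmorph0.
  exact: (congr1 (fun h : {lrmorphism _ -> _} => h _)
    (esym (on_points0 f R^o))).
rewrite rmorphB /= [X in _ - X]linearZ /= rmorph1 => /subr0_eq ->.
exact: mulr1.
Qed.

(** The points of the kernel of Y -> Y / X lie in the image of X: the indicator
    u of the image is invariant, so y(u) = mu, whereas y(u) * y(a) = 0. *)
Lemma kernel_of_cokernel X Y (f : gs_hom X Y) T (y : point Y T) a :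
  free_mod (coord X) -> free_mod (coord Y) -> has_casimir (coord Y) ->
  torsion_free T -> (forall b, invariant f b -> y b = gzero Y T b) ->
  comorph f a = 0 -> y a = 0.
Proof.
move=> freeX freeY casY tfT y_inv fa.
have [u [mu [mu0 u_inv u_eps uJ]]] := image_indicator f freeX freeY casY.
apply: (tfT mu) => //; have := congr1 y (uJ a fa).
by rewrite rmorphM /= (y_inv u u_inv) counitE u_eps mulr_algl rmorph0.
Qed.

Lemma linear_retraction (M N : lmodType R) (f : {linear M -> N}) :
  free_mod M -> free_mod N -> injective f ->
  exists (r : {linear N -> M}) d, d != 0 /\ forall x, r (f x) = d *: x.
Proof.
move=> [m [e [c ec]]] [n [e' [c' ec']]] f_inj.
pose F := matrix_of e c' f; have FE x : c' (f x) = c x *m F.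
  exact: matrix_ofE.
have [v vF|d [G [d0 FG]]] := injective_matrix dvr (F := F).
  pose x := \sum_k v 0 k *: e k.
  have cx : c x = v.
    rewrite /x linear_sum [RHS]row_sum_delta; apply: eq_bigr => k _.
    by rewrite linearZ /= ec.2.
  have fx : f x = 0.
    rewrite [f x]ec'.1 FE cx vF big1 // => k _; by rewrite mxE scale0r.
  have x0 : x = 0 by apply: f_inj; rewrite fx linear0.
  by rewrite -cx x0 linear0.
have [|r rE] := @linear_of R N M (fun y => \sum_k (c' y *m G) 0 k *: e k).
  move=> s x y; rewrite scaler_sumr -big_split; apply: eq_bigr => k _ /=.
  by rewrite linearP mulmxDl -scalemxAl !mxE scalerDl scalerA.
exists r, d; split=> // x; rewrite rE FE -mulmxA FG mul_mx_scalar.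
rewrite [x in RHS]ec.1 scaler_sumr; apply: eq_bigr => k _.
by rewrite mxE scalerA.
Qed.

(** By separability, a linear retraction of the injection of Y-functions into
    X-functions can be averaged into one that is linear over the functions on Y.
    Base change to Z gives a map psi from the functions on the product of X and
    Z to the functions on Z, up to the scalar d * mu a retraction of the
    pullback; the largest ideal in the kernel of psi defines a torsion-free
    quotient in which the two maps to Y agree. *)
Lemma fibre_product_injective X Y Z P (f : gs_hom X Y) (z : gs_hom Z Y)
    (p1 : gs_hom P X) (p2 : gs_hom P Z) a :
  free_mod (coord X) -> free_mod (coord Y) -> free_mod (coord Z) ->
  has_casimir (coord Y) -> is_tensor (comorph p1) (comorph p2) ->
  injective (comorph f) ->
  (forall T, torsion_free T -> forall x : point P T,
     on_points f (on_points p1 x) = on_points z (on_points p2 x) ->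
     x (comorph p2 a) = 0) -> a = 0.
Proof.
move=> freeX freeY freeZ [n [e [v [mu [mu0 [ev_move ev]]]]]] P12 f_inj a0.
have tfZ := free_torsion_free dvr freeZ.
have [r0 [d [d0 r0f]]] := linear_retraction freeY freeX f_inj.
pose r x := \sum_k r0 (comorph f (e k) * x) * v k.
have r_lin b x : r (comorph f b * x) = b * r x.
  have bb : bilinear_map (fun a a' : coord Y => r0 (comorph f a * x) * a').
    split=> [a' s c c'|c s a' a'']; last by rewrite mulrDr -scalerAr.
    by rewrite linearP /= mulrDl -scalerAl linearP /= mulrDl -scalerAl.
  rewrite /r mulr_sumr.
  transitivity (\sum_k r0 (comorph f (b * e k) * x) * v k).
    by apply: eq_bigr => k _; rewrite rmorphM /= mulrCA mulrA.
  rewrite (ev_move _ _ b bb); apply: eq_bigr => k _; exact: mulrCA.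
have r1 : r 1 = (d * mu)%:A.
  rewrite /r -scalerA -ev scaler_sumr; apply: eq_bigr => k _.
  by rewrite mulr1 r0f -scalerAl.
have [_ gen ext] := P12.
have [|psi psiE] := ext (coord Z) (fun x w => comorph z (r x) * w).
  split=> [w s x x'|x s w w']; last by rewrite mulrDr -scalerAr.
  have -> : r (s *: x + x') = s *: r x + r x'.
    rewrite /r scaler_sumr -big_split; apply: eq_bigr => k _ /=.
    by rewrite mulrDr -scalerAr linearP /= mulrDl -scalerAl.
  by rewrite linearP /= mulrDl -scalerAl.
have psi2 w : psi (comorph p2 w) = (d * mu) *: w.
  rewrite -[comorph p2 w]mul1r -(rmorph1 (comorph p1)) psiE r1 linearZ /=.
  by rewrite rmorph1 mulr_algl.
have dmu0 : d * mu != 0 := dvr_mul_neq0 dvr d0 mu0.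
have [|||T [q [q_onto qJ]]] :=
  @quotient_algebra R (coord P) (fun t => forall t', psi (t * t') = 0).
- move=> /(_ 1); rewrite mulr1 -(rmorph1 (comorph p2)) psi2.
  by move=> /(tfZ _ _ dmu0)/eqP; rewrite oner_eq0.
- by move=> t'; rewrite mul0r linear0.
- move=> s x y xt yt t'; rewrite mulrDl linearD /= yt addr0.
  by rewrite [s * x]mulrC -mulrA xt.
have tfT : torsion_free T.
  move=> s t s0; have [b <-] := q_onto t; rewrite -linearZ => /qJ sb.
  apply/qJ => t'; apply: (tfZ s) => //.
  by rewrite -linearZ scalerAl sb.
have qa : q (comorph p2 a) = 0.
  apply: a0 => //; apply: lrmorphism_ext => b /=.
  apply/subr0_eq; rewrite -rmorphB; apply/qJ => t.
  have [m [x [w ->]]] := gen t; rewrite mulr_sumr linear_sum big1 // => k _.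
  rewrite /= mulrBl linearB mulrA -rmorphM /= psiE r_lin.
  rewrite mulrCA -rmorphM /= psiE rmorphM /=.
  by rewrite mulrA [comorph z b * _]mulrC subrr.
move: qa => /qJ/(_ 1); rewrite mulr1 psi2; exact: tfZ.
Qed.

End Exactness.

(** * The category of finite flat group schemes *)

Section FiniteFlat.
Variables (R : comNzRingType) (K : fieldType) (j : {rmorphism R -> K}) (pi : R).
Hypothesis dvr : dvr_in j pi.
Variable p : nat.
Hypothesis p_neq0 : p%:R != 0 :> R.
Implicit Types (G H L : group_scheme R) (A B C T : comAlgType R).

Definition finite_flat_p G := finite_flat G /\ killed_by_power p G.

Lemma finite_flat_freeE G : finite_flat G <-> free_mod (coord G).
Proof. exact: finite_flat_free dvr _. Qed.

Lemma killed_of_universal G N :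
  gmuln N (lrid (coord G) : point G _) = gzero G _ ->
  forall B (x : point G B), gmuln N x = gzero G B.
Proof.
by move=> killN B x; rewrite -[x]lrid_comp -gmuln_nat killN gzero_nat.
Qed.

Lemma killed_of_injective G H (f : gs_hom G H) N :
  injective (comorph f) -> (forall B (x : point G B), gmuln N x = gzero G B) ->
  forall B (y : point H B), gmuln N y = gzero H B.
Proof.
move=> f_inj killN; apply: killed_of_universal; apply: (lrcomp_inj f_inj).
rewrite gmuln_nat gzero_nat lrid_comp.
have -> : comorph f = on_points f (lrid (coord G)).
  by rewrite /on_points lrcomp_id.
by rewrite -on_points_muln killN on_points0.
Qed.

Lemma killed_of_surjective G H (f : gs_hom G H) N :
  (forall a, exists b, comorph f b = a) ->
  (forall B (x : point H B), gmuln N x = gzero H B) ->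
  forall B (y : point G B), gmuln N y = gzero G B.
Proof.
move=> f_onto killN B y; apply: (lrcomp_surj f_onto).
by rewrite -/(on_points f _) on_points_muln killN -(on_points0 f).
Qed.

Lemma comorph_eq0 G H (f : gs_hom G H) :
  (forall b, comorph f b = gzero H _ b) -> f = gs_zero G H.
Proof. by move=> f0; apply: gs_hom_eq; apply: lrmorphism_ext. Qed.

Lemma augmentation_generic_kernel G H (f : gs_hom G H) b :
  generic_kernel f (comorph f (b - (counit H b : R)%:A)).
Proof.
move=> T tfT x fx.
have -> : x (comorph f (b - (counit H b : R)%:A)) =
  on_points f x (b - (counit H b : R)%:A) by [].
by rewrite fx rmorphB /= counitE linearZ /= rmorph1 subrr.
Qed.

Lemma trivial_group_exists : exists Z : group_scheme R,
  free_mod (coord Z) /\ forall B (x y : point Z B), x = y.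
Proof.
have R_eq B (x y : {lrmorphism R^o -> B}) : x = y.
  apply: lrmorphism_ext => r; rewrite -[r]mulr1 -[r * 1]/(r *: 1).
  by rewrite !linearZ !rmorph1.
have unitP B : {h : {lrmorphism R^o -> B} | forall r, h r = r%:A}.
  by apply: cid; apply: unit_exists.
have addA B : associative (fun x y : {lrmorphism R^o -> B} => x) by [].
have addC B : commutative (fun x y : {lrmorphism R^o -> B} => x).
  by move=> x y.
have add0 B : left_id (sval (unitP B)) (fun x y : {lrmorphism R^o -> B} => x).
  by move=> x.
have addN B : left_inverse (sval (unitP B)) id
    (fun x y : {lrmorphism R^o -> B} => x).
  by move=> x.
have add_nat B C (f : {lrmorphism B -> C}) (x y : {lrmorphism R^o -> B}) :
  lrcomp f x = lrcomp f x by [].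
exists (@GroupScheme R (R^o : comAlgType R) _ _ _ addA addC add0 addN add_nat).
split=> /=; last exact: R_eq.
apply: (finite_torsion_free dvr); last exact: torsion_free_regular dvr.
exists 1%N, (fun=> 1) => m; exists (fun=> m).
by rewrite big_ord1 -[_ *: _]/(m * 1) mulr1.
Qed.

Let C := group_schemes R.
Definition ff_category := full_subcategory (C := C) finite_flat_p.
Definition ff_preadditive : preadditive ff_category :=
  preadditive_full (group_schemes_preadditive R) finite_flat_p.
Local Notation D := ff_category.
Local Notation AD := ff_preadditive.
Local Notation carrier X := (sval X : group_scheme R).

Lemma ff_free (X : D) : free_mod (coord (sval X)).
Proof. by apply/finite_flat_freeE; have [] := svalP X. Qed.

Lemma ff_torsion_free (X : D) : torsion_free (coord (sval X)).
Proof. exact (free_torsion_free dvr (ff_free X)). Qed.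

Lemma ff_killed (X : D) : exists N, N%:R != 0 :> R /\
  forall B (x : point (carrier X) B), gmuln N x = gzero (sval X) B.
Proof.
have [_ [m killm]] := svalP X; exists (p ^ m)%N; split=> //.
by rewrite natrX; apply: (dvr_exp_neq0 dvr _ p_neq0).
Qed.

Lemma ff_casimir (X : D) : has_casimir (coord (sval X)).
Proof.
have [N [N0 killN]] := ff_killed X.
exact: (group_casimir dvr (ff_free X) N0 killN).
Qed.

Lemma ff_zero : exists Z : D, zero_object Z.
Proof.
have [Z [freeZ Z_eq]] := trivial_group_exists.
have ffZ : finite_flat_p Z.
  split; first exact/finite_flat_freeE.
  by exists 0%N => B x; apply: Z_eq.
exists (exist _ Z ffZ : D) => X; split.
  exists (gs_zero (carrier X) Z); split=> // g _; apply: gs_hom_points => B x.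
  exact: Z_eq.
exists (gs_zero Z (carrier X)); split=> // g _; apply: gs_hom_points => B x.
rewrite on_points_zero (Z_eq _ x (gzero Z B)); apply/esym; exact: on_points0.
Qed.

Lemma ff_product (X Y : D) : exists (P : D) (p1 : gs_hom (sval P) (sval X))
    (p2 : gs_hom (sval P) (sval Y)),
  is_tensor (comorph p1) (comorph p2) /\
  forall (Z : group_scheme R) (f : gs_hom Z (sval X)) (g : gs_hom Z (sval Y)),
    exists h, gs_comp p1 h = f /\ gs_comp p2 h = g.
Proof.
have [P [p1 [p2 P12]]] := product_exists (sval Y) (ff_free X).
have [extP genP _] := P12.
have P_eq B (x y : point P B) : on_points p1 x = on_points p1 y ->
    on_points p2 x = on_points p2 y -> x = y.
  exact: (tensor_hom_eq P12).
have ffP : finite_flat_p P.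
  split.
    apply/finite_flat_freeE.
    have [n [e [c ec]]] := ff_free X.
    have tfP := tensor_torsion_free P12 ec (@ff_torsion_free Y).
    apply: (finite_torsion_free dvr) => //.
    exact (tensor_finite P12 ec (free_finite (ff_free Y))).
  have [_ [m killX]] := svalP X; have [_ [m' killY]] := svalP Y.
  exists (m + m')%N => B x; apply: P_eq; rewrite on_points_muln on_points0.
    by rewrite expnD mulnC gmulnM killX gmuln0.
  by rewrite expnD gmulnM killY gmuln0.
exists (exist _ P ffP), p1, p2; split=> // Z f g.
have [h [h1 h2]] := extP _ (comorph f) (comorph g).
have hD B (x y : point Z B) : lrcomp (gadd x y) h =
    gadd (lrcomp x h : point P B) (lrcomp y h).
  apply: P_eq; rewrite on_pointsD /on_points -!lrcompA ?h1 ?h2.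
    by rewrite gs_hom_add.
  by rewrite gs_hom_add.
by exists (@GsHom R Z P h hD); split; apply: gs_hom_eq.
Qed.

Lemma ff_biproducts : has_biproducts AD.
Proof.
move=> X Y; have [P [p1 [p2 [P12 lift]]]] := ff_product X Y.
have [i1 [p1i1 p2i1]] := lift _ (gs_id (carrier X)) (gs_zero _ _).
have [i2 [p1i2 p2i2]] := lift _ (gs_zero _ _) (gs_id (carrier Y)).
exists P, i1, i2, p1, p2; split; [exact: p1i1 | exact: p2i2 |].
apply: gs_hom_points => B x.
rewrite on_points_add !on_points_comp.
have idP : on_points (idc P : gs_hom _ _) x = x by exact: on_points_id.
apply: (tensor_hom_eq P12); rewrite -!/(on_points _ _) !on_pointsD.
  by rewrite idP -!(on_points_comp p1) p1i1 p1i2 on_points_id on_points_zero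
    gadd_r0.
by rewrite idP -!(on_points_comp p2) p2i1 p2i2 on_points_id on_points_zero
  gadd0.
Qed.

Lemma ff_hom_eq0 (X Y : D) (f : hom X Y) :
  f = hzero AD X Y <-> forall b, comorph (f : gs_hom (sval X) (sval Y)) b =
    gzero (sval Y) _ b.
Proof. by split=> [-> //|]; apply: comorph_eq0. Qed.

Lemma injective_epi (X Y : D) (f : hom X Y) :
  injective (comorph (f : gs_hom (sval X) (sval Y))) -> epi f.
Proof.
move=> f_inj Z g h gfh; apply: gs_hom_eq; apply: (lrcomp_inj f_inj).
exact: (congr1 (@comorph R (sval X) (sval Z)) gfh).
Qed.

Lemma ff_kernel (X Y : D) (f : hom X Y) : exists (N : D) (i : hom N X),
  [/\ is_kernel AD f i,
      forall c, exists a, comorph (i : gs_hom (sval N) (sval X)) a = c &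
      forall a, comorph (i : gs_hom (sval N) (sval X)) a = 0 <->
        generic_kernel (f : gs_hom (sval X) (sval Y)) a].
Proof.
pose f' : gs_hom (sval X) (sval Y) := f.
have [N [i [freeN i_onto iJ]]] := kernel_exists dvr f' (ff_free X).
have ffN : finite_flat_p N.
  split; first exact/finite_flat_freeE.
  have [_ [m killX]] := svalP X; exists m.
  exact: killed_of_surjective i_onto killX.
exists (exist _ N ffN), i; split=> //; split.
  apply: comorph_eq0 => b /=; apply/subr0_eq.
  have /iJ := @augmentation_generic_kernel _ _ f' b.
  by rewrite !rmorphB /= counitE => <-; rewrite [comorph f' _%:A]linearZ /=
    [in RHS]linearZ /= !rmorph1.
move=> Z g fg; pose g' : gs_hom (sval Z) (sval X) := g.
have [h hi] : exists h, lrcomp h (comorph i) = comorph g'.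
  apply: factor_surj => // a /iJ; apply; first exact: ff_torsion_free.
  by have := congr1 (@comorph _ _ _) fg.
have hD B (x y : point (carrier Z) B) :
    lrcomp (gadd x y) h = gadd (lrcomp x h : point N B) (lrcomp y h).
  apply: (lrcomp_surj i_onto); rewrite -[RHS]/(on_points i _) on_pointsD.
  by rewrite /on_points -!lrcompA hi gs_hom_add.
exists (GsHom hD); split; first exact: gs_hom_eq.
move=> h' ih'; apply: gs_hom_eq; apply: (lrcomp_surj i_onto).
rewrite hi; exact: (esym (congr1 (@comorph _ _ _) ih')).
Qed.

Lemma ff_cokernel (X Y : D) (f : hom X Y) : exists (Q : D) (q : hom Y Q),
  [/\ is_cokernel AD f q,
      injective (comorph (q : gs_hom (sval Y) (sval Q))) &
      forall a, (exists b, comorph (q : gs_hom (sval Y) (sval Q)) b = a) <->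
        invariant (f : gs_hom (sval X) (sval Y)) a].
Proof.
pose f' : gs_hom (sval X) (sval Y) := f.
have [Q [q [freeQ q_inj qE]]] := cokernel_exists dvr f' (ff_free Y).
have ffQ : finite_flat_p Q.
  split; first exact/finite_flat_freeE.
  have [_ [m killY]] := svalP Y; exists m.
  exact: killed_of_injective q_inj killY.
exists (exist _ Q ffQ), q; split=> //; split.
  apply: comorph_eq0 => b.
  have /qE inv_b : exists b', comorph q b' = comorph q b by exists b.
  have := inv_b _ (@ff_torsion_free X) (lrid _) (gzero _ _).
  rewrite gadd_r0 /on_points lrcomp_id /= => ->.
  by rewrite -(on_points0 q).
move=> Z g gf; pose g' : gs_hom (sval Y) (sval Z) := g.
have gf0 B (x : point (carrier X) B) :
    on_points g' (on_points f' x) = gzero (sval Z) B.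
  rewrite -on_points_comp -(on_points_zero (sval Z) x).
  exact: (congr1 (fun u : gs_hom _ _ => on_points u x) gf).
have [h qh] : exists h, lrcomp (comorph q) h = comorph g'.
  apply: factor_inj => // c; apply/qE => T tfT x y.
  have gE (z : point (carrier Y) T) :
    z (comorph g' c) = on_points g' z c by [].
  by rewrite !gE on_pointsD gf0 gadd0.
have [TQ [j1 [j2 TQ12]]] := tensor_exists (coord Q) freeQ.
have [TY [i1 [i2 TY12]]] := tensor_exists (coord (sval Y)) (ff_free Y).
have [extQ _ _] := TQ12.
have [k [k1 k2]] := extQ TY (lrcomp i1 (comorph q)) (lrcomp i2 (comorph q)).
have k_inj : injective k.
  exact: (tensor_injective dvr TY12 TQ12 (ff_free Y) freeQ
    (@ff_torsion_free Y) q_inj q_inj k1 k2).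
(* Additivity is tested on the universal pair of points of Q, in the tensor
   square of coord Q; it embeds in that of coord Y, where qh applies. *)
have univ : lrcomp (gadd (j1 : point Q TQ) j2) h =
    gadd (lrcomp j1 h : point (carrier Z) TQ) (lrcomp j2 h).
  apply: (lrcomp_inj k_inj); rewrite gadd_nat !lrcompA gadd_nat k1 k2.
  rewrite -[lrcomp i1 _]/(on_points q (i1 : point (sval Y) TY)).
  rewrite -[lrcomp i2 _]/(on_points q (i2 : point (sval Y) TY)).
  by rewrite -on_pointsD /on_points -!lrcompA qh gs_hom_add.
have hD B (x y : point Q B) :
    lrcomp (gadd x y) h = gadd (lrcomp x h : point (carrier Z) B) (lrcomp y h).
  have [w [<- <-]] := extQ B x y.
  by rewrite -gadd_nat -lrcompA univ gadd_nat !lrcompA.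
exists (GsHom hD); split; first exact: gs_hom_eq.
move=> h' h'q; apply: gs_hom_eq; apply: (lrcomp_inj q_inj).
rewrite qh; exact: (esym (congr1 (@comorph _ _ _) h'q)).
Qed.

Lemma ff_kernels : has_kernels AD.
Proof. by move=> X Y f; have [N [i [f_i _ _]]] := ff_kernel f; exists N, i. Qed.

Lemma ff_cokernels : has_cokernels AD.
Proof.
by move=> X Y f; have [Q [q [f_q _ _]]] := ff_cokernel f; exists Q, q.
Qed.

(** The kernel of a monomorphism is trivial, so the only functions that survive
    modulo the generic kernel are the constants. *)
Lemma mono_generic_kernel (X Y : D) (f : hom X Y) : mono f ->
  forall a, counit (sval X) a = 0 ->
    generic_kernel (f : gs_hom (sval X) (sval Y)) a.
Proof.
move=> f_mono a a0; have [N [i [f_i _ iJ]]] := ff_kernel f.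
apply/iJ; have /ff_hom_eq0-> := mono_comp0 f_mono f_i.1.
by rewrite counitE a0 scale0r.
Qed.

(** A morphism with trivial cokernel leaves only constant functions invariant;
    the indicator of its image is then constant, so the image is everything. *)
Lemma epi_injective (X Y : D) (f : hom X Y) : epi f ->
  injective (comorph (f : gs_hom (sval X) (sval Y))).
Proof.
move=> f_epi; pose f' : gs_hom (sval X) (sval Y) := f.
have [Q [q [f_q _ qE]]] := ff_cokernel f.
have /ff_hom_eq0 q0 := epi_comp0 f_epi f_q.1.
apply: (raddf_inj (f := comorph f')) => a fa.
have tfY := @ff_torsion_free Y.
apply: (kernel_of_cokernel (f := f') (y := lrid _) dvr (ff_free X) (ff_free Y)
  (ff_casimir Y) tfY _ fa) => b /qE[c <-].
pose q' : gs_hom (sval Y) (sval Q) := q.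
have -> : gzero (sval Y) _ (comorph q' c) =
  on_points q' (gzero (sval Y) (coord (sval Y))) c by [].
rewrite on_points0; exact: q0.
Qed.

(** Generically the kernel of the cokernel of f is contained in the image of f,
    by [kernel_of_cokernel].  The functions on it inject into those on X. *)
Lemma ff_epi_onto_image : epi_onto_image AD.
Proof.
move=> X Y Q I f q i e f_q q_i ie.
have [N [i0 [q_i0 i0_onto i0J]]] := ff_kernel q.
have [e0 i0e0] := kernel_lift q_i0 f_q.1.
have [w iw] := kernel_lift q_i q_i0.1.
have [w' i0w'] := kernel_lift q_i0 q_i.1.
have ww' : w \oc w' = idc I.
  apply: (kernel_mono q_i); rewrite comp_assoc iw i0w'.
  by rewrite comp_idr.
have e0_epi : epi e0.
  apply: injective_epi; pose e0' : gs_hom (sval X) (sval N) := e0.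
  apply: (raddf_inj (f := comorph e0')) => c.
  have [a <-] := i0_onto c => ea.
  apply/i0J => T tfT y qy.
  have fa : comorph (f : gs_hom (sval X) (sval Y)) a = 0.
    by rewrite -ea -i0e0.
  apply: (kernel_of_cokernel dvr (ff_free X) (ff_free Y)
    (ff_casimir Y) tfT _ fa).
  have [Q0 [q0 [f_q0 _ q0E]]] := ff_cokernel f.
  have [v vq] := cokernel_lift f_q f_q0.1.
  move=> b /q0E[b' <-].
  have yE (z : point (sval Y) T) :
    z (comorph (q0 : gs_hom (sval Y) (sval Q0)) b') = on_points q0 z b' by [].
  by rewrite !yE -vq !on_points_comp qy !on_points0.
have <- : w \oc e0 = e.
  by apply: (kernel_mono q_i); rewrite comp_assoc iw i0e0 ie.
move=> Z g h; rewrite !comp_assoc => /e0_epi gh.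
by rewrite -[g]comp_idr -[h]comp_idr -ww' !comp_assoc gh.
Qed.

(** The fibre product is the kernel of f p1 - z p2 on the product of X and Z. *)
Lemma ff_epi_pullback : epi_pullback D.
Proof.
move=> X Y Z f z f_epi.
have [P [p1 [p2 [P12 lift]]]] := ff_product X Z.
pose f' : gs_hom (sval X) (sval Y) := f.
pose z' : gs_hom (sval Z) (sval Y) := z.
pose g : hom P Y := gs_add (gs_comp f' p1) (gs_opp (gs_comp z' p2)).
have gE B (x : point (sval P) B) : on_points (g : gs_hom (sval P) (sval Y)) x =
    gsub (on_points f' (on_points p1 x)) (on_points z' (on_points p2 x)).
  by rewrite on_points_add on_points_opp !on_points_comp.
have [N [i [g_i i_onto iJ]]] := ff_kernel g.
pose i' : gs_hom (sval N) (sval P) := i.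
exists N, (gs_comp p1 i'), (gs_comp p2 i'); split.
- apply: gs_hom_points => B x; rewrite !on_points_comp.
  have := congr1 (fun h : gs_hom _ _ => on_points h x) g_i.1.
  rewrite /= on_points_comp gE on_points_zero => gi0.
  by rewrite -[LHS](gsubK _ (on_points z' (on_points p2 (on_points i' x)))) gi0
    gadd0.
- apply: injective_epi; apply: raddf_inj => a /iJ gJ.
  apply: (fibre_product_injective (f := f') (z := z') dvr
    (ff_free X) (ff_free Y)
    (ff_free Z) (ff_casimir Y) P12 (epi_injective f_epi)) => T tfT x fzx.
  by apply: gJ => //; rewrite gE fzx gsubxx.
- move=> T u v uv1 uv2; apply: (kernel_mono g_i).
  apply: gs_hom_points => B x; rewrite !on_points_comp.
  apply: (tensor_hom_eq P12).
    have := congr1 (fun h : gs_hom _ _ => on_points h x) uv1.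
    by rewrite /= !on_points_comp.
  have := congr1 (fun h : gs_hom _ _ => on_points h x) uv2.
  by rewrite /= !on_points_comp.
Qed.

Lemma ff_mono_pushout : mono_pushout D.
Proof.
exact: (mono_pushout_of_pullback ff_biproducts ff_kernels ff_cokernels
  ff_epi_pullback ff_epi_onto_image).
Qed.

End FiniteFlat.

(** * The degree of a bimorphism *)

Section Degree.
Variables (R : comNzRingType) (K : fieldType) (j : {rmorphism R -> K}) (pi : R).
Hypothesis dvr : dvr_in j pi.
Variable p : nat.
Hypothesis p_neq0 : p%:R != 0 :> R.
Implicit Types B : comAlgType R.
Local Notation D := (ff_category R p).

Lemma scalar_factor_leq m n (F : 'M[R]_(m, n)) (G : 'M[R]_(n, m)) d :
  d != 0 -> F *m G = d%:M -> (m <= n)%N.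
Proof.
move=> d0 FG; have jd0 : j d != 0.
  by rewrite -(rmorph0 j) (inj_eq (dvr_inj dvr)).
have : (\rank ((j d)%:M : 'M[K]_m) <= n)%N.
  rewrite -map_scalar_mx -FG map_mxM.
  exact: leq_trans (mulmx_max_rank _ _) _.
by rewrite -scalemx1 mxrank_scale_nz // mxrank1.
Qed.

(** Otherwise pi would be invertible. *)
Lemma dvr_unit_exp (u u' w : R) v n :
  u * u' = 1 -> u * pi ^+ v * w = pi ^+ n -> (v <= n)%N.
Proof.
move=> uu' E; rewrite leqNgt; apply/negP => nv.
have pi0 := dvr_pi dvr.
have : pi * (u * w * pi ^+ (v - n.+1)) == 1.
  apply/eqP/(dvr_mulI dvr (dvr_exp_neq0 dvr n pi0)); rewrite mulr1 -[RHS]E.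
  rewrite -{2}(subnK nv) exprD exprS; ring.
exact/negP/(dvr_nonunit dvr).
Qed.

(** The length of the cokernel of the map on coordinate rings, computed as the
    valuation of its determinant.  As a relation it needs no choice of bases. *)
Definition degree (X Y : D) (f : hom X Y) (v : nat) := exists n
    (e : 'I_n -> coord (sval X)) (c : {linear coord (sval X) -> 'rV[R]_n})
    (e' : 'I_n -> coord (sval Y)) (c' : {linear coord (sval Y) -> 'rV[R]_n})
    (u u' : R),
  [/\ free_on e c, free_on e' c', u * u' = 1 &
      \det (matrix_of e' c (comorph (f : gs_hom (sval X) (sval Y)))) =
        u * pi ^+ v].

Lemma free_rank_unique (M : lmodType R) m n (e : 'I_m -> M)
    (c : {linear M -> 'rV[R]_m}) (e' : 'I_n -> M)
    (c' : {linear M -> 'rV[R]_n}) : free_on e c -> free_on e' c' -> m = n.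
Proof.
move=> ec ec'; have one0 := oner_neq0 R.
have [|s sE] := @linear_of R M M idfun; first by [].
have ss : s =1 s \o s by move=> x; rewrite /= !sE.
have E1 := matrix_of_comp e c ec' ss.
have E2 := matrix_of_comp e' c' ec ss.
apply/eqP; rewrite eqn_leq; apply/andP; split.
  exact: (scalar_factor_leq one0 (etrans (esym E1) (matrix_of_id ec sE))).
exact: (scalar_factor_leq one0 (etrans (esym E2) (matrix_of_id ec' sE))).
Qed.

(** On coordinate rings f is injective because f is epic, and N^n annihilates
    its cokernel because f is monic: N^n times its inverse is integral. *)
Lemma bimorphism_quasi_inverse (X Y : D) (f : hom X Y) N m n
    (e : 'I_m -> coord (sval X)) (c : {linear coord (sval X) -> 'rV[R]_m})
    (e' : 'I_n -> coord (sval Y)) (c' : {linear coord (sval Y) -> 'rV[R]_n}) :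
  bimorphism f -> N%:R != 0 :> R -> free_on e c -> free_on e' c' ->
  (forall B (y : point (sval Y : group_scheme R) B),
     gmuln N y = gzero (sval Y) B) ->
  let F := matrix_of e' c (comorph (f : gs_hom (sval X) (sval Y))) in
  let d : R := N%:R ^+ n in
  exists G : 'M[R]_(m, n), F *m G = d%:M /\ G *m F = d%:M.
Proof.
move=> [f_mono f_epi] N0 ec ec' killN F d.
pose f' : gs_hom (sval X) (sval Y) := f.
have d0 : d != 0 := dvr_exp_neq0 dvr n N0.
have freeX : free_mod (coord (sval X)) by exists m, e, c.
have bound := generic_mono_bound dvr freeX ec' killN N0
  (mono_generic_kernel dvr f_mono).
have f_inj := epi_injective dvr p_neq0 f_epi.
have [|scX scXE] := @linear_of R (coord (sval X)) (coord (sval X))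
  (fun x => d *: x).
  by move=> r x y; rewrite scalerDr !scalerA mulrC.
have [|scY scYE] := @linear_of R (coord (sval Y)) (coord (sval Y))
  (fun x => d *: x).
  by move=> r x y; rewrite scalerDr !scalerA mulrC.
have [|s fs] := @linear_lifting R _ _ _ (comorph f') scX freeX.
  by move=> x; have [b bE] := bound x; exists b; rewrite scXE; exact: (esym bE).
exists (matrix_of e c' s); split.
  rewrite -(matrix_of_comp e' c' (h := scY) ec); last first.
    move=> y; apply: f_inj; rewrite scYE linearZ /=.
    by have := fs (comorph f' y); rewrite scXE.
  exact: matrix_of_scale ec' scYE.
rewrite -(matrix_of_comp e c (h := scX) ec').
  exact: matrix_of_scale ec scXE.
by move=> x; rewrite /= -fs.
Qed.

Lemma bimorphism_rank (X Y : D) (f : hom X Y) m n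
    (e : 'I_m -> coord (sval X)) (c : {linear coord (sval X) -> 'rV[R]_m})
    (e' : 'I_n -> coord (sval Y)) (c' : {linear coord (sval Y) -> 'rV[R]_n}) :
  bimorphism f -> free_on e c -> free_on e' c' -> m = n.
Proof.
move=> f_bi ec ec'; have [N [N0 killN]] := ff_killed dvr p_neq0 Y.
have d0 := dvr_exp_neq0 dvr n N0.
have [G [FG GF]] := bimorphism_quasi_inverse f_bi N0 ec ec' killN.
apply/eqP; rewrite eqn_leq (scalar_factor_leq d0 GF).
exact: (scalar_factor_leq d0 FG).
Qed.

Lemma degree_exists (X Y : D) (f : hom X Y) :
  bimorphism f -> exists v, degree f v.
Proof.
move=> f_bi; have [m [e [c ec]]] := ff_free dvr X.
have [n [e' [c' ec']]] := ff_free dvr Y.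
have [N [N0 killN]] := ff_killed dvr p_neq0 Y.
have mn := bimorphism_rank f_bi ec ec'; case: n / mn e' c' ec' => e' c' ec'.
have [G [FG GF]] := bimorphism_quasi_inverse f_bi N0 ec ec' killN.
have : \det (matrix_of e' c (comorph (f : gs_hom (sval X) (sval Y)))) != 0.
  apply/eqP => F0; have := congr1 determinant FG.
  rewrite det_mulmx F0 mul0r det_scalar => /esym/eqP; apply/negP.
  by do 2!apply: (dvr_exp_neq0 dvr).
by move=> /(dvr_val dvr)[u [u' [v [uu' vE]]]]; exists v, m, e, c, e', c', u, u'.
Qed.

Lemma degree_comp (X Y Z : D) (g : hom Y Z) (f : hom X Y) v w :
  bimorphism g -> bimorphism f -> degree g v -> degree f w ->
  degree (g \oc f) (v + w)%N.
Proof.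
move=> _ _ [n [e1 [c1 [e2 [c2 [u [u' [ec1 ec2 uu' gv]]]]]]]].
move=> [m [e [c [e0 [c0 [x [x' [ec ec0 xx' fw]]]]]]]].
have mn := free_rank_unique ec0 ec1; case: n / mn e1 c1 e2 c2 ec1 ec2 gv.
move=> e1 c1 e2 c2 ec1 ec2 gv.
have [|s sE] := @linear_of R (coord (sval Y)) (coord (sval Y)) idfun;
  first by [].
pose b := \det (matrix_of e1 c0 s); pose b' := \det (matrix_of e0 c1 s).
have bb' : b * b' = 1.
  rewrite -det_mulmx -(matrix_of_comp e1 c1 (h := s) ec0).
    by rewrite (matrix_of_id ec1 sE) det1.
  by move=> y; rewrite /= !sE.
exists m, e, c, e2, c2, (u * b * x), (u' * b' * x'); split=> //.
  transitivity ((u * u') * (b * b') * (x * x')); first by ring.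
  by rewrite uu' bb' xx' !mulr1.
pose g' : gs_hom (sval Y) (sval Z) := g.
pose f' : gs_hom (sval X) (sval Y) := f.
rewrite (matrix_of_comp e2 c (f := comorph g') (g := comorph f') ec1) //.
rewrite (matrix_of_comp e1 c (f := s) (g := comorph f') ec0); last first.
  by move=> y; rewrite /= sE.
by rewrite !det_mulmx -/b gv fw exprD; ring.
Qed.

Lemma iso_of_bijective (G H : group_scheme R) (f : gs_hom G H) :
  injective (comorph f) -> (forall a, exists b, comorph f b = a) ->
  exists g : gs_hom H G, gs_comp g f = gs_id G /\ gs_comp f g = gs_id H.
Proof.
move=> f_inj f_onto.
have [h hf] : exists h, lrcomp h (comorph f) = lrid (coord H).
  by apply: factor_surj => // b fb; apply: f_inj; rewrite fb rmorph0.
have fh : lrcomp (comorph f) h = lrid (coord G).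
  by apply: (lrcomp_surj f_onto); rewrite -lrcompA hf lrid_comp lrcomp_id.
have hD B (x y : point H B) :
    lrcomp (gadd x y) h = gadd (lrcomp x h : point G B) (lrcomp y h).
  apply: (lrcomp_surj f_onto); rewrite -[RHS]/(on_points f _) on_pointsD.
  by rewrite /on_points -!lrcompA hf !lrid_comp.
by exists (GsHom hD); split; apply: gs_hom_eq.
Qed.

Lemma degree0_iso (X Y : D) (f : hom X Y) :
  bimorphism f -> degree f 0 -> iso f.
Proof.
move=> [_ f_epi] [n [e [c [e' [c' [u [u' [ec ec' uu' F]]]]]]]].
move: F; set F := matrix_of _ _ _; rewrite expr0 mulr1 => detF.
have GF : (u' *: \adj F) *m F = 1%:M.
  by rewrite -scalemxAl mul_adj_mx detF -mul_scalar_mx -scalar_mxM mulrC uu'.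
have [|g [gf fg]] := @iso_of_bijective _ _ (f : gs_hom (sval X) (sval Y))
  (epi_injective dvr p_neq0 f_epi); last by exists g.
move=> a; exists (\sum_k (c a *m (u' *: \adj F)) 0 k *: e' k).
have c_inj x y : c x = c y -> x = y.
  by move=> cxy; rewrite [x]ec.1 [y]ec.1 cxy.
apply: c_inj.
rewrite (matrix_ofE c (comorph (f : gs_hom (sval X) (sval Y))) _ ec') -/F.
have -> : c' (\sum_k (c a *m (u' *: \adj F)) 0 k *: e' k) =
    c a *m (u' *: \adj F).
  rewrite linear_sum [RHS]row_sum_delta; apply: eq_bigr => k _.
  by rewrite linearZ /= ec'.2.
by rewrite -mulmxA GF mulmx1.
Qed.

(** The determinant of F divides that of d%:M = F *m G, with d = N^n and a
    matrix of size n; V is the valuation of d^n, which depends on N and n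
    alone. *)
Lemma degree_leq (X Y : D) (f : hom X Y) N n V (w w' : R) v :
  bimorphism f -> N%:R != 0 :> R ->
  (forall B (y : point (sval Y : group_scheme R) B),
     gmuln N y = gzero (sval Y) B) ->
  (exists (e : 'I_n -> coord (sval Y))
       (c : {linear coord (sval Y) -> 'rV[R]_n}),
     free_on e c) ->
  w * w' = 1 -> (N%:R ^+ n) ^+ n = w * pi ^+ V -> degree f v -> (v <= V)%N.
Proof.
move=> f_bi N0 killN [e0 [c0 ec0]] ww' NV.
move=> [m [e [c [e' [c' [u [u' [ec ec' uu' F]]]]]]]].
have mn := free_rank_unique ec0 ec'; case: m / mn e c e' c' ec ec' F.
move=> e c e' c' ec ec' F.
have [G [FG _]] := bimorphism_quasi_inverse f_bi N0 ec ec' killN.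
have := congr1 determinant FG; rewrite det_mulmx F det_scalar NV => E.
apply: (@dvr_unit_exp u u' (\det G * w')) => //.
by rewrite mulrA E mulrAC ww' mul1r.
Qed.

Lemma degree_bounded_target (Y : D) : exists N, forall (X : D) (f : hom X Y) v,
  bimorphism f -> degree f v -> (v <= N)%N.
Proof.
have [n [e [c ec]]] := ff_free dvr Y.
have [N [N0 killN]] := ff_killed dvr p_neq0 Y.
have /(dvr_val dvr)[w [w' [V [ww' NV]]]] : (N%:R ^+ n) ^+ n != 0 :> R.
  by do 2!apply: (dvr_exp_neq0 dvr).
exists V => X f v f_bi; apply: degree_leq f_bi N0 killN _ ww' NV.
by exists e, c.
Qed.

(** The target of a bimorphism from X has the same rank as X and is killed by
    the same N, so the bound for its target depends only on X. *)
Lemma degree_bounded_source (X : D) : exists N, forall (Y : D) (f : hom X Y) v,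
  bimorphism f -> degree f v -> (v <= N)%N.
Proof.
have [n [e [c ec]]] := ff_free dvr X.
have [N [N0 killN]] := ff_killed dvr p_neq0 X.
have /(dvr_val dvr)[w [w' [V [ww' NV]]]] : (N%:R ^+ n) ^+ n != 0 :> R.
  by do 2!apply: (dvr_exp_neq0 dvr).
exists V => Y f v f_bi; apply: degree_leq (f_bi) N0 _ _ ww' NV.
  exact: killed_of_injective (epi_injective dvr p_neq0 f_bi.2) killN.
have [m [e' [c' ec']]] := ff_free dvr Y.
have nm := bimorphism_rank f_bi ec ec'; case: m / nm e' c' ec' => e' c' ec'.
by exists e', c'.
Qed.

Theorem ff_maximal_abelian :
  abelian_category (full_subcategory (@bi_maximal D)).
Proof.
apply: (@maximal_abelian D (ff_preadditive R p)).
- exact: (ff_zero dvr).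
- exact: (ff_biproducts dvr).
- exact: (ff_kernels dvr).
- exact: (ff_cokernels dvr).
- exact: (ff_epi_pullback dvr).
- exact: (ff_mono_pushout dvr).
apply: (enough_maximals_of_degree (deg := degree)).
- exact: degree_exists.
- exact: degree_comp.
- exact: degree0_iso.
- exact: degree_bounded_target.
Qed.

Theorem ff_minimal_abelian :
  abelian_category (full_subcategory (@bi_minimal D)).
Proof.
apply: (@minimal_abelian D (ff_preadditive R p)).
- exact: (ff_zero dvr).
- exact: (ff_biproducts dvr).
- exact: (ff_kernels dvr).
- exact: (ff_cokernels dvr).
- exact: (ff_epi_pullback dvr).
- exact: (ff_mono_pushout dvr).
apply: (enough_minimals_of_degree (deg := degree)).
- exact: degree_exists.
- exact: degree_comp.
- exact: degree0_iso.
- exact: degree_bounded_source.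
Qed.

End Degree.

(** * Prolongations *)

Section Prolongations.
Variables (R : comNzRingType) (K : fieldType) (j : {rmorphism R -> K}) (pi : R).
Hypothesis dvr : dvr_in j pi.
Variable p : nat.
Hypothesis p_neq0 : p%:R != 0 :> R.
Implicit Types (G H M : group_scheme R) (B : comAlgType K).
Local Notation D := (ff_category R p).
Local Notation restr := (restr_scalars j).

Lemma dvr_image_neq0 d : d != 0 -> j d != 0.
Proof. by rewrite -(rmorph0 j) (inj_eq (dvr_inj dvr)). Qed.

(** Thus the points of the generic fibre are among the test points in the
    definition of the generic kernel and of the invariant functions. *)
Lemma restr_torsion_free B : torsion_free (restr B).
Proof.
move=> d b d0 db; have jd0 := dvr_image_neq0 d0.
have : j d *: (b : B) = 0 by exact: db.
by move=> /(congr1 ( *:%R (j d)^-1)); rewrite scalerA mulVf // scale1r scaler0.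
Qed.

Lemma generic_algebra_exists (A : comAlgType R) : free_mod A ->
  exists (AK : comAlgType K) (i : {lrmorphism A -> restr AK}), is_generic i.
Proof.
exact: (generic_exists (dvr_inj dvr) (dvr_frac dvr) (@dvr_domain _ _ _ _ dvr)).
Qed.

(** The coordinate ring of G embeds in its generic fibre, so that the universal
    point of G is determined by a generic one. *)
Lemma generic_faithful G H (f g : gs_hom G H) : free_mod (coord G) ->
  (forall B (x : point G (restr B)), on_points f x = on_points g x) -> f = g.
Proof.
move=> /generic_algebra_exists[GK [i [_ i_inj _]]] fg.
by apply/gs_hom_eq/(lrcomp_inj i_inj)/fg.
Qed.

(** Over K the scalar d is invertible, and the comorphism becomes bijective. *)
Lemma fibre_bijective G H (s : gs_hom H G) d : d != 0 ->
  injective (comorph s) -> (forall a, exists b, d *: a = comorph s b) ->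
  forall B, bijective (fun x : fibre_point j H B =>
    on_points s x : fibre_point j G B).
Proof.
move=> d0 s_inj bound B.
have tfB := @restr_torsion_free B; have jd0 := dvr_image_neq0 d0.
have inj_s (x y : point H (restr B)) : on_points s x = on_points s y -> x = y.
  move=> sxy; apply: lrmorphism_ext => a; have [b ab] := bound a.
  apply/subr0_eq/(tfB d _ d0); rewrite scalerBr -!linearZ ab.
  have /= -> := congr1 (fun h : {lrmorphism _ -> _} => h b) sxy.
  by rewrite subrr.
have onto (y : point G (restr B)) : exists x, on_points s x = y.
  pose b a := sval (cid (bound a)).
  have bE a : comorph s (b a) = d *: a by rewrite /b; case: cid.
  pose x (a : coord H) : restr B := ((j d)^-1 *: (y (b a) : B) : B).
  have xd a : d *: x a = y (b a).
    rewrite -[LHS]/(j d *: ((j d)^-1 *: (y (b a) : B)) : B).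
    by rewrite scalerA mulfV // scale1r.
  have x_eq a c : y (b a) = d *: c -> x a = c.
    move=> bc; apply/subr0_eq/(tfB d _ d0).
    by rewrite scalerBr xd bc subrr.
  have bs c : b (comorph s c) = d *: c by apply: s_inj; rewrite bE linearZ.
  have [||||h hE] := @lrmorphism_of R (coord H) (restr B) x.
  - move=> a a'; apply: x_eq; rewrite scalerDr !xd -rmorphD; congr (y _).
    by apply: s_inj; rewrite rmorphD /= !bE scalerDr.
  - move=> a a'; apply: x_eq; apply/subr0_eq/(tfB d _ d0).
    have bM : d *: y (b (a * a')) = y (b a) * y (b a').
      rewrite -linearZ -rmorphM; congr (y _); apply: s_inj.
      by rewrite linearZ rmorphM /= !bE -scalerAl -scalerAr.
    by rewrite scalerBr bM -!xd -scalerAl -scalerAr subrr.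
  - apply: x_eq; rewrite -[in LHS](rmorph1 (comorph s)) bs linearZ /= rmorph1.
    by [].
  - move=> r a; apply: x_eq; rewrite scalerA mulrC -scalerA xd -linearZ.
    congr (y _); apply: s_inj.
    by rewrite [RHS]linearZ /= !bE !scalerA mulrC.
  exists h; apply: lrmorphism_ext => c; rewrite /= hE; apply: x_eq.
  by rewrite bs linearZ.
pose t y := sval (cid (onto y)).
have tK y : on_points s (t y) = y by rewrite /t; case: cid.
by exists t => [x|y]; [apply: inj_s; apply: tK | apply: tK].
Qed.

Section FibreIso.
Variables (G H : group_scheme R) (phi : fibre_iso j H G).
Local Notation fm := (fibre_map phi).

Lemma fibre_map_inj B (x y : point H (restr B)) : fm x = fm y -> x = y.
Proof. exact: (bij_inj (fibre_map_bij phi B)). Qed.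

Lemma fibre_map0 B : fm (gzero H (restr B)) = gzero G (restr B).
Proof.
apply: (@gadd_cancel _ G (restr B) (fm (gzero H (restr B)))).
by rewrite gadd_r0 -[RHS](congr1 _ (gadd0 (gzero H (restr B)))) fibre_map_add.
Qed.

Lemma fibre_mapN B (x : point H (restr B)) : fm (gopp x) = gopp (fm x).
Proof.
apply: (@gadd_cancel _ G (restr B) (fm x)).
by rewrite gadd_rN -fibre_map0 -(gadd_rN x) fibre_map_add.
Qed.

Lemma fibre_mapB B (x y : point H (restr B)) :
  fm (gsub x y) = gsub (fm x) (fm y).
Proof. by rewrite /gsub fibre_map_add fibre_mapN. Qed.

Lemma fibre_map_muln B n (x : point H (restr B)) :
  fm (gmuln n x) = gmuln n (fm x).
Proof.
elim: n => [|n IH]; first exact: fibre_map0.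
by rewrite /gmuln !iterS -/(gmuln n x) -/(gmuln n (fm x)) -IH -fibre_map_add.
Qed.

End FibreIso.

(** N is the schematic closure of the graph of phi in the product of G and M.
    Over K it has no points outside the graph: the pullback under phi of a
    function a on G is b / d for a function b on M, and d * a - b belongs to the
    ideal of the closure. *)
Lemma graph_closure G M (phi : fibre_iso j M G) :
  free_mod (coord G) -> free_mod (coord M) ->
  exists (N : group_scheme R) (n1 : gs_hom N G) (n2 : gs_hom N M),
  [/\ free_mod (coord N),
      forall (B : comAlgType R) (x y : point N B),
        on_points n1 x = on_points n1 y -> on_points n2 x = on_points n2 y ->
        x = y,
      forall B (x : point N (restr B)),
        fibre_map phi (on_points n2 x) = on_points n1 x &
      forall B (m : point M (restr B)), exists x : point N (restr B),
        on_points n2 x = m /\ on_points n1 x = fibre_map phi m].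
Proof.
move=> freeG freeM; have tfM := free_torsion_free dvr freeM.
have [P [p1 [p2 P12]]] := product_exists M freeG; have [ext _ _] := P12.
have freeP : free_mod (coord P).
  have [n [e [c ec]]] := freeG; apply: (finite_torsion_free dvr).
    exact (tensor_finite P12 ec (free_finite freeM)).
  exact (tensor_torsion_free P12 ec tfM).
pose J (t : coord P) := forall B (m : point M (restr B))
    (z : point P (restr B)),
  on_points p1 z = fibre_map phi m -> on_points p2 z = m -> z t = 0.
have [MK [i [MK_lift i_inj MK_frac]]] := generic_algebra_exists freeM.
have graph B (z : point P (restr B)) : kills J z ->
    fibre_map phi (on_points p2 z) = on_points p1 z.
  move=> zJ; apply: lrmorphism_ext => a.
  have [d [b [d0 db]]] := MK_frac (fibre_map phi (i : point M (restr MK)) a).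
  have phi_db B' (m : point M (restr B')) : d *: fibre_map phi m a = m b.
    have [h <-] := MK_lift B' m.
    rewrite (fibre_map_nat phi h (i : fibre_point j M MK)).
    rewrite /= -[d *: _]linearZ; congr (restr_fun _); exact: db.
  have tJ : J (d *: comorph p1 a - comorph p2 b).
    move=> B' m z' z1 z2.
    have -> : z' (d *: comorph p1 a - comorph p2 b) =
        d *: on_points p1 z' a - on_points p2 z' b.
      by rewrite rmorphB /= linearZ.
    by rewrite z1 z2 phi_db subrr.
  apply/subr0_eq/(@restr_torsion_free B d _ d0); rewrite scalerBr phi_db.
  have := zJ _ tJ; rewrite rmorphB /= linearZ => /subr0_eq <-.
  by rewrite subrr.
have [||||||N [n [freeN n_onto nJ]]] := @closed_subgroup R K j pi dvr P J freeP.
- have [z [z1 z2]] := ext _ (fibre_map phi (i : fibre_point j M MK)) i.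
  by move=> /(_ MK i z z1 z2)/eqP; rewrite rmorph1 oner_eq0.
- by move=> B m z _ _; rewrite rmorph0.
- move=> a x y Jx Jy B m z z1 z2.
  by rewrite rmorphD rmorphM /= (Jx B m z) // (Jy B m z) // mulr0 addr0.
- move=> d a d0 Ja B m z z1 z2; apply: (@restr_torsion_free B d _ d0).
  by have := Ja B m z z1 z2; rewrite linearZ.
- move=> a Ja.
  have := Ja (K^o : comAlgType K) (gzero M _) (gzero P _).
  rewrite !on_points0 fibre_map0 => /(_ erefl erefl); rewrite gzeroE => r0.
  apply/eqP; apply: contraT => r_neq0.
  have := @restr_torsion_free (K^o : comAlgType K) _ _ r_neq0 r0.
  by move=> /eqP; rewrite oner_eq0.
- move=> T freeT x y xJ yJ t Jt.
  have [TK [iT [_ iT_inj _]]] := generic_algebra_exists freeT.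
  have graphT (w : point P T) : kills J w ->
      fibre_map phi (on_points p2 (lrcomp iT w)) = on_points p1 (lrcomp iT w).
    by move=> wJ; apply: graph => a /wJ /= ->; rewrite rmorph0.
  apply: iT_inj; rewrite rmorph0.
  have -> : iT (gsub x y t) = lrcomp iT (gsub x y) t by [].
  apply: (Jt TK (on_points p2 (lrcomp iT (gsub x y)))) => //.
  by rewrite !gsub_nat !on_pointsB fibre_mapB !graphT.
exists N, (gs_comp p1 n), (gs_comp p2 n); split=> //.
- move=> B x y; rewrite !on_points_comp => xy1 xy2.
  apply: (lrcomp_surj n_onto).
  exact: (tensor_hom_eq P12 xy1 xy2).
- move=> B x; rewrite !on_points_comp; apply: graph => t /nJ nt.
  by rewrite /= nt rmorph0.
move=> B m; have [z [z1 z2]] := ext _ (fibre_map phi m) m.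
have [x xz] : exists x, lrcomp x (comorph n) = z.
  by apply: factor_surj => // t /nJ Jt; apply: (Jt B m).
by exists x; rewrite !on_points_comp /on_points xz.
Qed.

(** The universal point of the model is determined by its generic fibre, on
    which the power of p that kills X is zero. *)
Lemma prolongation_killed (X : D) (M : prolongation j (sval X)) :
  finite_flat_p p (model M).
Proof.
split; first exact: model_finite_flat.
have freeM : free_mod (coord (model M)).
  by apply/(finite_flat_freeE dvr)/model_finite_flat.
have [_ [m killX]] := svalP X; exists m; apply: killed_of_universal.
have [MK [i [_ i_inj _]]] := generic_algebra_exists freeM.
apply: (lrcomp_inj i_inj); rewrite gmuln_nat gzero_nat lrid_comp.
apply: (fibre_map_inj (phi := model_iso M)).
by rewrite fibre_map_muln fibre_map0 killX.
Qed.

Lemma generic_injective_mono (X Y : D) (f : hom X Y) :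
  (forall B (x y : point (sval X : group_scheme R) (restr B)),
     on_points (f : gs_hom (sval X) (sval Y)) x =
     on_points (f : gs_hom (sval X) (sval Y)) y -> x = y) -> mono f.
Proof.
move=> f_inj Z g h fgh.
apply: (generic_faithful (ff_free dvr Z)) => B z; apply: f_inj.
rewrite -!on_points_comp.
exact: (congr1 (fun u : gs_hom _ _ => on_points u z) fgh).
Qed.

Lemma generic_surjective_epi (X Y : D) (f : hom X Y) :
  (forall B (y : point (sval Y : group_scheme R) (restr B)), exists x,
     on_points (f : gs_hom (sval X) (sval Y)) x = y) -> epi f.
Proof.
move=> f_onto Z g h gfh.
apply: (generic_faithful (ff_free dvr Y)) => B y; have [x <-] := f_onto B y.
rewrite -!on_points_comp.
exact: (congr1 (fun u : gs_hom _ _ => on_points u x) gfh).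
Qed.

Definition prolongation_object (X : D) (M : prolongation j (sval X)) : D :=
  exist _ (model M) (prolongation_killed M).

(** Two models of the same generic fibre are both dominated, through
    bimorphisms, by the closure of the graph of the identification. *)
Lemma prolongation_roof (X : D) (M : prolongation j (sval X)) :
  exists (N : D) (n1 : hom N X) (n2 : hom N (prolongation_object M)),
  [/\ bimorphism n1, bimorphism n2,
      forall B (x : point (sval N : group_scheme R) (restr B)),
        fibre_map (model_iso M) (on_points (n2 : gs_hom (sval N) (model M)) x) =
        on_points (n1 : gs_hom (sval N) (sval X)) x &
      forall B (m : point (model M) (restr B)), exists x,
        on_points (n2 : gs_hom (sval N) (model M)) x = m /\
        on_points (n1 : gs_hom (sval N) (sval X)) x =
          fibre_map (model_iso M) m].
Proof.
have freeX := ff_free dvr X; have freeM := ff_free dvr (prolongation_object M).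
have [N [n1 [n2 [freeN n_eq graph graph_onto]]]] :=
  graph_closure (model_iso M) freeX freeM.
have ffN : finite_flat_p p N.
  split; first exact/(finite_flat_freeE dvr).
  have [_ [m killX]] := svalP X.
  have [_ [m' killM]] := svalP (prolongation_object M).
  exists (m + m')%N => B x; apply: n_eq; rewrite on_points_muln on_points0.
    by rewrite expnD mulnC gmulnM killX gmuln0.
  by rewrite expnD gmulnM killM gmuln0.
exists (exist _ N ffN), n1, n2; split=> //; split.
- apply: generic_injective_mono => B x y xy1; apply: n_eq => //.
  by apply: (fibre_map_inj (phi := model_iso M)); rewrite !graph.
- apply: generic_surjective_epi => B y.
  have [m mK Km] := fibre_map_bij (model_iso M) B.
  by have [x [_ x1]] := graph_onto B (m y); exists x; rewrite x1 Km.
- apply: generic_injective_mono => B x y xy2; apply: n_eq => //.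
  by rewrite -!graph; congr (fibre_map _ _).
- by apply: generic_surjective_epi => B m; have [x [x2 _]] := graph_onto B m;
    exists x.
Qed.

Lemma bimorphism_fibre (X Y : D) (s : hom Y X) : bimorphism s ->
  forall B, bijective (fun x : fibre_point j (sval Y) B =>
    on_points (s : gs_hom (sval Y) (sval X)) x : fibre_point j (sval X) B).
Proof.
move=> [s_mono s_epi]; have [N [N0 killN]] := ff_killed dvr p_neq0 X.
have [n [e [c ec]]] := ff_free dvr X.
apply: (fibre_bijective (dvr_exp_neq0 dvr n N0)).
  exact: (epi_injective dvr p_neq0 s_epi).
exact: (generic_mono_bound dvr (ff_free dvr Y) ec killN N0
  (mono_generic_kernel dvr s_mono)).
Qed.

(** A bimorphism Y -> X makes Y a model of the fibre of X, and a morphism from X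
    to that model which is the identity on fibres inverts it.  Conversely, the
    roof N over a model M has a bimorphism to X; when X is maximal its inverse,
    followed by N -> M, dominates M. *)
Lemma maximalP (X : D) : maximal j (sval X) <-> bi_maximal X.
Proof.
split=> [[ffX X_max] Y s s_bi|X_max].
  pose s' : gs_hom (sval Y) (sval X) := s.
  have ffY : finite_flat (sval Y : group_scheme R) by have [] := svalP Y.
  have s_nat (B C : comAlgType K) (f : {lrmorphism B -> C})
      (x : fibre_point j (sval Y) B) :
    on_points s' (lrcomp (restr_morphism j f) x) =
    lrcomp (restr_morphism j f) (on_points s' x) by rewrite on_points_nat.
  pose phi : fibre_iso j (sval Y) (sval X) :=
    @FibreIso R K j (sval Y) (sval X) (fun B x => on_points s' x)
      (bimorphism_fibre s_bi) (fun B x y => on_pointsD s' x y) s_nat.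
  have [f fE] := X_max (Prolongation ffY phi).
  have sf : s \oc (f : hom X Y) = idc X.
    apply: (generic_faithful (ff_free dvr X)) => B x.
    by rewrite on_points_comp [RHS]on_points_id; apply: fE.
  exists f; split=> //; apply: s_bi.1.
  by rewrite comp_assoc sf comp_idl comp_idr.
have ffX : finite_flat (sval X : group_scheme R) by have [] := svalP X.
exists ffX => M; have [N [n1 [n2 [n1_bi n2_bi graph _]]]] :=
  prolongation_roof M.
have [g [_ n1g]] := X_max _ _ n1_bi.
exists (gs_comp (n2 : gs_hom (sval N) (model M))
  (g : gs_hom (sval X) (sval N))).
move=> B x; rewrite on_points_comp graph -on_points_comp.
have := congr1 (fun u : gs_hom _ _ => on_points u x) n1g.
by move=> ->; apply: on_points_id.
Qed.

(** Here the roof N is turned into a common quotient: the pushout of N -> M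
    along N -> X receives a bimorphism from X, which is invertible when X is
    minimal. *)
Lemma minimalP (X : D) : minimal j (sval X) <-> bi_minimal X.
Proof.
split=> [[ffX X_min] Y s s_bi|X_min].
  pose s' : gs_hom (sval X) (sval Y) := s.
  have ffY : finite_flat (sval Y : group_scheme R) by have [] := svalP Y.
  have s_inj B (x y : fibre_point j (sval X) B) :
      on_points s' x = on_points s' y -> x = y.
    exact: (bij_inj (bimorphism_fibre s_bi B)).
  have s_onto B (y : fibre_point j (sval Y) B) : exists x, on_points s' x = y.
    by have [t _ tK] := bimorphism_fibre s_bi B; exists (t y); apply: tK.
  pose t B y : fibre_point j (sval X) B := sval (cid (s_onto B y)).
  have tK B y : on_points s' (t B y) = y by rewrite /t; case: cid.
  have t_bij B : bijective (t B).
    by exists (fun x => on_points s' x) => [y|x]; [|apply: s_inj]; apply: tK.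
  have tD B (x y : fibre_point j (sval Y) B) :
      t B (gadd x y) = gadd (t B x) (t B y).
    by apply: s_inj; rewrite on_pointsD !tK.
  have t_nat (B C : comAlgType K) (f : {lrmorphism B -> C})
      (x : fibre_point j (sval Y) B) :
      t C (lrcomp (restr_morphism j f) x) = lrcomp (restr_morphism j f) (t B x).
    by apply: s_inj; rewrite -on_points_nat !tK.
  pose phi : fibre_iso j (sval Y) (sval X) :=
    @FibreIso R K j (sval Y) (sval X) t t_bij tD t_nat.
  have [f fE] := X_min (Prolongation ffY phi).
  have fE' B (y : point (sval Y : group_scheme R) (restr B)) :
    on_points f y = t B y by exact: fE.
  exists f; split.
    apply: (generic_faithful (ff_free dvr X)) => B x.
    by rewrite on_points_comp [RHS]on_points_id fE'; apply: s_inj; rewrite tK.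
  apply: (generic_faithful (ff_free dvr Y)) => B y.
  by rewrite on_points_comp [RHS]on_points_id fE' tK.
have ffX : finite_flat (sval X : group_scheme R) by have [] := svalP X.
exists ffX => M.
have [N [n1 [n2 [n1_bi n2_bi graph graph_onto]]]] := prolongation_roof M.
have [P [q1 [q2 [q12 q2_mono q_epi]]]] := ff_mono_pushout dvr p_neq0 n1 n2_bi.1.
have q2_bi : bimorphism q2.
  split=> // T u v uv; apply: q_epi => //; apply: n2_bi.2.
  by rewrite -!comp_assoc q12 !comp_assoc uv.
have [g [gq2 _]] := X_min _ _ q2_bi.
exists (gs_comp (g : gs_hom (sval P) (sval X))
  (q1 : gs_hom (model M) (sval P))).
move=> B m /=; have [x [<- n1x]] := graph_onto B m.
rewrite graph.
have E : g \oc q1 \oc n2 = n1 by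
  rewrite -comp_assoc q12 comp_assoc gq2 comp_idl.
have := congr1 (fun u : gs_hom _ _ => on_points u x) E.
by rewrite /= !on_points_comp.
Qed.

Theorem maximal_category_abelian : abelian_category (maximal_category j p).
Proof.
apply: (@abelian_nested (group_schemes R) (finite_flat_p p) _
  (@bi_maximal D)); last first.
  exact: (ff_maximal_abelian dvr p_neq0).
move=> X; split=> [[ffX killX maxX]|[ffX]].
  have h : finite_flat_p p X by split.
  by exists h; apply/(maximalP (exist _ X h)).
by move=> /maximalP maxX; have [? ?] := ffX; split.
Qed.

Theorem minimal_category_abelian : abelian_category (minimal_category j p).
Proof.
apply: (@abelian_nested (group_schemes R) (finite_flat_p p) _
  (@bi_minimal D)); last first.
  exact: (ff_minimal_abelian dvr p_neq0).
move=> X; split=> [[ffX killX minX]|[ffX]].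
  have h : finite_flat_p p X by split.
  by exists h; apply/(minimalP (exist _ X h)).
by move=> /minimalP minX; have [? ?] := ffX; split.
Qed.

End Prolongations.

(** * Witt vectors *)

Section Dwork.
Variables (p : nat) (A : comNzRingType) (phi : {rmorphism A -> A}).
Hypothesis p_prime : prime p.
Hypothesis p_reg : forall x : A, p%:R * x = 0 -> x = 0.
Hypothesis phi_lift : forall x, exists y, phi x = x ^+ p + p%:R * y.

Definition cong n (x y : A) := exists z, x = y + p%:R ^+ n * z.

Lemma cong_refl n x : cong n x x.
Proof. by exists 0; rewrite mulr0 addr0. Qed.

Lemma cong_sym n x y : cong n x y -> cong n y x.
Proof. by move=> [z ->]; exists (- z); ring. Qed.

Lemma cong_trans n x y z : cong n x y -> cong n y z -> cong n x z.
Proof. by move=> [u ->] [v ->]; exists (u + v); ring. Qed.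

Lemma congD n x y x' y' : cong n x y -> cong n x' y' ->
    cong n (x + x') (y + y').
Proof. by move=> [u ->] [v ->]; exists (u + v); ring. Qed.

Lemma congM n x y x' y' : cong n x y -> cong n x' y' ->
    cong n (x * x') (y * y').
Proof.
move=> [u ->] [v ->]; exists (y * v + u * y' + p%:R ^+ n * u * v).
by ring.
Qed.

Lemma congX n x y m : cong n x y -> cong n (x ^+ m) (y ^+ m).
Proof.
move=> xy; elim: m => [|m IH]; first exact: cong_refl.
by rewrite !exprS; apply: congM.
Qed.

Lemma cong_sum n m (F G : 'I_m -> A) : (forall i, cong n (F i) (G i)) ->
  cong n (\sum_i F i) (\sum_i G i).
Proof.
move=> FG; pose z i := sval (cid (FG i)).
have zE i : F i = G i + p%:R ^+ n * z i by rewrite /z; case: cid.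
exists (\sum_i z i); rewrite mulr_sumr -big_split.
by apply: eq_bigr => i _; apply: zE.
Qed.

Lemma cong_scale m n x y : cong n x y ->
  cong (m + n) (p%:R ^+ m * x) (p%:R ^+ m * y).
Proof. by move=> [z ->]; exists z; rewrite exprD; ring. Qed.

(** x^p - y^p is (x - y) times a sum of p terms that are all congruent to
    y^(p-1) modulo p. *)
Lemma cong_Xp n x y : cong n.+1 x y -> cong n.+2 (x ^+ p) (y ^+ p).
Proof.
move=> xy; have [z xE] := xy.
have xy1 : cong 1 x y by exists (p%:R ^+ n * z);
  rewrite xE expr1 (exprS _ n); ring.
have [t tE] : cong 1 (\sum_(i < p) x ^+ (p.-1 - i) * y ^+ i)
                     (\sum_(i < p) y ^+ p.-1).
  apply: cong_sum => i.
  have {2}-> : p.-1 = (p.-1 - i + i)%N.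
    by rewrite subnK // -ltnS prednK ?ltn_ord // prime_gt0.
  by rewrite exprD; apply: congM; [apply: congX | apply: cong_refl].
exists (z * (y ^+ p.-1 + t)).
have -> : x ^+ p = y ^+ p + (x ^+ p - y ^+ p) by ring.
rewrite subrXX tE sumr_const card_ord -[_ *+ p]mulr_natl xE expr1.
by rewrite (exprS _ n.+1) (exprS _ n); ring.
Qed.

Lemma cong_Xpn n x y : cong 1 x y -> cong n.+1 (x ^+ (p ^ n)) (y ^+ (p ^ n)).
Proof.
move=> xy; elim: n => [|n IH]; first by rewrite !expr1.
by rewrite expnSr !exprM; apply: cong_Xp.
Qed.

Implicit Types a b c w : nat -> A.

(** Applying phi to the ghost component of index n replaces a i by a i ^+ p up
    to a multiple of p; the weight p^i and the exponent p^(n - i) improve this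
    to a congruence modulo p^(n + 1). *)
Lemma ghost_succ a n : cong n.+1
  (\sum_(i < n.+1) (p ^ i)%:R * a i ^+ (p ^ (n.+1 - i))) (phi (ghost p a n)).
Proof.
rewrite /ghost rmorph_sum; apply: cong_sum => i.
rewrite rmorphM rmorph_nat rmorphXn natrX /=.
case: i => i /=; rewrite ltnS => i_n.
have E : (i + (n - i).+1)%N = n.+1 by rewrite addnS subnKC.
rewrite -[X in cong X]E.
apply: cong_scale; rewrite subSn // expnS exprM; apply: cong_Xpn.
have [y ->] := phi_lift (a i); exists (- y); ring.
Qed.

Lemma ghost0 a : ghost p a 0 = a 0%N.
Proof. by rewrite /ghost big_ord1 expn0 mul1r expr1. Qed.

(** Dwork's criterion: these congruences characterize the sequences of ghost
    components. *)
Definition frobenius_compatible (w : nat -> A) :=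
  forall n, cong n.+1 (w n.+1) (phi (w n)).

Lemma ghost_compatible a : frobenius_compatible (ghost p a).
Proof.
move=> n; apply: cong_trans (ghost_succ a n).
exists (a n.+1); rewrite {1}/ghost big_ord_recr /= subnn expn0 expr1 natrX.
by [].
Qed.

Lemma ghost_ext a b n : (forall i, (i <= n)%N -> a i = b i) ->
  ghost p a n = ghost p b n.
Proof. by move=> ab; apply: eq_bigr => i _; rewrite ab // -ltnS. Qed.

(** The term of index n is found by dividing by p^n what remains of w n after
    the earlier terms.  This is possible because that remainder is congruent to
    w n - phi (w (n - 1)). *)
Lemma ghost_surjective w : frobenius_compatible w ->
  exists a, forall n, ghost p a n = w n.
Proof.
move=> w_phi.
pose next n (a : nat -> A) x := w n =
  \sum_(i < n) (p ^ i)%:R * a i ^+ (p ^ (n - i)) + (p ^ n)%:R * x.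
have next_ex n a : (forall i, (i < n)%N -> ghost p a i = w i) ->
    exists x, next n a x.
  case: n => [|n] aw.
    by exists (w 0%N); rewrite /next big_ord0 add0r mul1r.
  have [|z zE] := @cong_trans n.+1 (w n.+1) (phi (w n))
    (\sum_(i < n.+1) (p ^ i)%:R * a i ^+ (p ^ (n.+1 - i))) (w_phi n).
    by rewrite -aw //; apply/cong_sym/ghost_succ.
  by exists z; rewrite /next natrX.
(* build n holds the terms of index below n; [pick] extends it by one. *)
pose pick n a := if pselect (exists x, next n a x) is left ex
  then sval (cid ex) else 0.
pose fix build n : nat -> A := if n is m.+1
  then fun i => if i == m then pick m (build m) else build m i else fun=> 0.
pose a n := build n.+1 n.
have buildE n i : (i < n)%N -> build n i = a i.
  elim: n => // n IH; rewrite ltnS leq_eqVlt => /predU1P[-> //|i_n].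
  by rewrite /= (ltn_eqF i_n) IH.
exists a; elim/ltn_ind => n IH.
have [|x xE] := next_ex n (build n).
  move=> i i_n; rewrite -IH //; apply: ghost_ext => l l_i.
  by apply: buildE; apply: leq_ltn_trans l_i i_n.
have an : next n (build n) (a n).
  rewrite /a /= eqxx /pick; case: pselect => [ex|[]]; last by exists x.
  by case: cid.
rewrite an /ghost big_ord_recr /= subnn expn0 expr1; congr (_ + _).
by apply: eq_bigr => i _; rewrite buildE.
Qed.

Lemma ghost_add a b : exists c, forall n,
  ghost p c n = ghost p a n + ghost p b n.
Proof.
apply: (ghost_surjective (w := fun n => ghost p a n + ghost p b n)) => n.
by rewrite rmorphD; apply: congD; apply: ghost_compatible.
Qed.

Lemma ghost_mul a b : exists c, forall n,
  ghost p c n = ghost p a n * ghost p b n.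
Proof.
apply: (ghost_surjective (w := fun n => ghost p a n * ghost p b n)) => n.
by rewrite rmorphM; apply: congM; apply: ghost_compatible.
Qed.

(** Once the earlier terms are congruent modulo p, their contributions to the
    ghost components of index n are congruent modulo p^(n + 1); what remains is
    p^n * a n, and p is regular. *)
Lemma ghost_cong a b :
  (forall n, cong n.+1 (ghost p a n) (ghost p b n)) ->
    forall n, cong 1 (a n) (b n).
Proof.
have regX n (x : A) : p%:R ^+ n * x = 0 -> x = 0.
  elim: n => [|n IH]; first by rewrite expr0 mul1r.
  by rewrite exprS -mulrA => /p_reg/IH.
move=> ab; elim/ltn_ind => n IH.
have [z zE] : cong n.+1 (p%:R ^+ n * a n) (p%:R ^+ n * b n).
  have E (c : nat -> A) : p%:R ^+ n * c n = ghost p c n +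
      (-1) * \sum_(i < n) (p ^ i)%:R * c i ^+ (p ^ (n - i)).
    by rewrite /ghost big_ord_recr /= subnn expn0 expr1 natrX; ring.
  rewrite !E; apply: congD; first exact: ab.
  apply: congM; first exact: cong_refl.
  apply: cong_sum => i; rewrite natrX.
  case: i => i /= i_n.
  have iE : (i + (n - i).+1)%N = n.+1 by rewrite addnS subnKC // ltnW.
  rewrite -[X in cong X]iE.
  exact/cong_scale/cong_Xpn/IH.
exists z; apply/subr0_eq/(regX n); rewrite mulrBr zE exprS; ring.
Qed.

(** The ghost components of the sequence 0, a 0 ^+ p, a 1 ^+ p and so on are p
    times those of a, up to the term p^(n + 1) * a n. *)
Lemma ghost_p_shift a c : (forall n, ghost p c n = p%:R * ghost p a n) ->
  cong 1 (c 0%N) 0 /\ forall n, cong 1 (c n.+1) (a n ^+ p).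
Proof.
move=> ca; pose b n := if n is m.+1 then a m ^+ p else 0.
suff cb n : cong 1 (c n) (b n) by split=> [|n];
  [apply: (cb 0%N) | apply: (cb n.+1)].
apply: ghost_cong => {}n; rewrite ca {1}/ghost big_ord_recr /= subnn expn0
  expr1.
exists (a n); rewrite mulrDr natrX /ghost big_ord_recl /=.
rewrite expr0n expn_eq0 (gtn_eqF (prime_gt0 p_prime)) /= mulr0 add0r exprS.
congr (_ + _); last by rewrite mulrA.
rewrite mulr_sumr; apply: eq_bigr => i _; rewrite /bump /= add1n add0n.
by rewrite -exprM -expnS -subSn // subSS expnS natrM mulrA.
Qed.

End Dwork.

Section MonoidRing.
Variable k : comNzRingType.

(** The ring Z[M] of a monoid M that maps onto k maps onto k and has no torsion,
    and the p-th power map of M lifts Frobenius to it.  M is the multiplicative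
    monoid of k with a new identity, distinct from the 1 of k: this makes M
    conical, which means that a product is the identity only if both factors
    are, as monoid algebras are formed over conical monoids. *)
Definition adjoined : Type := option k.
HB.instance Definition _ := Choice.on adjoined.

Definition adjoined_mul (x y : adjoined) : adjoined :=
  match x, y with
  | Some a, Some b => Some (a * b)
  | None, _ => y
  | _, None => x
  end.

Lemma adjoined_mulA : associative adjoined_mul.
Proof. by move=> [a|] [b|] [c|] //=; rewrite mulrA. Qed.
Lemma adjoined_mul1 : left_id None adjoined_mul.
Proof. by case. Qed.
Lemma adjoined_mulr1 : right_id None adjoined_mul.
Proof. by case. Qed.
Lemma adjoined_unit x y : adjoined_mul x y = None -> x = None /\ y = None.
Proof. by case: x y => [a|] [b|]. Qed.
Lemma adjoined_mulC : commutative adjoined_mul.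
Proof. by move=> [a|] [b|] //=; rewrite mulrC. Qed.

HB.instance Definition _ := Choice_isMonomialDef.Build adjoined adjoined_mulA
  adjoined_mul1 adjoined_mulr1 adjoined_unit.
HB.instance Definition _ := MonomialDef_isConomialDef.Build adjoined
  adjoined_mulC.

Definition monoid_ring := {malg int[adjoined]}.
HB.instance Definition _ := GRing.ComNzRing.on monoid_ring.

Definition adjoined_val (x : adjoined) : k := odflt 1 x.
Lemma adjoined_val_mmorphism : mmorphism adjoined_val.
Proof. by split=> [[a|] [b|]|] //=; rewrite ?mul1r ?mulr1. Qed.
HB.instance Definition _ := isMultiplicative.Build adjoined k adjoined_val
  adjoined_val_mmorphism.

Variable p : nat.

Definition adjoined_pow (x : adjoined) : monoid_ring :=
  mkmalgU (omap (fun a => a ^+ p) x : adjoined) 1.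
Lemma adjoined_pow_mmorphism : mmorphism adjoined_pow.
Proof.
split=> // x y; rewrite /adjoined_pow [RHS]fgmulUU mulr1; congr mkmalgU.
by case: x y => [a|] [b|] //=; rewrite exprMn.
Qed.
HB.instance Definition _ := isMultiplicative.Build adjoined monoid_ring
  adjoined_pow adjoined_pow_mmorphism.

Definition monoid_ring_eval : {rmorphism monoid_ring -> k} :=
  [the {rmorphism monoid_ring -> k} of mmap intr adjoined_val].
Definition monoid_ring_frobenius : {rmorphism monoid_ring -> monoid_ring} :=
  [the {rmorphism monoid_ring -> monoid_ring} of mmap intr adjoined_pow].

Definition monoid_ring_lift (a : k) : monoid_ring :=
    mkmalgU (Some a : adjoined) 1.

Lemma monoid_ring_liftK a : monoid_ring_eval (monoid_ring_lift a) = a.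
Proof. by rewrite /= mmapU mul1r. Qed.

Lemma monoid_ring_regular (x : monoid_ring) :
  prime p -> p%:R * x = 0 -> x = 0.
Proof.
move=> /prime_gt0 p0 px; apply/malgP => m; rewrite mcoeff0.
have := congr1 (mcoeff m) px; rewrite mulr_natl mcoeffMn mcoeff0 => /eqP.
by rewrite mulrn_eq0 gtn_eqF // => /eqP.
Qed.

Lemma monoid_ring_ind (P : monoid_ring -> Prop) : P 0 ->
  (forall u v, P u -> P v -> P (u + v)) -> (forall u, P u -> P (- u)) ->
  (forall m, P (mkmalgU m 1)) -> forall x, P x.
Proof.
move=> P0 PD PN PX x.
have -> : x = \sum_(m <- finmap.enum_fset (msupp x))
    (mkmalgU m (mcoeff m x) : monoid_ring) by exact: monalgE.
apply: (big_ind P); [exact: P0 | exact: PD | move=> m _].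
have Pnat n : P (mkmalgU m n%:Z).
  elim: n => [|n IH]; first by rewrite monalgU0.
  have -> : (mkmalgU m n.+1%:Z : monoid_ring) = mkmalgU m n%:Z + mkmalgU m 1.
    by rewrite -addn1 PoszD monalgUD.
  exact: PD.
case: (mcoeff m x) => n; first exact: Pnat.
by rewrite NegzE monalgUN; apply: PN.
Qed.

Lemma freshman (A : comNzRingType) (x y : A) : prime p ->
  exists z, (x + y) ^+ p = x ^+ p + y ^+ p + p%:R * z.
Proof.
move=> p_pr; have p0 := prime_gt0 p_pr; rewrite exprDn.
case: p p_pr p0 => // q q_pr _.
rewrite big_ord_recl big_ord_recr /= bin0 binn subn0 subnn !expr0 !mulr1 mul1r.
have div (i : 'I_q) : (q.+1 %| 'C(q.+1, bump 0 i))%N.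
  by rewrite prime_dvd_bin // /bump /= add1n ltnS ltn_ord.
exists (\sum_(i < q) (x ^+ (q.+1 - bump 0 i) * y ^+ bump 0 i) *+
  ('C(q.+1, bump 0 i) %/ q.+1)).
rewrite -!addrA; congr (_ + _); rewrite addrC; congr (_ + _).
rewrite mulr_sumr; apply: eq_bigr => i _ /=.
by rewrite mulr_natl -mulrnA divnK.
Qed.

(** The elements that satisfy the congruence contain the monoid, and they form a
    subgroup: sums by the binomial theorem, opposites because p is odd. *)
Lemma monoid_ring_frobenius_lift (x : monoid_ring) : prime p -> odd p ->
  exists y, monoid_ring_frobenius x = x ^+ p + p%:R * y.
Proof.
move=> p_pr p_odd; set phi := monoid_ring_frobenius.
pose P (x : monoid_ring) := exists y, phi x = x ^+ p + p%:R * y.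
have P0 : P 0.
  exists 0; rewrite rmorph0 mulr0 addr0 expr0n gtn_eqF //; exact: prime_gt0.
have PD u v : P u -> P v -> P (u + v).
  move=> [y uy] [z vz]; have [t tE] := freshman u v p_pr.
  by exists (y + z - t); rewrite rmorphD uy vz tE; ring.
have PN u : P u -> P (- u).
  move=> [y uy]; exists (- y).
  by rewrite rmorphN uy exprNn -signr_odd p_odd expr1; ring.
have PX m : P (mkmalgU m 1).
  exists 0; rewrite mulr0 addr0 /= mmapU mul1r.
  have XE n : (mkmalgU m 1 : monoid_ring) ^+ n =
      mkmalgU (iter n (adjoined_mul m) None : adjoined) 1.
    elim: n => [|n IH]; first by rewrite expr0.
    by rewrite exprS IH [LHS]fgmulUU mulr1.
  rewrite XE /adjoined_pow; congr mkmalgU; case: m {XE} => [a|] /=.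
    have := prime_gt0 p_pr; case: (p) => // q _.
    elim: q => [|q IH]; first by rewrite expr1.
    by rewrite iterS -IH /= exprS.
  by elim: (p) => //= q <-.
exact: (@monoid_ring_ind P P0 PD PN PX x).
Qed.

End MonoidRing.

Section WittRing.
Variables (p : nat) (k : fieldType) (W : idomainType).
Hypotheses (p_prime : prime p) (p_odd : odd p) (k_perfect : perfect_field p k).
Variable wv : (nat -> k) -> W.
Hypothesis wv_bij : bijective wv.
Hypothesis wv_ghost : forall (A : comNzRingType) (f : {rmorphism A -> k}),
  (forall x : A, p%:R * x = 0 -> x = 0) -> forall a b c : nat -> A,
  ((forall n, ghost p c n = ghost p a n + ghost p b n) ->
     wv (f \o c) = wv (f \o a) + wv (f \o b)) /\
  ((forall n, ghost p c n = ghost p a n * ghost p b n) ->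
     wv (f \o c) = wv (f \o a) * wv (f \o b)).

Let A := monoid_ring k.
Let f : {rmorphism A -> k} := monoid_ring_eval k.
Let phi : {rmorphism A -> A} := monoid_ring_frobenius k p.
Let lift (a : nat -> k) n : A := monoid_ring_lift (a n).

Let A_reg (x : A) : p%:R * x = 0 -> x = 0.
Proof. exact: monoid_ring_regular. Qed.

Let A_lift (x : A) : exists y, phi x = x ^+ p + p%:R * y.
Proof. exact: monoid_ring_frobenius_lift. Qed.

Let liftK a : f \o lift a = a.
Proof. by apply/funext => n; apply: monoid_ring_liftK. Qed.

Let f_cong (x y : A) : cong p 1 x y -> f x = f y.
Proof.
move=> [z ->]; rewrite rmorphD rmorphM expr1 rmorph_nat.
by have [/pcharf0 -> _] := k_perfect; rewrite mul0r addr0.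
Qed.

Lemma witt_inj : injective wv.
Proof. exact: bij_inj. Qed.

Lemma witt0 : wv (fun=> 0) = 0.
Proof.
have [wvD _] := wv_ghost f A_reg (fun=> 0) (fun=> 0) (fun=> 0).
have f0 : f \o (fun _ : nat => 0 : A) = (fun=> 0).
  by apply/funext => n; apply: rmorph0.
have : wv (fun=> 0) = wv (fun=> 0) + wv (fun=> 0).
  rewrite -f0; apply: wvD => n; rewrite /ghost big1 ?addr0 // => i _.
  by rewrite expr0n expn_eq0 (gtn_eqF (prime_gt0 p_prime)) /= mulr0.
by rewrite -[LHS]addr0 => /addrI <-.
Qed.

(** The ghost component of index 0 is the term of index 0. *)
Lemma witt_mul0 a b : exists c, wv c = wv a * wv b /\ c 0%N = a 0%N * b 0%N.
Proof.
have [c cE] := ghost_mul p_prime A_lift (lift a) (lift b).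
exists (f \o c); split.
  have [_ wvM] := wv_ghost f A_reg (lift a) (lift b) c.
  by rewrite wvM // !liftK.
have := cE 0%N; rewrite !ghost0 /= => ->.
by rewrite rmorphM !monoid_ring_liftK.
Qed.

(** All the ghost components of this sequence are 1, so it gives a nonzero
    idempotent of a domain. *)
Lemma witt1 : wv (fun n => (n == 0%N)%:R) = 1.
Proof.
pose e n : A := (n == 0%N)%:R.
have eE : f \o e = fun n => (n == 0%N)%:R by apply/funext => n;
  rewrite /= rmorph_nat.
have ghost_e n : ghost p e n = 1.
  rewrite /ghost big_ord_recl /= big1 => [|i _].
    by rewrite addr0 expn0 mul1r expr1n.
  by rewrite /e /= expr0n expn_eq0 (gtn_eqF (prime_gt0 p_prime)) /= mulr0.
have [_ wvM] := wv_ghost f A_reg e e e.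
have idem : wv (f \o e) * wv (f \o e) = wv (f \o e).
  by rewrite -wvM // => n; rewrite !ghost_e mulr1.
have e0 : wv (f \o e) != 0.
  rewrite -witt0 (inj_eq witt_inj) eE; apply/eqP => /(congr1 (fun g => g 0%N)).
  by move=> /eqP; rewrite oner_eq0.
by apply: (mulfI e0); rewrite -eE idem mulr1.
Qed.

Lemma witt_exp a d : exists c, wv c = wv a ^+ d /\ c 0%N = a 0%N ^+ d.
Proof.
elim: d => [|d [c [cE c0]]].
  by exists (fun n => (n == 0%N)%:R); rewrite witt1.
have [b [bE b0]] := witt_mul0 a c.
by exists b; rewrite bE b0 cE c0 !exprS.
Qed.

(** Lift a to the monoid ring, where p * a is computed by adding up lifts;
    modulo p the result is described by [ghost_p_shift]. *)
Lemma witt_mulp a :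
  p%:R * wv a = wv (fun n => if n is m.+1 then a m ^+ p else 0).
Proof.
have mul_nat m : exists c : nat -> A,
    (forall n, ghost p c n = m%:R * ghost p (lift a) n) /\
    wv (f \o c) = m%:R * wv a.
  elim: m => [|m [c [cE cw]]].
    exists (fun=> 0); split=> [n|].
      rewrite mul0r /ghost big1 // => i _.
      by rewrite expr0n expn_eq0 (gtn_eqF (prime_gt0 p_prime)) /= mulr0.
    rewrite mul0r -[RHS]witt0; congr wv; apply/funext => n; exact: rmorph0.
  have [b bE] := ghost_add p_prime A_lift c (lift a).
  have [wvD _] := wv_ghost f A_reg c (lift a) b.
  exists b; rewrite wvD // cw liftK; split=> [n|];
    last by rewrite -natr1 mulrDl mul1r.
  by rewrite bE cE -natr1 mulrDl mul1r.
have [c [cE <-]] := mul_nat p; congr wv.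
have [c0 cS] := ghost_p_shift p_prime A_reg cE.
apply/funext => -[|n] /=; first by rewrite (f_cong c0) rmorph0.
by rewrite (f_cong (cS n)) rmorphXn /= monoid_ring_liftK.
Qed.

Lemma witt_p_neq0 : p%:R != 0 :> W.
Proof.
apply/eqP => p0.
have E a : wv (fun n => if n is m.+1 then a m ^+ p else 0) = wv (fun=> 0).
  by rewrite -witt_mulp p0 mul0r witt0.
have /witt_inj/(congr1 (fun g => g 1%N)) := E (fun=> 1).
by rewrite expr1n => /eqP; rewrite oner_eq0.
Qed.

(** A sequence that begins with 0 is a shift of p-th powers, as k is perfect; so
    p divides w as often as there are leading zeros. *)
Lemma witt_uniformizer w : w != 0 ->
  exists v b, w = p%:R ^+ v * wv b /\ b 0%N != 0.
Proof.
have [wv' wv'K wvK] := wv_bij; rewrite -[w]wvK; move: (wv' w) => a a0.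
have [v av] : exists v, a v != 0.
  apply: contrapT => all0; case/eqP: a0; rewrite -witt0; congr wv.
  apply/funext => n; apply/eqP; apply: contrapT => an.
  by apply: all0; exists n; apply/negP.
elim: v a {a0} av => [|v IH] a av.
  by exists 0%N, a; rewrite expr0 mul1r.
have [a00|a00] := eqVneq (a 0%N) 0; last first.
  by exists 0%N, a; rewrite expr0 mul1r.
have [_ roots] := k_perfect.
pose r n := sval (cid (roots (a n.+1))).
have rE n : r n ^+ p = a n.+1 by rewrite /r; case: cid.
have [|m [b [bE b0]]] := IH r.
  by apply: contra_neq av; rewrite -rE => ->; rewrite expr0n gtn_eqF ?prime_gt0.
exists m.+1, b; split=> //; rewrite exprS -mulrA -bE witt_mulp; congr wv.
by apply/funext => -[|n].
Qed.

Lemma witt_exp_ndvd b d w : b 0%N != 0 -> wv b ^+ d != p%:R * w.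
Proof.
move=> b0; have [wv' wv'K wvK] := wv_bij; rewrite -[w]wvK witt_mulp.
have [c [<- c0]] := witt_exp b d; rewrite (inj_eq witt_inj).
apply/eqP => /(congr1 (fun g => g 0%N)) /=; rewrite c0 => /eqP.
by apply/negP; rewrite expf_neq0.
Qed.

End WittRing.

(** * The ring of integers *)

Section RingOfIntegers.
Variables (p : nat) (k : fieldType) (W : idomainType).
Hypotheses (p_prime : prime p) (p_odd : odd p) (k_perfect : perfect_field p k).
Hypothesis W_Witt : is_Witt_ring p k W.
Variable K : fieldExtType {fraction W}.
Local Notation O := (ring_of_integers K).
Local Notation iota := (in_alg K \o @tofrac W).
Local Notation "x %:F" := (tofrac x).

Lemma iota_inj : injective iota.
Proof.
apply: inj_comp; first exact: fmorph_inj.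
by move=> x y /eqP; rewrite tofrac_eq => /eqP.
Qed.

Lemma iotaP : exists io : {rmorphism W -> K}, io =1 iota.
Proof. by exists [the {rmorphism W -> K} of iota]. Qed.

Lemma fraction_denominator (t : {fraction W}) :
  exists a d, d != 0 /\ t * d%:F = a%:F.
Proof.
elim/quotW: t => r; exists (frac r).1, (frac r).2; split;
  first exact: denom_ratioP.
unlock tofrac; rewrite -[_ * _]FracField.pi_mul.
apply/eqmodP; rewrite /= /FracField.equivf /FracField.mulf /=.
by rewrite !numden_Ratio ?mulf_neq0 ?denom_ratioP ?oner_neq0 // !mulr1 mulrC.
Qed.

Lemma in_integers x : (x \in @integers W K) <-> integralOver iota x.
Proof. by split=> /asboolP. Qed.

(** A nonzero integral element divides a nonzero element of W, the constant term
    of a polynomial equation that it satisfies. *)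
Lemma integral_divides (x : K) : x \in @integers W K -> x != 0 ->
  exists w y, [/\ w != 0, y \in @integers W K & iota w = x * y].
Proof.
move=> xO x0; have /in_integers[P P_monic] := xO.
have iota_int w : iota w \in @integers W K by apply/in_integers/integral_id.
have : P != 0 by apply: monic_neq0.
elim/poly_ind: P {P_monic} => [|P c IH] P0 rootP; first by rewrite eqxx in P0.
have [c0|c0] := eqVneq c 0.
  have {}P0 : P != 0 by apply: contraNneq P0 => ->; rewrite c0 mul0r addr0.
  apply: IH => //; move: rootP; rewrite c0 addr0 /root rmorphM /= map_polyX.
  by rewrite hornerMX mulf_eq0 (negbTE x0) orbF.
exists (- c), (map_poly iota P).[x]; split; first by rewrite oppr_eq0.
  elim/poly_ind: P {IH P0 rootP} => [|P d IH];
    first by rewrite rmorph0 horner0 rpred0.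
  rewrite rmorphD rmorphM /= map_polyX map_polyC hornerMXaddC.
  by apply: rpredD; [apply: rpredM | apply: iota_int].
move: rootP; rewrite /root rmorphD rmorphM /= map_polyX map_polyC hornerMXaddC.
rewrite addr_eq0 => /eqP xP; rewrite [RHS]mulrC xP.
exact: (rmorphN iota).
Qed.

(** If p divides b in O, then p divides a power of b in W: multiply an integral
    equation of b / p by a power of p. *)
Lemma integral_div_p (b : W) (s : K) : s \in @integers W K ->
  iota b = p%:R * s -> exists d w, b ^+ d = p%:R * w.
Proof.
move=> /in_integers[Q Q_monic]; have [io ioE] := iotaP.
rewrite -ioE (eq_map_poly (g := io)) => [rootQ bs|w]; last by rewrite ioE.
pose n := (size Q).-1.
have Q_size : size Q = n.+1 by rewrite prednK // size_poly_gt0 monic_neq0.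
exists n, (- \sum_(i < n) Q`_i * p%:R ^+ (n - i).-1 * b ^+ i).
have io_inj : injective io by move=> x y; rewrite !ioE => /iota_inj.
apply: io_inj; apply/eqP; rewrite mulrN rmorphN -addr_eq0; apply/eqP.
have : p%:R ^+ n * (map_poly io Q).[s] = 0 by rewrite (rootP rootQ) mulr0.
have -> : map_poly io Q = \poly_(i < n.+1) io Q`_i by rewrite -Q_size.
rewrite horner_poly big_ord_recr /= mulrDr.
have -> : Q`_n = 1 by move: Q_monic; rewrite monicE lead_coefE -/n => /eqP.
rewrite rmorph1 mul1r -exprMn -bs addrC => E.
rewrite -[RHS]E rmorphXn; congr (_ + _).
rewrite rmorphM rmorph_sum !mulr_sumr; apply: eq_bigr => i _.
rewrite !rmorphM !rmorphXn /= !rmorph_nat.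
have -> : (p%:R : K) ^+ n = p%:R * p%:R ^+ (n - i).-1 * p%:R ^+ i.
  by rewrite -exprS prednK ?subn_gt0 // -exprD subnK // ltnW.
by rewrite bs exprMn; ring.
Qed.

Lemma p_neq0_K : p%:R != 0 :> K.
Proof.
have [wv [wv_bij wv_ghost]] := W_Witt.
have := witt_p_neq0 p_prime p_odd k_perfect wv_bij wv_ghost.
apply: contra_neq => p0; apply: iota_inj; apply: (etrans (rmorph_nat iota p)).
by rewrite p0; apply/esym/(rmorph0 iota).
Qed.

Lemma p_neq0_O : p%:R != 0 :> O.
Proof.
apply: contra_neq p_neq0_K => p0.
by have := congr1 (integers_incl K) p0; rewrite rmorph_nat rmorph0.
Qed.

(** Write a nonzero multiple w = x * y in W as p^v * b, with b not divisible by
    p.  If p^(v + 1) divides x then p divides b in O, hence a power of b in W;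
    but the leading term of a power of b is a power of that of b. *)
Lemma integers_separated (x : O) : x != 0 ->
    exists n, forall y, x <> p%:R ^+ n * y.
Proof.
move=> x0; have [wv [wv_bij wv_ghost]] := W_Witt.
have vx0 : val x != 0 by rewrite (inj_eq val_inj x 0).
have [w [y [w0 yO wxy]]] := integral_divides (valP x) vx0.
have [v [b [wE b0]]] :=
  witt_uniformizer p_prime p_odd k_perfect wv_bij wv_ghost w0.
exists v.+1 => z xz.
have bz : iota (wv b) = p%:R * (val z * y).
  have [io ioE] := iotaP; rewrite -ioE; apply: (mulfI (expf_neq0 v p_neq0_K)).
  transitivity (io w); first by rewrite wE rmorphM rmorphXn rmorph_nat.
  rewrite ioE wxy xz -[val _]/(integers_incl K _) rmorphM rmorphXn rmorph_nat
    /=.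
  by rewrite exprSr -!mulrA.
have zyO : val z * y \in @integers W K by rewrite rpredM // (valP z).
have [d [w' bd]] := integral_div_p zyO bz.
have := witt_exp_ndvd p_prime p_odd k_perfect wv_bij wv_ghost d w' b0.
by rewrite bd eqxx.
Qed.

(** Clear the denominators of an algebraic equation, then of its leading
    coefficient. *)
Lemma integers_frac (x : K) : exists w (y : O), w != 0 /\ iota w * x = val y.
Proof.
have [q qE] : exists q : {poly {fraction W}},
  minPoly 1%VS x = map_poly (in_alg K) q.
  by apply/polyOver1P/minPolyOver.
have q_monic : q \is monic.
  by rewrite -(map_monic (in_alg K)) -qE monic_minPoly.
have rootq : root (map_poly (in_alg K) q) x by rewrite -qE root_minPoly.
pose n := (size q).-1.
have q_size : size q = n.+1 by rewrite prednK // size_poly_gt0 monic_neq0.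
have dens i : exists a d, d != 0 /\ q`_i * d%:F = a%:F.
  exact: fraction_denominator.
pose a i := sval (cid (dens i)).
pose d i := sval (cid (svalP (cid (dens i)))).
have [d0 dE] : (forall i, d i != 0) /\ (forall i, q`_i * (d i)%:F = (a i)%:F).
  by split=> i; have [] := svalP (cid (svalP (cid (dens i)))).
pose w := \prod_(i < n) d i.
have w0 : w != 0 by apply/prodf_neq0.
pose t (i : 'I_n) := a i * \prod_(l < n | l != i) d l.
have tE (i : 'I_n) : q`_i * w%:F = (t i)%:F.
  by rewrite /w (bigD1 i) //= rmorphM mulrA dE -rmorphM.
pose T : {poly W} := 'X^n + \sum_(i < n) (t i * w ^+ (n - i).-1) *: 'X^i.
have T_monic : T \is monic.
  apply/monicP; rewrite lead_coefDl ?lead_coefXn // size_polyXn ltnS.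
  apply: (leq_trans (size_sum _ _ _)); apply/bigmax_leqP => i _.
  by apply: leq_trans (size_scale_leq _ _) _; rewrite size_polyXn ltn_ord.
have [io ioE] := iotaP.
have [ia iaE] : exists ia : {rmorphism {fraction W} -> K}, ia =1 in_alg K.
  by exists [the {rmorphism {fraction W} -> K} of in_alg K].
have ia_io u : ia u%:F = io u by rewrite iaE ioE.
have rootT : root (map_poly iota T) (iota w * x).
  rewrite (eq_map_poly (g := io)) => [|v]; last by rewrite ioE.
  rewrite -ioE /root rmorphD rmorph_sum /= map_polyXn hornerD hornerXn
    horner_sum.
  have : io w ^+ n * (map_poly ia q).[x] = 0.
    by rewrite (eq_map_poly iaE) (rootP rootq) mulr0.
  have -> : map_poly ia q = \poly_(i < n.+1) ia q`_i by rewrite -q_size.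
  rewrite horner_poly big_ord_recr /= mulrDr.
  have -> : q`_n = 1 by move: q_monic; rewrite monicE lead_coefE -/n => /eqP.
  rewrite rmorph1 mul1r -exprMn addrC => E; apply/eqP; rewrite -[RHS]E.
  congr (_ + _); rewrite mulr_sumr; apply: eq_bigr => i _.
  rewrite map_polyZ /= map_polyXn hornerZ hornerXn exprMn.
  rewrite rmorphM rmorphXn /= -(ia_io (t i)) -tE rmorphM ia_io.
  have -> : io w ^+ n = io w * io w ^+ (n - i).-1 * io w ^+ i.
    by rewrite -exprS prednK ?subn_gt0 // -exprD subnK // ltnW.
  by ring.
have wxO : iota w * x \in @integers W K by apply/in_integers; exists T.
by exists w, (exist (fun z : K => z \in @integers W K) _ wxO).
Qed.

(** As p is a unit times a power of pi, an element of O that is not infinitely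
    divisible by p is not infinitely divisible by pi.  Divided by the largest
    possible power of pi it is no longer in the maximal ideal. *)
Lemma ring_of_integers_dvr : totally_ramified K p ->
  exists pi, dvr_in (integers_incl K) pi.
Proof.
move=> [pi [nonunit [u [[u' uu'] pE]]]].
have pi_nonunit x : pi * x != 1.
  apply/eqP => px; have [_ /(_ _)[]] := nonunit pi; last by exists x.
  by exists 1; rewrite mul1r.
have e_gt0 : (0 < \dim {:K})%N by apply: adim_gt0.
have pi0 : pi != 0.
  apply: contraNneq p_neq0_O => pi0.
  by rewrite pE pi0 expr0n gtn_eqF // mulr0.
have val_pi x : x != 0 -> exists u u' v, u * u' = 1 /\ x = u * pi ^+ v.
  move=> x0; have [n xn] := integers_separated x0.
  pose ndiv v := `[< forall y, x <> pi ^+ v * y >].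
  have ex_v : exists v, ndiv v.
    (* p^n and pi^(e n), with e the degree of K, differ by a unit. *)
    exists (\dim {:K} * n)%N; apply/asboolP => y xy.
    apply: (xn (u' ^+ n * y)); rewrite pE exprMn -exprM.
    rewrite -[RHS]mulrA [pi ^+ _ * _]mulrCA -xy mulrA -exprMn uu' expr1n mul1r.
    by [].
  case: (ex_minnP ex_v) => -[/asboolP/(_ x)|v /asboolP v_ndiv v_min].
    by rewrite expr0 mul1r.
  have [y xy] : exists y, x = pi ^+ v * y.
    apply: contrapT => no_y; have : (v.+1 <= v)%N.
      by apply: v_min; apply/asboolP => y xy; apply: no_y; exists y.
    by rewrite ltnn.
  have [[y' yy']|y_nonunit] := pselect (exists y', y * y' = 1).
    by exists y, y', v; split=> //; rewrite mulrC.
  have [z yz] := (nonunit y).1 y_nonunit.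
  by case: (v_ndiv z); rewrite xy yz exprSr -mulrA [pi * z]mulrC.
exists pi; split=> //; first exact: val_inj.
move=> x; have [w [y [w0 wx]]] := integers_frac x.
have wO : iota w \in @integers W K by apply/in_integers/integral_id.
exists y, (exist (fun z : K => z \in @integers W K) _ wO); split=> //.
rewrite -(inj_eq val_inj) /=; apply: contra_neq w0 => w0.
by apply: iota_inj; rewrite rmorph0.
Qed.

End RingOfIntegers.

Theorem theorem2 (p : nat) (p_prime : prime p) (p_odd : odd p)
    (k : fieldType) (k_perfect : perfect_field p k)
    (W : idomainType) (W_Witt : is_Witt_ring p k W)
    (K : fieldExtType {fraction W}) (K_ram : totally_ramified K p) :
  abelian_category (minimal_category (integers_incl K) p) /\
  abelian_category (maximal_category (integers_incl K) p).
Proof.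
have [pi dvr] := ring_of_integers_dvr p_prime p_odd k_perfect W_Witt K_ram.
have p_neq0 := p_neq0_O p_prime p_odd k_perfect W_Witt K.
split; first exact: (minimal_category_abelian dvr p_neq0).
exact: (maximal_category_abelian dvr p_neq0).
Qed.
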